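(* For each $t\in[0,T]$, $x\in\mathbb R^{n_L}$ and $a\in\Gamma$, $$V^\eta(t,\eta_L^\top x,a,S(r))\le V(t,x,a,r)\qquad\text{for all } r\in H(a).$$
   Context: Vector inequalities and $x^+=\max(x,0)$ are componentwise. **Production modes.** For each generator $k\in\mathcal N_G=\{1,\dots,n_G\}$ there is a finite set of production levels $\Theta_k=\{\theta_{k,1}<\dots<\theta_{k,n_k^\theta}\}\subset\mathbb R_+$ and a set $\Lambda_k\subset\Theta_k\times\Theta_k$ of allowed switches (one writes $l$ for $\theta_{k,l}$). Each $(l,m)\in\Lambda_k$ has a delay $\delta_{k,(l,m)}>0$, a switching cost $K_{k,(l,m)}\ge0$, and a monotone continuous ramp function $\theta^T_{k,(l,m)}$ on $[0,\delta_{k,(l,m)}]$ with $\theta^T_{k,(l,m)}(0)=\theta_{k,l}$, $\theta^T_{k,(l,m)}(\delta_{k,(l,m)})=\theta_{k,m}$; all ramp functions are Lipschitz with a common constant $C^{RR}$. Put $D_G=\prod_k[\theta_{k,1},\theta_{k,n_k^\theta}]$, $\Lambda=\bigcup_k\{k\}\times\Lambda_k$; for $\beta=(k,(l,m))\in\Lambda$ write $\beta^{\mathcal N}=k$, $\beta^f=l$, $\beta^t=m$, and $\delta_\beta,K_\beta$ for its delay and cost. Operation modes: $\Gamma=\prod_k(\Theta_k\cup\Lambda_k)$. For $a\in\Gamma$: $\Lambda(a)=\{(k,(l,m))\in\Lambda: a_k=l\}$, and $H(a)=\{r\in\mathbb R^{n_G}_+: r_k=0\text{ if }a_k\in\Theta_k,\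 r_k\in[0,\delta_{k,a_k})\text{ if }a_k\in\Lambda_k\}$. The production $\zeta(a,r)\in D_G$ is $\zeta_k(a,r)=a_k$ (the level) if $a_k\in\Theta_k$ and $\zeta_k(a,r)=\theta^T_{k,a_k}(r_k)$ if $a_k\in\Lambda_k$. **Feasible sets.** $c\in\mathbb R^{n_L}$ has positive components. For $i=0,\dots,n_c$, $G_i\subset\mathbb R^{n_G}\times\mathbb R^{n_L}_+$ is a closed set (feasible operating points in network configuration $i$), with $G_i(p_G)=\{p_D\in\mathbb R_+^{n_L}:(p_G,p_D)\in G_i\}$, satisfying: (A) $G_i$ is convex and compact; (B) for all $p_G\in D_G$, $p_D\in\mathbb R^{n_L}_+$ there is $z\ge0$ with $(p_G,p_D-z)\in G_i$; (C) for all $p_G\in D_G$, $(\{p_G\}\times G_i(p_G))\cap\operatorname{int}G_i\ne\emptyset$; (D) if $(p_G,p_D)\in G_i$ and $0\le p_D'\le p_D$ then $(p_G,p_D')\in G_i$. $z_i^*(p_G,p_D)$ denotes a minimizer of $c^\top z$ over $z\in\mathbb R^{n_L}_+$ with $(p_G,p_D-z)\in G_i$. **Demand.** On a probability space carrying an $n_L$-dimensional Brownian motion $W$, $X_t=m(t)+Z_t$, $t\in[0,T]$, where $m:[0,T]\to\mathbb R^{n_L}_+$ is smooth with $\|m(t)-m(s)\|\le C^m|t-s|$, and $dZ_t=-\gamma Z_tdt+\sigma dW_t$, $Z_0=x_0-m(0)$, with scalar $\gamma\ge0$ and nonsingular $\sigma\in\mathbb R^{n_L\times n_L}$. $\mathcal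 F_t=\sigma(X_s:s\le t)$. $X^{t,x}$ is $X$ conditioned on $X_t=x$, i.e. $X^{t,x}_s=m(s)+Z_s$ with $Z$ solving the same SDE on $[t,T]$ from $Z_t=x-m(t)$. **Controls.** For $t\in[0,T]$, $a\in\Gamma$, $r\in H(a)$, $\mathcal V_{t,a,r}$ is the set of $v=(\tau_1,\dots,\tau_N;\beta_1,\dots,\beta_N)$ ($N$ finite, possibly random) with $\mathcal F$-stopping times $t\le\tau_1\le\dots\le\tau_N\le T$, $\beta_j$ $\mathcal F_{\tau_j}$-measurable with $\beta_j\in\Lambda(\alpha^{t,a,r}(\tau_j^-,v))$, and for each $k$ the times $\tau_1^k,\dots,\tau^k_{N_k}$ of the requests $\beta_{k,1},\dots,\beta_{k,N_k}$ with $\beta_j^{\mathcal N}=k$ strictly increasing. Here the mode $\alpha=\alpha^{t,a,r}(\cdot,v)$ and transition progression $\xi=\xi^{t,a,r}(\cdot,v)$ are: $\alpha(t^-)=a$, $\xi(t^-)=r$; with $\tau^k_{N_k+1}=\infty$, for $s\in[\tau_j^k,\tau_j^k+\delta_{\beta_{k,j}})$, $j\ge1$: $\alpha_k(s)=(\beta_{k,j}^f,\beta_{k,j}^t)$, $\xi_k(s)=s-\tau_j^k$; for $s\in[\tau_j^k+\delta_{\beta_{k,j}},\tau_{j+1}^k)$: $\alpha_k(s)=\beta_{k,j}^t$, $\xi_k(s)=0$; for $s\in[t,\tau_1^k)$: if $a_k\in\Theta_k$ then $\alpha_k(s)=a_k$, $\xi_k(s)=0$; if $a_k=(l,m)\in\Lambda_k$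 then $\alpha_k(s)=(l,m)$, $\xi_k(s)=s-t+r_k$ while $s-t+r_k<\delta_{k,a_k}$, and $\alpha_k(s)=m$, $\xi_k(s)=0$ afterwards. **Costs.** $C_G:D_G\to\mathbb R$ is continuous, $q_i\ge0$, and $f(x,a,r)=C_G(\zeta(a,r))+\sum_{i=0}^{n_c}q_i\,c^\top z_i^*(\zeta(a,r),x^+)$. For $v\in\mathcal V_{t,a,r}$, $J(t,x,a,r;v)=\mathbb E\big[\int_t^Tf(X_s^{t,x},\alpha^{t,a,r}(s,v),\xi^{t,a,r}(s,v))ds+\sum_{\tau_i\le T}K_{\beta_i}\big]$, and $V(t,x,a,r)=\inf_{v\in\mathcal V_{t,a,r}}J(t,x,a,r;v)$. **Lower-bound running cost.** Fix $\eta_L\in\mathbb R^{n_L}_+$ with $\|\eta_L\|=1$ and vectors $\eta_G^j\in\mathbb R^{n_G}$, $j\in\mathcal J=\{1,\dots,N_{\eta_G}\}$, $N_{\eta_G}\ge1$. Let $d_{i,j}^\eta=\max\{(\eta_G^j)^\top p_G+\eta_L^\top p_D:\ p_G\in D_G,\ p_D\in\mathbb R^{n_L}_+,\ (p_G,p_D)\in G_i\}$, and for $u,y\in\mathbb R$ let $c^\top z_{i,j}^\eta(u,y)=\min\{c^\top z: z\in\mathbb R^{n_L}_+,\ u+y-\eta_L^\top z\le d_{i,j}^\eta\}$. Set $f_1^\eta(y,a,r)=C_G(\zeta(a,r))+\max_{j\in\mathcal J}\sum_{i=0}^{n_c}q_i\,c^\top z_{i,j}^\eta((\eta_G^j)^\top\zeta(a,r),y)$.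 With $S(r)=\sum_kr_k$, $\delta_{k,a_k}:=0$ if $a_k\in\Theta_k$, and $\varsigma(a)=\sum_k\delta_{k,a_k}$, set $f_2^\eta(y,a,\rho)=\inf\{f_1^\eta(y,a,r): r\in H(a),\ S(r)=\rho\}$ for $\rho\in[0,\varsigma(a))$, where $[0,\varsigma(a))$ is read as $\{0\}$ if $\varsigma(a)=0$. **Lower-bound problem.** $X^\eta_t=\eta_L^\top X_t=\eta_L^\top m(t)+Z^\eta_t$, with $dZ^\eta_t=-\gamma Z_t^\eta dt+\sigma^\eta dW_t^\eta$, $\sigma^\eta=\|\eta_L^\top\sigma\|$, $W^\eta=\frac1{\sigma^\eta}\eta_L^\top\sigma W$; $\mathcal F^\eta$ is the filtration generated by $W^\eta$; $X^{\eta,t,y}$ is $X^\eta$ conditioned on $X^\eta_t=y$ (same SDE started at $y$ at time $t$). $N_T(a)=\#\{k:a_k\in\Lambda_k\}$. For $a\in\Gamma$, $w\in[0,\varsigma(a))$, $\mathcal V^{\eta,R}_{t,a,w}$ is the set of $v=(\tau_1,\dots,\tau_N;\beta_1,\dots,\beta_N;\vartheta_{-N_T(a)+1},\dots,\vartheta_0,\vartheta_1,\dots,\vartheta_N)$ where $t\le\tau_1\le\dots\le\tau_N\le T$ are $\mathcal F^\eta$-stopping times, $\beta_j$ is $\mathcal F^\eta_{\tau_j}$-measurable with $\beta_j\in\Lambda(\alpha^{\eta,t,a}(\tau_j^-,v))$ (request times for the same generator being strictly increasing), and the execution times $\vartheta_j$ are $\mathcal F^\eta$-stopping times, $\vartheta_j\ge\tau_j$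 for $j\ge1$, $\vartheta_j\ge t$ for $j\le0$ (values beyond $T$ allowed). The indices $j\le0$ enumerate the generators $\kappa$ in transition in mode $a$, with $\beta_j:=(\kappa,a_\kappa)$. The mode $\alpha^{\eta,t,a}(\cdot,v)$ starts from $\alpha^{\eta,t,a}(t^-)=a$; generator $\beta_j^{\mathcal N}$ is in transition $(\beta_j^f,\beta_j^t)$ from $\tau_j$ (from time $t$ if $j\le0$) until $\vartheta_j$, and is in level $\beta_j^t$ from $\vartheta_j$ until its next request; a generator stationary in $a$ stays in $a_k$ until its first request. The total progression is $\rho^{t,a,w}(s,v)=w+\int_t^sN_T(\alpha^{\eta,t,a}(u,v))du-\sum_{j:\,t\le\vartheta_j\le s}\delta_{\beta_j}$, and it is required that $0\le\rho^{t,a,w}(s,v)\le\varsigma(\alpha^{\eta,t,a}(s,v))$ for all $s\in[t,T]$. Finally $J^\eta(t,y,a,w;v)=\mathbb E\big[\int_t^Tf_2^\eta(X_s^{\eta,t,y},\alpha^{\eta,t,a}(s,v),\rho^{t,a,w}(s,v))ds+\sum_{t\le\tau_i\le T}K_{\beta_i}\big]$ and $V^\eta(t,y,a,w)=\inf_{v\in\mathcal V^{\eta,R}_{t,a,w}}J^\eta(t,y,a,w;v)$. *)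

(* Defs.v *)
From HB Require Import structures.
From mathcomp Require Import all_boot all_order all_algebra.
From mathcomp Require Import all_classical all_reals all_analysis.

Set Implicit Arguments.
Unset Strict Implicit.
Unset Printing Implicit Defensive.

Import Order.TTheory GRing.Theory Num.Theory.
Import numFieldNormedType.Exports.

Local Open Scope classical_set_scope.
Local Open Scope ring_scope.

(* Vectors of R^n are columns ['cV[R]_n].  Modes and transition progressions   *)
(* are defined path by path; a control is a random finite list of timed        *)
(* requests, and every constraint on a control is imposed at every sample      *)
(* point.  The natural filtrations are neither completed nor made              *)
(* right-continuous.                                                           *)

Section vectors.
Context {R : realType}.

Definition dot n (u v : 'cV[R]_n) : R := (u^T *m v) 0 0.

(* The norm of the library on matrices is the sup norm. *)
Definition enorm n (u : 'cV[R]_n) : R := Num.sqrt (dot u u).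

Definition cvle n (u v : 'cV[R]_n) : Prop := forall i, u i 0 <= v i 0.

Definition pospart n (u : 'cV[R]_n) : 'cV[R]_n :=
  map_mx (fun z => Num.max z 0) u.

Definition set_max (A : set R) : R := xget 0 [set v | A v /\ ubound A v].
Definition set_min (A : set R) : R := xget 0 [set v | A v /\ lbound A v].

End vectors.

(* Generator [k] has the [(nlev k).+1] levels [theta k l].  [ramp], [delay]    *)
(* and [swcost] are only relevant at the pairs of [switches k], and [ramp]     *)
(* only on [0, delay].                                                         *)
Unset Implicit Arguments.
Record fleet (R : realType) (nG : nat) := Fleet {
  nlev : 'I_nG -> nat;
  level := fun k => 'I_(nlev k).+1;
  theta : forall k, level k -> R;
  theta_ge0 : forall k l, 0 <= theta k l;
  theta_incr : forall k (l m : level k), (l < m)%N -> theta k l < theta k m;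
  switches : forall k, {set level k * level k};
  delay : forall k, level k * level k -> R;
  delay_gt0 : forall k lm, lm \in switches k -> 0 < delay k lm;
  swcost : forall k, level k * level k -> R;
  swcost_ge0 : forall k lm, lm \in switches k -> 0 <= swcost k lm;
  ramp : forall k, level k * level k -> R -> R;
  ramp_mono : forall k lm, lm \in switches k ->
    {in `[0, delay k lm] &, {homo ramp k lm : x y / x <= y}} \/
    {in `[0, delay k lm] &, {homo ramp k lm : x y / x <= y >-> y <= x}};
  ramp_cont : forall k lm, lm \in switches k ->
    {within `[0, delay k lm], continuous (ramp k lm)};
  ramp_start : forall k lm, lm \in switches k -> ramp k lm 0 = theta k lm.1;
  ramp_end : forall k lm, lm \in switches k ->
    ramp k lm (delay k lm) = theta k lm.2;
  rampLip : R;
  ramp_lip : forall k lm, lm \in switches k ->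
    {in `[0, delay k lm] &, forall x y,
      `|ramp k lm x - ramp k lm y| <= rampLip * `|x - y|}
}.
Set Implicit Arguments.
Arguments level {R nG} f k.
Arguments nlev {R nG} f k.
Arguments switches {R nG} f k.
Arguments theta {R nG f} k l.
Arguments delay {R nG f} k lm.
Arguments swcost {R nG f} k lm.
Arguments ramp {R nG f} k lm s.

Section modes.
Context {R : realType} {nG : nat} (F : fleet R nG).

Definition switch (k : 'I_nG) := {lm : level F k * level F k | lm \in switches F k}.
Definition gmode (k : 'I_nG) := (level F k + switch k)%type.
Definition mode := forall k, gmode k.
Definition request := {k : 'I_nG & switch k}.

Definition req_gen (b : request) : 'I_nG := tag b.
Definition req_switch (b : request) : switch (req_gen b) := tagged b.
Definition req_delay (b : request) : R := delay (req_gen b) (val (req_switch b)).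
Definition req_cost (b : request) : R := swcost (req_gen b) (val (req_switch b)).

Definition prodset : set 'cV[R]_nG :=
  [set p | forall k, theta k (ord0 : level F k) <= p k 0 <= theta k (ord_max : level F k)].

Definition allowed (a : mode) : set request :=
  [set b | a (req_gen b) = inl (val (req_switch b)).1].

Definition in_transition (a : mode) (k : 'I_nG) : bool :=
  if a k is inr _ then true else false.

Definition mode_delay (a : mode) (k : 'I_nG) : R :=
  if a k is inr b then delay k (val b) else 0.

Definition total_delay (a : mode) : R := \sum_k mode_delay a k.

Definition num_trans (a : mode) : nat := #|[pred k | in_transition a k]|.

Definition progset (a : mode) : set 'cV[R]_nG :=
  [set r | [/\ cvle 0 r,
      forall k, ~~ in_transition a k -> r k 0 = 0 &
      forall k, in_transition a k -> r k 0 < mode_delay a k]].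

Definition total_prog (r : 'cV[R]_nG) : R := \sum_k r k 0.

Definition production (a : mode) (r : 'cV[R]_nG) : 'cV[R]_nG :=
  \col_k match a k with
         | inl l => theta k l
         | inr b => ramp k (val b) (r k 0)
         end.

End modes.

Section model.
Context {R : realType} {nG : nat} (F : fleet R nG) (nL nc : nat).

Record network := Network {
  shedcost : 'cV[R]_nL;
  shedcost_gt0 : forall i, 0 < shedcost i 0;
  feas : 'I_nc.+1 -> set ('cV[R]_nG * 'cV[R]_nL);
  feas_ge0 : forall i p, feas i p -> cvle 0 p.2;
  feas_closed : forall i, closed (feas i);
  feas_convex : forall i, convex_set (feas i);
  feas_compact : forall i, compact (feas i);
  feas_shed : forall i pG pD, prodset F pG -> cvle 0 pD ->
    exists2 z, cvle 0 z & feas i (pG, pD - z);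
  feas_int : forall i pG, prodset F pG ->
    exists2 pD, feas i (pG, pD) & (feas i)° (pG, pD);
  feas_down : forall i pG pD pD', feas i (pG, pD) -> cvle 0 pD' ->
    cvle pD' pD -> feas i (pG, pD');
  shed : 'I_nc.+1 -> 'cV[R]_nG -> 'cV[R]_nL -> 'cV[R]_nL;
  shed_min : forall i pG pD, prodset F pG -> cvle 0 pD ->
    [/\ cvle 0 (shed i pG pD), feas i (pG, pD - shed i pG pD) &
        forall z, cvle 0 z -> feas i (pG, pD - z) ->
          dot shedcost (shed i pG pD) <= dot shedcost z]
}.

Record costs := Costs {
  prodcost : 'cV[R]_nG -> R;
  prodcost_cont : {within prodset F, continuous prodcost};
  weight : 'I_nc.+1 -> R;
  weight_ge0 : forall i, 0 <= weight i
}.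

Variables (N : network) (C : costs).

Definition run_cost (x : 'cV[R]_nL) (a : mode F) (r : 'cV[R]_nG) : R :=
  prodcost C (production a r) +
  \sum_i weight C i * dot (shedcost N) (shed N i (production a r) (pospart x)).

Record projection := Projection {
  nproj : nat;
  etaL : 'cV[R]_nL;
  etaL_ge0 : cvle 0 etaL;
  etaL_norm : enorm etaL = 1;
  etaG : 'I_nproj.+1 -> 'cV[R]_nG
}.

Variable E : projection.

Definition eta_bound (i : 'I_nc.+1) (j : 'I_(nproj E).+1) : R :=
  set_max [set dot (etaG j) p.1 + dot (etaL E) p.2 |
           p in [set p | [/\ prodset F p.1, cvle 0 p.2 & feas N i p]]].

Definition eta_shedcost (i : 'I_nc.+1) (j : 'I_(nproj E).+1) (u y : R) : R :=
  set_min [set dot (shedcost N) z |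
           z in [set z | cvle 0 z /\ u + y - dot (etaL E) z <= eta_bound i j]].

Definition eta_shedsum (y : R) (a : mode F) (r : 'cV[R]_nG)
    (j : 'I_(nproj E).+1) : R :=
  \sum_i weight C i * eta_shedcost i j (dot (etaG j) (production a r)) y.

Definition f1eta (y : R) (a : mode F) (r : 'cV[R]_nG) : R :=
  prodcost C (production a r) +
  \big[Num.max/eta_shedsum y a r ord0]_j eta_shedsum y a r j.

(* The value is +oo when no [r] qualifies; for an admissible control this      *)
(* happens only at instants where the total progression equals a positive      *)
(* [total_delay], a Lebesgue-null set of times.                                *)
Definition f2eta (y : R) (a : mode F) (rho : R) : \bar R :=
  ereal_inf [set (f1eta y a r)%:E | r in [set r | progset a r /\ total_prog r = rho]].

End model.

Arguments projection R nG nL : clear implicits.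

Section processes.
Context {R : realType} {disp : measure_display} {Omega : measurableType disp}.
Notation mu := (@lebesgue_measure R).

Definition natural_filtration (I : Type) (Y : I -> R -> Omega -> R) (s : R) :
    set (set Omega) :=
  <<s [set A | exists i (u : R) (B : set R),
        [/\ 0 <= u <= s, measurable B & A = Y i u @^-1` B]] >>.

Definition coords n (Y : R -> Omega -> 'cV[R]_n) (i : 'I_n) (s : R) (w : Omega) : R :=
  Y s w i 0.

Definition stopping_time (Fil : R -> set (set Omega)) (D : set R)
    (tau : Omega -> \bar R) : Prop :=
  forall s, D s -> Fil s [set w | (tau w <= s%:E)%E].

(* Increments over [r, s] are independent of the past up to [r], with          *)
(* independent N(0, s - r) coordinates; [normal_prob] takes the standard       *)
(* deviation.                                                                  *)
Definition brownian (P : probability Omega R) n (W : R -> Omega -> 'cV[R]_n) : Prop :=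
  [/\ forall w, W 0 w = 0,
      forall w i, {within `[0, +oo[, continuous (fun s : R => W s w i 0)},
      forall (s : R) i, 0 <= s -> measurable_fun setT (fun w => W s w i 0) &
      forall (r s : R) A (B : 'I_n -> set R), 0 <= r -> r < s ->
        natural_filtration (coords W) r A -> (forall i, measurable (B i)) ->
        P (A `&` [set w | forall i, B i (W s w i 0 - W r w i 0)]) =
        (P A * \prod_(i < n) normal_prob 0 (Num.sqrt (s - r)) (B i))%E].

(* [p] solves dp = - gamma p ds + dn on [t, T] from [p t = z].  The driving    *)
(* noises are additive, so the stochastic differential equation is this        *)
(* pathwise integral equation.                                                 *)
Definition ou_path (gamma t T z : R) (n p : R -> R) : Prop :=
  {within `[t, T], continuous p} /\
  forall s, t <= s <= T ->
    p s = z - gamma * \int[mu]_(u in `[t, s]) p u + (n s - n t).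

End processes.

Section control.
Context {R : realType} {nG : nat} (F : fleet R nG).
Notation mu := (@lebesgue_measure R).

(* The requests addressed to generator [k], in order; [D] is the type of the   *)
(* data, such as the request time, attached to a request.                      *)
Definition requests_of (D : Type) (k : 'I_nG) (v : seq (D * request F)) :
    seq (D * switch F k) :=
  pmap (fun p => untag None (fun b => Some (p.1, b)) p.2) v.

Definition last_such (D : Type) (Q : pred D) (v : seq D) : option D :=
  ohead (rev [seq x <- v | Q x]).

(* A sample of a control: pairs (tau_j, beta_j). *)
Definition strategy := seq (R * request F).

(* State of generator [k] at time [s]: its mode and its progression.  Before   *)
(* time [t] the state is kept at the initial one, so that the left limit of    *)
(* the mode at [t] is [a].                                                     *)
Definition gen_state (t : R) (a : mode F) (r : 'cV[R]_nG) (v : strategy) (s : R)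
    (k : 'I_nG) : gmode F k * R :=
  if s < t then (a k, r k 0) else
  match last_such (fun p => p.1 <= s) (requests_of k v) with
  | Some (tau, b) =>
      if s < tau + delay k (val b) then (inr b, s - tau) else (inl (val b).2, 0)
  | None =>
      match a k with
      | inl l => (inl l, 0)
      | inr b => if s - t + r k 0 < delay k (val b) then (inr b, s - t + r k 0)
                 else (inl (val b).2, 0)
      end
  end.

Definition mode_at t a r v s : mode F := fun k => (gen_state t a r v s k).1.
Definition prog_at t a r v s : 'cV[R]_nG := \col_k (gen_state t a r v s k).2.

(* A sample of a relaxed control: the triples ((tau_j, vartheta_j), beta_j),   *)
(* j >= 1, and the execution times of the generators in transition in the      *)
(* initial mode; the latter are irrelevant at the other generators.            *)
Definition rstrategy := (seq ((R * \bar R) * request F) * ('I_nG -> \bar R))%type.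

Definition rmode_at (t : R) (a : mode F) (v : rstrategy) (s : R) : mode F :=
  fun k =>
  if s < t then a k else
  match last_such (fun p => p.1.1 <= s) (requests_of k v.1) with
  | Some (tau, vth, b) => if (s%:E < vth)%E then inr b else inl (val b).2
  | None =>
      match a k with
      | inl l => inl l
      | inr b => if (s%:E < v.2 k)%E then inr b else inl (val b).2
      end
  end.

Definition rprog_at (t : R) (a : mode F) (w : R) (v : rstrategy) (s : R) : R :=
  w + \int[mu]_(u in `[t, s]) (num_trans (rmode_at t a v u))%:R
  - (\sum_(k | in_transition a k && (t%:E <= v.2 k <= s%:E)%E) mode_delay a k
     + \sum_(p <- v.1 | (t%:E <= p.1.2 <= s%:E)%E) req_delay p.2).

(* [b] can be requested at time [s] when the mode evolves along [alpha]: it is *)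
(* allowed in the left limit of the (piecewise constant) mode at [s].          *)
Definition allowed_before (alpha : R -> mode F) (s : R) (b : request F) : Prop :=
  exists2 a, (\forall u \near s^'-, alpha u = a) & allowed a b.

Context {disp : measure_display} {Omega : measurableType disp}.

(* Beyond the last request all times are +oo. *)
Definition nth_time (D : Type) (time : D -> \bar R)
    (v : Omega -> seq (D * request F)) (j : nat) (w : Omega) : \bar R :=
  if onth (v w) j is Some p then time p.1 else +oo%E.

(* beta_j is measurable with respect to the sigma-algebra of tau_j. *)
Definition request_adapted (Fil : R -> set (set Omega)) (S : set R) (D : Type)
    (time : D -> R) (v : Omega -> seq (D * request F)) (j : nat) : Prop :=
  forall s b, S s ->
    Fil s [set w | exists2 x, onth (v w) j = Some (x, b) & time x <= s].

Definition admissible (Fil : R -> set (set Omega)) (t T : R) (a : mode F)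
    (r : 'cV[R]_nG) : set (Omega -> strategy) :=
  [set v |
   [/\ forall w, sorted <=%R (map fst (v w)) /\
                 {in v w, forall p, t <= p.1 <= T},
       forall j, stopping_time Fil `[0, T] (nth_time EFin v j),
       forall j, request_adapted Fil `[0, T] id v j,
       forall w, {in v w, forall p,
         allowed_before (mode_at t a r (v w)) p.1 p.2} &
       forall w k, sorted <%R (map fst (requests_of k (v w)))]].

Definition radmissible (Fil : R -> set (set Omega)) (t T : R) (a : mode F)
    (rho0 : R) : set (Omega -> rstrategy) :=
  [set v |
   let v1 := fun w => (v w).1 in
   [/\ forall w, sorted <=%R [seq p.1.1 | p <- v1 w] /\
                 {in v1 w, forall p, t <= p.1.1 <= T},
       forall j, stopping_time Fil `[0, +oo[ (nth_time (fun x => x.1%:E) v1 j) /\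
                 request_adapted Fil `[0, +oo[ fst v1 j,
       forall w, {in v1 w, forall p,
         allowed_before (rmode_at t a (v w)) p.1.1 p.2},
       forall w k, sorted <%R [seq p.1.1 | p <- requests_of k (v1 w)] &
       [/\ forall j, stopping_time Fil `[0, +oo[ (nth_time snd v1 j),
           forall w, {in v1 w, forall p, (p.1.1%:E <= p.1.2)%E},
           forall k, in_transition a k ->
             stopping_time Fil `[0, +oo[ (fun w => (v w).2 k) /\
             forall w, (t%:E <= (v w).2 k)%E &
           forall w s, t <= s <= T ->
             0 <= rprog_at t a rho0 (v w) s <= total_delay (rmode_at t a (v w) s)]]].

End control.

Section values.
Context {R : realType} {disp : measure_display} {Omega : measurableType disp}.
Context (P : probability Omega R) {nG : nat} (F : fleet R nG) (nL nc : nat).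
Notation mu := (@lebesgue_measure R).

(* [Zflow t z] is the Ornstein-Uhlenbeck process started at [z] at time [t].   *)
(* Smoothness of [mean] on [0, horizon] is that of an extension to the line.   *)
Record demand := Demand {
  horizon : R;
  W : R -> Omega -> 'cV[R]_nL;
  W_brownian : brownian P W;
  mean : R -> 'cV[R]_nL;
  mean_ge0 : forall s : R, 0 <= s <= horizon -> cvle 0 (mean s);
  mean_smooth : forall i, exists g : R -> R,
    (forall n x, derivable (derive1n n g) x 1) /\
    forall s : R, 0 <= s <= horizon -> mean s i 0 = g s;
  meanLip : R;
  mean_lip : forall s u : R, 0 <= s <= horizon -> 0 <= u <= horizon ->
    enorm (mean s - mean u) <= meanLip * `|s - u|;
  reversion : R;
  reversion_ge0 : 0 <= reversion;
  vol : 'M[R]_nL;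
  vol_unit : vol \in unitmx;
  x0 : 'cV[R]_nL;
  Zflow : R -> 'cV[R]_nL -> R -> Omega -> 'cV[R]_nL;
  Zflow_ou : forall (t : R) (z : 'cV[R]_nL) w i, 0 <= t <= horizon ->
    ou_path reversion t horizon (z i 0) (fun s => (vol *m W s w) i 0)
      (fun s => Zflow t z s w i 0)
}.

Variable X : demand.

Definition demand_from (t : R) (x : 'cV[R]_nL) (s : R) (w : Omega) : 'cV[R]_nL :=
  mean X s + Zflow X t (x - mean X t) s w.

Definition demand_filtration : R -> set (set Omega) :=
  natural_filtration (coords (demand_from 0 (x0 X))).

Variables (N : network F nL nc) (C : costs F nc).

Definition J (t : R) (x : 'cV[R]_nL) (a : mode F) (r : 'cV[R]_nG)
    (v : Omega -> strategy F) : \bar R :=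
  (\int[P]_w (\int[mu]_(s in `[t, horizon X])
                (run_cost N C (demand_from t x s w)
                   (mode_at t a r (v w) s) (prog_at t a r (v w) s))%:E
              + (\sum_(p <- v w) req_cost p.2)%:E))%E.

Definition V (t : R) (x : 'cV[R]_nL) (a : mode F) (r : 'cV[R]_nG) : \bar R :=
  ereal_inf [set J t x a r v | v in
             admissible demand_filtration t (horizon X) a r].

Variable E : projection R nG nL.

Definition eta_vol : R := enorm ((vol X)^T *m etaL E).

Definition Weta (s : R) (w : Omega) : R :=
  eta_vol^-1 * dot (etaL E) (vol X *m W X s w).

Definition eta_filtration : R -> set (set Omega) :=
  natural_filtration (fun _ : unit => Weta).

(* [Zeta t z] is the scalar Ornstein-Uhlenbeck process started at [z] at       *)
(* time [t].                                                                   *)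
Definition eta_ou (Zeta : R -> R -> R -> Omega -> R) : Prop :=
  forall t z w, 0 <= t <= horizon X ->
    ou_path (reversion X) t (horizon X) z (fun s => eta_vol * Weta s w)
      (fun s => Zeta t z s w).

Variable Zeta : R -> R -> R -> Omega -> R.

Definition eta_demand_from (t y s : R) (w : Omega) : R :=
  dot (etaL E) (mean X s) + Zeta t (y - dot (etaL E) (mean X t)) s w.

Definition Jeta (t y : R) (a : mode F) (rho0 : R) (v : Omega -> rstrategy F) : \bar R :=
  (\int[P]_w (\int[mu]_(s in `[t, horizon X])
                f2eta N C E (eta_demand_from t y s w)
                  (rmode_at t a (v w) s) (rprog_at t a rho0 (v w) s)
              + (\sum_(p <- (v w).1) req_cost p.2)%:E))%E.

Definition Veta (t y : R) (a : mode F) (rho0 : R) : \bar R :=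
  ereal_inf [set Jeta t y a rho0 v | v in
             radmissible eta_filtration t (horizon X) a rho0].

End values.

(* Main.v *)
(* Given an admissible control of the full problem and e > 0, we construct one  *)
(* of the lower-bound problem whose cost is larger by at most e.  Path by path, *)
(* [f1eta] is below the running cost, and [f2eta] is below [f1eta] along the    *)
(* actual progressions; so the same requests would do, were they adapted to the *)
(* filtration of [Weta].  After a rotation of the Brownian motion, [Weta] is a  *)
(* multiple of one coordinate, independent of the others.  Freezing the others  *)
(* at a sample point [w'] makes the control adapted to [Weta], and by Tonelli   *)
(* some [w'] yields a cost close to the mean or below it, because the projected *)
(* demand only depends on [Weta].                                               *)
(* Admissibility is required at every sample point, hence also for the frozen   *)
(* control, and nothing is completed.  So the requests are first delayed to a   *)
(* time grid, at an arbitrarily small cost.  The control then has countably     *)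
(* many values, and what it announces at a grid point is an event that lifts to *)
(* the product of two copies of the sample space (for [Weta] and for the other  *)
(* coordinates); off the diagonal, announcements are obeyed only as long as     *)
(* they extend what has already been done to an admissible list of requests.    *)

Require Import Defs.
From HB Require Import structures.
From mathcomp Require Import all_boot all_order all_algebra.
From mathcomp Require Import all_classical all_reals all_analysis.
From mathcomp Require Import measurable_realfun.
From mathcomp Require Import ring lra.
Set Implicit Arguments.
Unset Strict Implicit.
Unset Printing Implicit Defensive.
Import Order.TTheory GRing.Theory Num.Theory.
Import numFieldNormedType.Exports.
Local Open Scope classical_set_scope.
Local Open Scope ring_scope.

(** The lower-bound problem relaxes the full one in several ways, none of which can raise the cost.
    A feasible operating point satisfies the half-space inequality that defines [eta_bound], so the
    load shed in the full problem is a candidate in the scalar one, whence [f1eta_le_run_cost].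
    Keeping only the sum of the progressions replaces [f1eta] by an infimum ([f2eta_le]). Executing
    each request exactly one delay after it is made is one of the choices of a relaxed control, and
    its total progression is then the sum of the true ones ([relax_prog_at]). Finally, the
    projection of the demand solves the scalar equation path by path, and that equation has one
    solution ([eta_demandE]).

    What remains is a question of information: the full control sees all of the demand, the relaxed
    one only [Weta]. By [align_eta] and [indep_processes], [Weta] is a multiple of one coordinate of
    a Brownian motion, independent of the other coordinates, which may therefore be averaged out
    ([integral_diagonal]); some frozen value of them does almost as well as the average
    ([exists_good_section]).

    Freezing evaluates a control at a pair of sample points [(w, w')], where it has no meaning
    unless [w = w']. Once [encode] has moved the requests to a grid, at a price bounded by
    [rounding_cost], the control is described by countably many events at finitely many dates.
    [causal_lift] extends each of them from the diagonal to the product, and [select] reads off a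
    control that obeys all constraints everywhere ([select_served]) and is the rounded one on the
    diagonal ([select_encode]). *)

Section integral_comparison.
Local Open Scope ereal_scope.
Context d (T : measurableType d) (R : realType) (mu : {measure set T -> \bar R}).
Implicit Types (D : set T) (f g k : T -> \bar R).

(** The integral of a nonnegative function is a supremum over the nonnegative simple functions below
    it, so it is monotone even without measurability. This matters because [run_cost] and [f2eta]
    along a path are never shown to be measurable. *)
Lemma ge0_le_integral_pointwise D f g :
  (forall x, D x -> 0 <= f x) -> (forall x, D x -> f x <= g x) ->
  \int[mu]_(x in D) f x <= \int[mu]_(x in D) g x.
Proof.
move=> f0 fg; rewrite !ge0_integralE//; last first.
  by move=> x Dx; rewrite (le_trans (f0 _ Dx))// fg.
apply: ereal_sup_le => _ [h /= hf <-].
exists h => // x; apply: (le_trans (hf x)).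
rewrite /patch; case: ifPn => //; rewrite inE => /fg; exact.
Qed.

Lemma le_integral_pointwise D f g :
  (forall x, D x -> f x <= g x) ->
  \int[mu]_(x in D) f x <= \int[mu]_(x in D) g x.
Proof.
move=> fg; rewrite (integralE mu D f) (integralE mu D g).
apply: leeB.
  apply: ge0_le_integral_pointwise => x Dx; first exact: funepos_ge0.
  rewrite !funeposE ge_max !le_max lexx orbT andbT; apply/orP; left; exact: fg.
apply: ge0_le_integral_pointwise => x Dx; first exact: funeneg_ge0.
rewrite !funenegE ge_max !le_max lexx orbT andbT; apply/orP; left.
by rewrite leeN2 fg.
Qed.

(** Since [g] may fail to be measurable, [k] cannot be added to it under the integral. Instead
    [f - k], whose negative part is at most [k], is integrated and then compared with [g]. *)
Lemma integral_le_perturbation D f g k (A : R) : measurable D ->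
  measurable_fun D f -> measurable_fun D k ->
  (forall x, D x -> 0 <= f x) -> (forall x, D x -> 0 <= k x < +oo) ->
  (forall x, D x -> f x - k x <= g x) ->
  \int[mu]_(x in D) k x <= A%:E ->
  \int[mu]_(x in D) f x <= \int[mu]_(x in D) g x + A%:E.
Proof.
move=> mD mf mk f0 k0 fkg kA.
pose h x := f x - k x.
have mh : measurable_fun D h by exact: emeasurable_funB.
have hg : \int[mu]_(x in D) h x <= \int[mu]_(x in D) g x.
  exact: le_integral_pointwise.
have negA : \int[mu]_(x in D) h^\- x <= A%:E.
  apply: le_trans kA; apply: ge0_le_integral_pointwise.
    by move=> x _; exact: funeneg_ge0.
  move=> x Dx; have /andP[k1 k2] := k0 x Dx.
  rewrite funenegE ge_max k1 andbT /h fin_num_oppeB; last by rewrite ge0_fin_numE.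
  by rewrite -[leRHS]add0e leeD2r// oppe_le0 f0.
have negfin : \int[mu]_(x in D) h^\- x \is a fin_num.
  rewrite ge0_fin_numE ?(le_lt_trans negA) ?ltry//.
  by apply: integral_ge0 => x _; exact: funeneg_ge0.
(* Only nonnegative functions occur in [f + h^- = h^+ + k], so additivity applies even when [f] has
   an infinite integral. *)
have e : \int[mu]_(x in D) f x + \int[mu]_(x in D) h^\- x =
         \int[mu]_(x in D) h^\+ x + \int[mu]_(x in D) k x.
  have hp0 x : D x -> 0 <= h^\+ x by move=> _; exact: funepos_ge0.
  have hn0 x : D x -> 0 <= h^\- x by move=> _; exact: funeneg_ge0.
  have k1 x : D x -> 0 <= k x by move=> /k0/andP[].
  rewrite -ge0_integralD//; last exact: measurable_funeneg.
  rewrite -ge0_integralD//; last exact: measurable_funepos.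
  apply: eq_integral => x; rewrite inE => Dx.
  have /andP[k1x k2] := k0 x Dx.
  have kfin : k x \is a fin_num by rewrite ge0_fin_numE.
  rewrite funenegE funeposE /h.
  case: (k x) kfin k1x => [s| |]//= _ s0.
  have := f0 x Dx; case: (f x) => [r| |]//= r0.
    rewrite -!EFinD -?EFinN -!EFin_max -!EFinD; congr (_%:E).
    rewrite !maxEle; case: ifP; case: ifP; lra.
  by rewrite (max_r (leNye _)) !addye// (max_l (leey _)) addye.
have -> : \int[mu]_(x in D) f x =
  \int[mu]_(x in D) h x + \int[mu]_(x in D) k x.
  rewrite (integralE mu D h) addeAC -e -addeA subee ?adde0//.
by rewrite leeD.
Qed.

End integral_comparison.

(** * Requests and states of a generator *)

Section last_such.
Context (D : Type).
Implicit Types (Q : pred D) (v : seq D).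

Lemma last_such_rcons Q v p :
  last_such Q (rcons v p) = if Q p then Some p else last_such Q v.
Proof. by rewrite /last_such filter_rcons; case: (Q p) => //; rewrite rev_rcons. Qed.

Lemma last_such_cons Q p v : last_such Q (p :: v) =
  if last_such Q v is Some q then Some q else if Q p then Some p else None.
Proof.
elim/last_ind: v => [|v q ih]; first by rewrite /last_such /=; case: (Q p).
by rewrite -rcons_cons !last_such_rcons ih; case: (Q q).
Qed.

Lemma last_such_filter Q Q' v : (forall p, Q p -> Q' p) ->
  last_such Q [seq p <- v | Q' p] = last_such Q v.
Proof.
move=> QQ'; elim/last_ind: v => [//|v q ih].
rewrite filter_rcons !last_such_rcons -ih.
case: (boolP (Q' q)) => [_|nQ'q]; first by rewrite last_such_rcons.
by case: (boolP (Q q)) => // /QQ'; rewrite (negbTE nQ'q).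
Qed.

End last_such.

Lemma last_such_map (D D' : Type) (h : D' -> D) (Q : pred D) (v : seq D') :
  last_such Q [seq h p | p <- v] = omap h (last_such (Q \o h) v).
Proof.
elim/last_ind: v => [//|v q ih].
by rewrite map_rcons !last_such_rcons ih /=; case: (Q (h q)).
Qed.

Lemma last_such_pred (D : eqType) (Q Q' : pred D) (v : seq D) :
  {in v, Q =1 Q'} -> last_such Q v = last_such Q' v.
Proof. by rewrite /last_such => /eq_in_filter->. Qed.

Lemma last_such_mem (D : eqType) (Q : pred D) (v : seq D) p :
  last_such Q v = Some p -> p \in v /\ Q p.
Proof.
elim/last_ind: v => [//|v q ih]; rewrite last_such_rcons mem_rcons inE.
case: ifPn => [Qq [<-]|_ /ih[-> Qp]]; first by rewrite eqxx.
by rewrite orbT.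
Qed.

Arguments requests_of : simpl never.

Section requests_of.
Context (R : realType) (nG : nat) (F : fleet R nG).

Lemma requests_of_cons (D : Type) k k' (b : switch F k') (x : D) v :
  requests_of k ((x, Tagged _ b) :: v) =
  (if k' =P k is ReflectT e then [:: (x, ecast i (switch F i) e b)] else [::])
  ++ requests_of k v.
Proof.
rewrite /requests_of /= /untag /=; case: eqP => e //=.
Qed.

Lemma requests_of_cons_eq (D : Type) k (b : switch F k) (x : D) v :
  requests_of k ((x, Tagged _ b) :: v) = (x, b) :: requests_of k v.
Proof.
rewrite requests_of_cons; case: eqP => // e.
by rewrite (eq_irrelevance e erefl).
Qed.

Lemma requests_of_cons_neq (D : Type) k k' (b : switch F k') (x : D) v :
  k' != k -> requests_of k ((x, Tagged _ b) :: v) = requests_of k v.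
Proof. by rewrite requests_of_cons; case: eqP. Qed.

Lemma requests_of_map (D D' : Type) (h : forall k, D -> switch F k -> D') k
    (v : seq (D * request F)) :
  requests_of k [seq (h (tag p.2) p.1 (tagged p.2), p.2) | p <- v] =
  [seq (h k q.1 q.2, q.2) | q <- requests_of k v].
Proof.
elim: v => [//|[x [k' b]] v ih] /=; case: (eqVneq k' k) => [e|ne].
  by subst k'; rewrite !requests_of_cons_eq ih.
by rewrite !requests_of_cons_neq// ih.
Qed.

Lemma requests_of_filter (D : Type) (Q : pred D) k (v : seq (D * request F)) :
  requests_of k [seq p <- v | Q p.1] = [seq q <- requests_of k v | Q q.1].
Proof.
elim: v => [//|[x [k' b]] v ih] /=; case: (eqVneq k' k) => [e|ne].
  subst k'; rewrite requests_of_cons_eq /=.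
  by case: ifP; rewrite ?requests_of_cons_eq ih.
by case: ifP; rewrite !requests_of_cons_neq// ih.
Qed.

Lemma mem_requests_of (D : eqType) k (v : seq (D * request F)) x (b : switch F k) :
  ((x, b) \in requests_of k v) = ((x, Tagged _ b) \in v).
Proof.
elim: v => [//|[x' [k' b']] v ih] /=; case: (eqVneq k' k) => [e|ne].
  subst k'; rewrite requests_of_cons_eq !inE ih.
  by rewrite !xpair_eqE eq_Tagged.
rewrite requests_of_cons_neq// inE ih; case: eqP => //= -[_ e].
by rewrite e eqxx in ne.
Qed.

Lemma big_requests_of (V : nmodType) (D : Type) (phi : D -> request F -> V)
    (v : seq (D * request F)) :
  \sum_(p <- v) phi p.1 p.2 =
  \sum_k \sum_(q <- requests_of k v) phi q.1 (Tagged _ q.2).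
Proof.
elim: v => [|[x [k' b]] v ih].
  by rewrite big_nil; under eq_bigr do rewrite big_nil; rewrite big1.
rewrite big_cons ih (bigD1 k')//= [in RHS](bigD1 k')//=.
rewrite requests_of_cons_eq big_cons /= addrA; congr (_ + _).
by apply: eq_bigr => k kk'; rewrite requests_of_cons_neq// eq_sym.
Qed.

Lemma size_requests_of (D : Type) (v : seq (D * request F)) :
  size v = (\sum_k size (requests_of k v))%N.
Proof.
elim: v => [|[x [k' b]] v ih]; first by rewrite big1.
rewrite [in RHS](bigD1 k')//= requests_of_cons_eq /= ih (bigD1 k')//=.
rewrite addSn; congr (_ + _).+1.
by apply: eq_bigr => k kk'; rewrite requests_of_cons_neq// eq_sym.
Qed.

End requests_of.

Lemma near_seq (T : eqType) (U : Type) (Fil : set_system U) {FF : Filter Fil}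
    (P : T -> U -> Prop) (l : seq T) :
  {in l, forall p, \forall u \near Fil, P p u} ->
  \forall u \near Fil, {in l, forall p, P p u}.
Proof.
elim: l => [_|p l ih Pl]; first by apply: nearW => u p; rewrite in_nil.
have Pp : \forall u \near Fil, P p u by apply: Pl; rewrite mem_head.
have Pl' : \forall u \near Fil, {in l, forall p, P p u}.
  by apply: ih => q ql; apply: Pl; rewrite inE ql orbT.
apply: filterS2 Pp Pl' => u Ppu Plu q; rewrite inE => /predU1P[->//|]; exact: Plu.
Qed.

(** * The life of one generator as a chain of timed switches *)

Section generator.
Context (R : realType) (nG : nat) (F : fleet R nG) (k : 'I_nG).
Implicit Types (p q : R * switch F k) (l L : seq (R * switch F k)).
Implicit Types (g : gmode F k) (t s rho : R) (lv : level F k).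

Definition endtime p := p.1 + delay k (val p.2).

Lemma endtime_gt p : p.1 < endtime p.
Proof. by rewrite ltrDl; apply: delay_gt0; exact: valP. Qed.

(** Strict, because a request is tested against the left limit of the mode: at the very end of a
    transition that limit is still the transition. *)
Definition follows p q := (endtime p < q.1) && ((val p.2).2 == (val q.2).1).

Definition chain lv L :=
  sorted follows L && (if L is q :: _ then lv == (val q.2).1 else true).

Lemma chain_rcons lv L q : chain lv (rcons L q) = chain lv L &&
  (if last_such predT L is Some p then follows p q else lv == (val q.2).1).
Proof.
case/lastP: L => [|L p]; first by [].
rewrite last_such_rcons /=; case: L => [|p' L]; rewrite /chain /=.
  by rewrite !andbT andbC.
by rewrite !rcons_path last_rcons andbAC.
Qed.

Lemma chain_rcons_endtime lv L q : chain lv (rcons L q) ->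
  {in L, forall p, endtime p < q.1}.
Proof.
elim/last_ind: L q => [//|L p ih] q; rewrite chain_rcons => /andP[cL].
rewrite last_such_rcons /= => /andP[pq _] p'; rewrite mem_rcons inE.
case/predU1P => [->//|p'L]; apply: lt_trans pq.
exact: lt_trans (ih _ cL _ p'L) (endtime_gt p).
Qed.

Lemma chain_rcons_lt lv L q : chain lv (rcons L q) -> {in L, forall p, p.1 < q.1}.
Proof. by move=> /chain_rcons_endtime qL p /qL; exact/lt_trans/endtime_gt. Qed.

Definition stage p s : gmode F k * R :=
  if s < endtime p then (inr p.2, s - p.1) else (inl (val p.2).2, 0).

Definition lstate lv L s : gmode F k * R :=
  if last_such (fun p => p.1 <= s) L is Some p then stage p s else (inl lv, 0).

Definition is_trans g : bool := if g is inr _ then true else false.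

(** Transitions along a chain do not overlap, so at most one term of each sum is nonzero. In this
    form the number of generators in transition can be integrated request by request. *)
Lemma lstate_sums lv L s : chain lv L ->
  (is_trans (lstate lv L s).1)%:R =
    \sum_(p <- L) (p.1 <= s < endtime p)%R%:R :> R /\
  (lstate lv L s).2 = \sum_(p <- L) (if p.1 <= s < endtime p then s - p.1 else 0).
Proof.
elim/last_ind: L => [_|L q ih cLq]; first by rewrite !big_nil.
have /ih{ih}[ih1 ih2] : chain lv L by move: cLq; rewrite chain_rcons => /andP[].
rewrite -!cats1 !big_cat !big_seq1 /= /lstate cats1 last_such_rcons.
case: (leP q.1 s) => [qs|sq] /=; last by rewrite !addr0; split; [exact: ih1|exact: ih2].
have ls p : p \in L -> s < endtime p = false.
  move=> pL; apply/negbTE; rewrite -leNgt.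
  by rewrite (le_trans (ltW (chain_rcons_endtime cLq pL))).
rewrite !big1_seq ?add0r.
- by rewrite /stage; case: ifP.
- by move=> p /= pL; rewrite ls// andbF.
- by move=> p /= pL; rewrite ls// andbF.
Qed.

Definition gstate t g rho l s : gmode F k * R :=
  if s < t then (g, rho) else
  match last_such (fun p => p.1 <= s) l with
  | Some p => stage p s
  | None =>
      match g with
      | inl lv => (inl lv, 0)
      | inr b => if s - t + rho < delay k (val b) then (inr b, s - t + rho)
                 else (inl (val b).2, 0)
      end
  end.

(* A transition in progress counts as a request made at time [t - rho]. *)
Definition ext t g rho l := if g is inr b then (t - rho, b) :: l else l.
Definition base g := match g with inl lv => lv | inr b => (val b).1 end.

Lemma ext_rcons t g rho l q : ext t g rho (rcons l q) = rcons (ext t g rho l) q.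
Proof. by case: g. Qed.

Lemma gstateE t g rho l s : t <= s -> 0 <= rho ->
  gstate t g rho l s = lstate (base g) (ext t g rho l) s.
Proof.
move=> ts rho0; rewrite /gstate ltNge ts /= /lstate.
case: g => [lv//|b]; rewrite /ext last_such_cons; case: last_such => //=.
have -> : t - rho <= s by lra.
rewrite /stage /endtime /=.
have -> : (s < t - rho + delay k (val b)) = (s - t + rho < delay k (val b)).
  by apply/idP/idP; lra.
by case: ifP => // _; congr (_, _); ring.
Qed.

(** The mode of [gstate] in the limit from the left: strict comparisons with [s] become weak and
    conversely. *)
Definition lmode t g rho l s : gmode F k :=
  if s <= t then g else
  match last_such (fun p => p.1 < s) l with
  | Some p => if s <= endtime p then inr p.2 else inl (val p.2).2
  | None =>
      match g with
      | inl lv => inl lv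
      | inr b => if s - t + rho <= delay k (val b) then inr b else inl (val b).2
      end
  end.

Lemma near_left_le (x s : R) : \forall u \near s^'-, (x <= u) = (x < s).
Proof.
case: (ltP x s) => [xs|sx].
  by near=> u; apply/idP; apply: ltW; near: u; exact: nbhs_left_gt.
near=> u; apply/negbTE; rewrite -ltNge; apply: lt_le_trans sx.
by near: u; exact: nbhs_left_lt.
Unshelve. all: by end_near. Qed.

Lemma near_left_lt (x s : R) : \forall u \near s^'-, (u < x) = (s <= x).
Proof.
by apply: filterS (near_left_le x s) => u e; rewrite ltNge e -leNgt.
Qed.

(** The mode depends on time through finitely many comparisons, each of which is constant just to
    the left of [s]. *)
Lemma gstate_left_limit t g rho l s :
  \forall u \near s^'-, (gstate t g rho l u).1 = lmode t g rho l s.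
Proof.
have H1 : \forall u \near s^'-, {in l, forall p, (p.1 <= u) = (p.1 < s)}.
  by apply: near_seq => p _; exact: near_left_le.
have H2 : \forall u \near s^'-, {in l, forall p, (u < endtime p) = (s <= endtime p)}.
  by apply: near_seq => p _; exact: near_left_lt.
have H3 : \forall u \near s^'-, (u < t) = (s <= t) by exact: near_left_lt.
have H4 : \forall u \near s^'-, if g is inr b then
    (u - t + rho < delay k (val b)) = (s - t + rho <= delay k (val b)) else True.
  case: g => [?|b]; first exact: nearW.
  apply: filterS (near_left_lt (delay k (val b) + t - rho) s) => u e.
  have -> : (u - t + rho < delay k (val b)) = (u < delay k (val b) + t - rho).
    by apply/idP/idP; lra.
  by rewrite e; apply/idP/idP; lra.
apply: filterS (filterI (filterI H1 H2) (filterI H3 H4)) => u [[h1 h2] [h3 h4]].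
rewrite /gstate /lmode h3; case: ifP => // _.
rewrite (last_such_pred (Q' := fun p => p.1 < s)); last exact: h1.
case E : last_such => [p|].
  by have [pl _] := last_such_mem E; rewrite /stage h2//; case: ifP.
by case: g h4 {H4} => // b ->; case: ifP.
Qed.

Lemma last_such_ltP l q : {in l, forall p, p.1 < q.1} ->
  last_such (fun p => p.1 < q.1) (rcons l q) = last_such predT l.
Proof.
move=> lq; rewrite last_such_rcons ltxx.
by apply: last_such_pred => p pl; rewrite lq.
Qed.

Lemma lmode_rcons t g rho l q s : s <= q.1 ->
  lmode t g rho (rcons l q) s = lmode t g rho l s.
Proof. by move=> sq; rewrite /lmode last_such_rcons ltNge sq. Qed.

(** Trades admissibility, phrased with left limits, for a combinatorial condition that is stable
    under changes of time and truncation; [lmode_of_chain] goes back. Induction on the last request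
    works because a request does not affect the mode before itself. *)
Lemma chain_of_lmode t g rho l : 0 <= rho -> (if g is inr b then rho < delay k (val b) else True) ->
  sorted <%R (map fst l) -> {in l, forall p, t <= p.1} ->
  {in l, forall p, lmode t g rho l p.1 = inl (val p.2).1} ->
  chain (base g) (ext t g rho l).
Proof.
move=> rho0 rhod; elim/last_ind: l => [|l q ih].
  by move=> _ _ _; case: (g) => [//|b]; rewrite /chain /= eqxx.
move=> srt tl all; rewrite ext_rcons chain_rcons.
have tp p : p \in l -> t <= p.1 by move=> pl; apply: tl; rewrite mem_rcons inE pl orbT.
have lq : {in l, forall p, p.1 < q.1}.
  move: srt; rewrite map_rcons -cats1 sorted_pairwise; last exact: lt_trans.
  rewrite pairwise_cat => /and3P[/allrelP h _ _] p pl.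
  by apply: h; rewrite ?inE//; exact: map_f.
have tq : t <= q.1 by apply: tl; rewrite mem_rcons mem_head.
apply/andP; split.
  apply: ih => [||p pl].
  - by move: srt; rewrite map_rcons => /(subseq_sorted lt_trans); apply; exact: subseq_rcons.
  - by move=> p pl; apply: tl; rewrite mem_rcons inE pl orbT.
  - rewrite -(@lmode_rcons _ _ _ _ q); last exact/ltW/lq.
    by apply: all; rewrite mem_rcons inE pl orbT.
have := all q; rewrite mem_rcons mem_head => /(_ isT).
rewrite /lmode last_such_ltP//.
case/lastP: l lq tp {ih srt tl all} => [|l p] lq tp.
  case: g rhod => [l1|b] rhod /=; first by case: ifP => _ [/eqP].
  case: ifPn => // qt; case: ifPn => // qd [e]; rewrite /follows /= e eqxx andbT.
  by rewrite /endtime /=; lra.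
have pq : p.1 < q.1 by apply: lq; rewrite mem_rcons mem_head.
rewrite last_such_rcons /= leNgt (le_lt_trans (tp p _) pq) ?mem_rcons ?mem_head//=.
rewrite ext_rcons last_such_rcons /=.
by case: ifPn => // + [pq']; rewrite -ltNge /follows => ->; rewrite pq' eqxx.
Qed.

Lemma lmode_of_chain t g rho l : 0 <= rho -> (if g is inr b then rho < delay k (val b) else True) ->
  {in l, forall p, t <= p.1} -> chain (base g) (ext t g rho l) ->
  {in l, forall p, lmode t g rho l p.1 = inl (val p.2).1}.
Proof.
move=> rho0 rhod; elim/last_ind: l => [//|l q ih] tl clq.
have lq p : p \in l -> p.1 < q.1.
  move=> pl; move: clq; rewrite ext_rcons => /chain_rcons_lt; apply.
  by case: (g) => // b; rewrite inE pl orbT.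
have tq : t <= q.1 by apply: tl; rewrite mem_rcons mem_head.
have tp p : p \in l -> t <= p.1 by move=> pl; apply: tl; rewrite mem_rcons inE pl orbT.
move: clq; rewrite ext_rcons chain_rcons => /andP[cl cq] p.
rewrite mem_rcons inE => /predU1P[->{p}|pl]; last first.
  by rewrite lmode_rcons ?ih// ltW// lq.
rewrite /lmode last_such_ltP//.
case/lastP: l lq cq tp {ih tl cl} => [|l p] lq cq tp.
  case: g rhod cq => [l1|b] rhod /=; first by move=> /eqP ->; rewrite if_same.
  move=> /andP[+ /eqP <-]; rewrite /endtime /= => bq.
  by rewrite !ifN// -ltNge; lra.
have pq : p.1 < q.1 by apply: lq; rewrite mem_rcons mem_head.
rewrite last_such_rcons /= leNgt (le_lt_trans (tp p _) pq) ?mem_rcons ?mem_head//=.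
move: cq; rewrite ext_rcons last_such_rcons /= => /andP[pq1 /eqP <-].
by rewrite ifN// -ltNge.
Qed.

(** A transition in progress at [t] keeps its end while the requests move, so the gap after it is
    protected by [x <= h x]; the last hypothesis protects the other gaps. *)
Lemma chain_map t g rho l (h : R -> R) : chain (base g) (ext t g rho l) ->
  (forall x, t <= x -> x <= h x) -> {in l, forall p, t <= p.1} ->
  (forall p (y : R), t <= p.1 -> endtime p < y -> endtime (h p.1, p.2) < h y) ->
  chain (base g) (ext t g rho [seq (h p.1, p.2) | p <- l]).
Proof.
move=> + hx + hp; elim/last_ind: l => [//|l q ih] + tl.
rewrite map_rcons !ext_rcons !chain_rcons => /andP[cl cq].
rewrite ih//=; last by move=> p pl; apply: tl; rewrite mem_rcons inE pl orbT.
have tq : q.1 <= h q.1 by apply: hx; apply: tl; rewrite mem_rcons mem_head.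
case/lastP: l cq tl {ih cl} => [|l p] cq tl.
  move: cq; case: (g) => //= b; rewrite /follows /= => /andP[bq ->]; rewrite andbT.
  exact: lt_le_trans tq.
move: cq; rewrite map_rcons !ext_rcons !last_such_rcons /follows /= => /andP[pq ->]; rewrite andbT.
by apply: hp => //; apply: tl; rewrite mem_rcons inE mem_rcons inE eqxx orbT.
Qed.

(** The requests that are dropped form a final segment, [Q] being downward closed. *)
Lemma chain_filter t g rho l (Q : pred R) : chain (base g) (ext t g rho l) ->
  (forall x y, x <= y -> Q y -> Q x) ->
  chain (base g) (ext t g rho [seq p <- l | Q p.1]).
Proof.
move=> + Qle; elim/last_ind: l => [//|l q ih].
move=> clq; rewrite filter_rcons; case: ifPn => Qq; last first.
  by apply: ih; move: clq; rewrite ext_rcons chain_rcons => /andP[].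
suff -> : [seq p <- l | Q p.1] = l by [].
apply/all_filterP/allP => p pl; apply: Qle Qq; apply: ltW.
by move: clq; rewrite ext_rcons => /chain_rcons_lt; apply; case: (g) => // b; rewrite inE pl orbT.
Qed.

Lemma chain_sorted t g rho l : chain (base g) (ext t g rho l) ->
  sorted <%R (map fst l).
Proof.
elim/last_ind: l => [//|l q ih] clq.
have lq p : p \in l -> p.1 < q.1.
  move=> pl; move: clq; rewrite ext_rcons => /chain_rcons_lt; apply.
  by case: (g) => // b; rewrite inE pl orbT.
move: clq; rewrite ext_rcons chain_rcons => /andP[/ih + _].
rewrite map_rcons -cats1 !(sorted_pairwise lt_trans) pairwise_cat => -> /=.
by rewrite andbT; apply/allrelP => x y /mapP[p pl ->]; rewrite inE => /eqP->; exact: lq.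
Qed.

(** Every request before [q] is followed by its whole delay before the next one is made. *)
Lemma chain_size t g rho l q (d : R) : (forall b : switch F k, d <= delay k (val b)) ->
  {in rcons l q, forall p, t <= p.1} -> chain (base g) (ext t g rho (rcons l q)) ->
  (size l)%:R * d <= q.1 - t.
Proof.
move=> dd; elim/last_ind: l q => [|l p ih] q tl.
  by rewrite mul0r subr_ge0 => _; apply: tl; rewrite mem_rcons mem_head.
rewrite ext_rcons => clq; have := clq.
rewrite chain_rcons => /andP[cl _].
have tp : {in rcons l p, forall p', t <= p'.1}.
  by move=> p' pl; apply: tl; rewrite mem_rcons inE pl orbT.
have {}ih := ih p tp cl.
have pq : endtime p < q.1.
  by apply: (chain_rcons_endtime clq); rewrite ext_rcons mem_rcons mem_head.
rewrite /endtime in pq; have dp := dd p.2.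
rewrite size_rcons -natr1 mulrDl mul1r.
lra.
Qed.

(** Postponing by at most [e] can change a comparison with [s] only if [s] lies within [e] after a
    request or after the end of a transition. *)
Lemma gstate_perturb t g rho l s (h : R -> R) (e : R) : 0 <= e ->
  {in l, forall p, p.1 <= h p.1 <= p.1 + e} ->
  {in l, forall p, ~~ (p.1 <= s < p.1 + e) && ~~ (endtime p <= s < endtime p + e)} ->
  let l' := [seq (h p.1, p.2) | p <- l] in
  (gstate t g rho l' s).1 = (gstate t g rho l s).1 /\
  `|(gstate t g rho l' s).2 - (gstate t g rho l s).2| <= e.
Proof.
move=> e0 hl sl /=; rewrite /gstate; case: ifP => _ /=; first by rewrite subrr normr0.
rewrite last_such_map (@last_such_pred _ _ (fun p => p.1 <= s)); last first.
  move=> p pl /=; have /andP[h1 h2] := hl p pl; have /andP[h3 h4] := sl p pl.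
  by apply/idP/idP; lra.
case E : last_such => [p|] /=; last by rewrite subrr normr0.
have [pl ps] := last_such_mem E.
have /andP[h1 h2] := hl p pl; have /andP[h3 h4] := sl p pl.
rewrite /stage /endtime /= in h4 *.
have -> : (s < h p.1 + delay k (val p.2)) = (s < p.1 + delay k (val p.2)).
  by apply/idP/idP; lra.
case: ifP => _ /=; last by rewrite subrr normr0.
by split=> //; rewrite ler_norml; lra.
Qed.

Lemma gstate_filter t g rho l s (Q : pred R) : (forall x, x <= s -> Q x) ->
  gstate t g rho [seq p <- l | Q p.1] s = gstate t g rho l s.
Proof.
move=> Qs; rewrite /gstate last_such_filter//.
by move=> p; exact: Qs.
Qed.

Lemma gstate_prog t g rho l s : t <= s -> 0 <= rho ->
  match (gstate t g rho l s).1 with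
  | inl _ => (gstate t g rho l s).2 = 0
  | inr b => 0 <= (gstate t g rho l s).2 < delay k (val b)
  end.
Proof.
move=> ts rho0; rewrite gstateE// /lstate.
case E : last_such => [p|//]; rewrite /stage; case: ifP => //= sp.
have [_ /= ps] := last_such_mem E.
by rewrite /endtime in sp; lra.
Qed.

End generator.

(** * Strategies of the fleet and the relaxed controls they induce *)

Section strategies.
Context (R : realType) (nG : nat) (F : fleet R nG).
Notation mu := (@lebesgue_measure R).
Context (t T : R) (a : mode F) (r : 'cV[R]_nG) (hr : progset a r).
Implicit Types (v : strategy F) (s : R) (k : 'I_nG).

Lemma gen_stateE v s k :
  gen_state t a r v s k = gstate t (a k) (r k 0) (requests_of k v) s.
Proof.
rewrite /gen_state /gstate; case: ifP => // _.
by case: last_such => [[tau b]|].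
Qed.

Lemma progset_ge0 k : 0 <= r k 0.
Proof. by case: hr => /(_ k); rewrite mxE. Qed.

Lemma progset_lt k : if a k is inr b then r k 0 < delay k (val b) else True.
Proof.
case: hr => _ _ /(_ k); rewrite /in_transition /mode_delay.
by case: (a k) => // b; exact.
Qed.

(** The constraints of [admissible] at one sample point, with chains in place of left limits. *)
Definition served v : Prop :=
  [/\ sorted <=%R (map fst v), {in v, forall p, t <= p.1 <= T} &
      forall k, chain (base (a k)) (ext t (a k) (r k 0) (requests_of k v))].

Lemma mode_at_left_limit v s :
  \forall u \near s^'-, mode_at t a r v u =
    (fun k => lmode t (a k) (r k 0) (requests_of k v) s) :> mode F.
Proof.
have H : \forall u \near s^'-, {in enum 'I_nG, forall k,
    (gstate t (a k) (r k 0) (requests_of k v) u).1 =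
    lmode t (a k) (r k 0) (requests_of k v) s}.
  by apply: near_seq => k _; exact: gstate_left_limit.
apply: filterS H => u H; apply: functional_extensionality_dep => k.
by rewrite /mode_at gen_stateE H// mem_enum.
Qed.

Lemma allowed_beforeE v s (b : request F) :
  allowed_before (mode_at t a r v) s b <->
  lmode t (a (req_gen b)) (r (req_gen b) 0) (requests_of (req_gen b) v) s =
  inl (val (req_switch b)).1.
Proof.
split=> [[a' Ha' /= <-]|lm]; last first.
  by eexists; [exact: mode_at_left_limit|].
have [u [-> -> //]] := @filter_ex _ s^'- _ _ (filterI Ha' (mode_at_left_limit v s)).
Qed.

Lemma served_of_allowed v : sorted <=%R (map fst v) ->
  {in v, forall p, t <= p.1 <= T} ->
  {in v, forall p, allowed_before (mode_at t a r v) p.1 p.2} ->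
  (forall k, sorted <%R (map fst (requests_of k v))) -> served v.
Proof.
move=> vs vT va vk; split=> // k.
apply: chain_of_lmode => //.
- exact: progset_ge0.
- exact: progset_lt.
- by move=> [tau b]; rewrite mem_requests_of => /vT /andP[].
- by move=> [tau b]; rewrite mem_requests_of => /va /allowed_beforeE.
Qed.

Lemma allowed_of_served v : served v ->
  {in v, forall p, allowed_before (mode_at t a r v) p.1 p.2}.
Proof.
move=> [_ vT vc] [tau [k b]] pv; apply/allowed_beforeE.
rewrite /req_gen /req_switch /=.
have pk : (tau, b) \in requests_of k v by rewrite mem_requests_of.
have vt : {in requests_of k v, forall p, t <= p.1}.
  by move=> [u b']; rewrite mem_requests_of => /vT /andP[].
exact: (lmode_of_chain (progset_ge0 k) (progset_lt k) vt (vc k) pk).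
Qed.

Lemma served_sorted v k : served v -> sorted <%R (map fst (requests_of k v)).
Proof. by move=> [_ _ /(_ k)]; exact: chain_sorted. Qed.

Lemma state_progset v s : t <= s -> progset (mode_at t a r v s) (prog_at t a r v s).
Proof.
move=> ts; have H k := gstate_prog (a k) (requests_of k v) ts (progset_ge0 k).
split=> [k|k|k]; rewrite /prog_at !mxE gen_stateE.
- by have := H k; case: (gstate _ _ _ _ _).1 => [_ ->//|b /andP[]].
- rewrite /in_transition /mode_at gen_stateE.
  by have := H k; case: (gstate _ _ _ _ _).1.
- rewrite /in_transition /mode_delay /mode_at gen_stateE.
  by have := H k; case: (gstate _ _ _ _ _).1 => // b /andP[].
Qed.

Lemma total_prog_bounds (a' : mode F) (r' : 'cV[R]_nG) : progset a' r' ->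
  0 <= total_prog r' <= total_delay a'.
Proof.
move=> [r0 r1 r2]; rewrite /total_prog /total_delay; apply/andP; split.
  by apply: sumr_ge0 => k _; have := r0 k; rewrite mxE.
apply: ler_sum => k _; have [/r2/ltW//|nk] := boolP (in_transition a' k).
rewrite r1//; move: nk; rewrite /in_transition /mode_delay.
by case: (a' k).
Qed.

(** The relaxed control that executes each request exactly one delay after it is made. The value [t]
    at a generator stationary in [a] is a placeholder. *)
Definition relax v : rstrategy F :=
  ([seq ((p.1, (p.1 + req_delay p.2)%:E), p.2) | p <- v],
   fun k => if a k is inr b then (t + delay k (val b) - r k 0)%:E else t%:E).

Lemma requests_of_relax v k : requests_of k (relax v).1 =
  [seq ((q.1, (endtime q)%:E), q.2) | q <- requests_of k v].
Proof.
exact: (requests_of_map (fun k x b => (x, (x + delay k (val b))%:E))).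
Qed.

Lemma relax_mode_at v s : rmode_at t a (relax v) s = mode_at t a r v s.
Proof.
apply: functional_extensionality_dep => k; rewrite /mode_at gen_stateE /rmode_at /gstate.
case: ifP => // _; rewrite requests_of_relax last_such_map.
rewrite -[last_such (_ \o _) _]/(last_such (fun p => p.1 <= s) (requests_of k v)).
case: last_such => [p|] /=; first by rewrite /stage lte_fin; case: ifP.
case: (a k) => // b; rewrite lte_fin.
have -> : (s < t + delay k (val b) - r k 0) = (s - t + r k 0 < delay k (val b)).
  by apply/idP/idP; lra.
by case: ifP.
Qed.

Lemma windowE (al be u : R) : (al <= u < be)%R%:R = \1_(`[al, be[%classic) u :> R.
Proof. by rewrite indicE mem_setE in_itv. Qed.

Lemma measurable_window (al be : R) (D : set R) :
  measurable_fun D (fun u => (al <= u < be)%R%:R%:E : \bar R).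
Proof.
under eq_fun do rewrite windowE.
by apply/measurable_EFinP; apply: measurable_indic.
Qed.

Lemma integral_window s (al be : R) : t <= s -> al < be -> t < be ->
  (\int[mu]_(u in `[t, s]) (al <= u < be)%R%:R%:E =
  (if s < Num.max t al then 0 else Num.min s be - Num.max t al)%:E)%E.
Proof.
move=> ts ab tb.
under eq_integral do rewrite windowE.
rewrite integral_indic//; case: ifPn => [sm|]; last rewrite -leNgt => ms.
  suff -> : `[al, be[ `&` `[t, s] = set0 by rewrite measure0.
  apply/seteqP; split=> // u /=; rewrite !in_itv /= => -[/andP[h1 h2] /andP[h3 h4]].
  by move: sm; rewrite lt_max => /orP[]; lra.
have [bs|sb] := leP be s.
  have -> : `[al, be[ `&` `[t, s] = `[Num.max t al, be[%classic.
    apply/seteqP; split=> u /=; rewrite !in_itv /= ge_max.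
      by move=> [/andP[-> ->] /andP[-> _]].
    move=> /andP[/andP[-> ->] ub]; rewrite ub; split=> //=.
    by apply: ltW; exact: lt_le_trans bs.
    rewrite /= lebesgue_measure_itv /= lte_fin gt_max tb ab EFinD//.
have -> : `[al, be[ `&` `[t, s] = `[Num.max t al, s]%classic.
  apply/seteqP; split=> u /=; rewrite !in_itv /= ge_max.
    by move=> [/andP[-> _] /andP[-> ->]].
  move=> /andP[/andP[-> ->] us]; rewrite us; split=> //=.
  exact: le_lt_trans sb.
rewrite /= lebesgue_measure_itv /= lte_fin; case: ifPn => [_|]; first by rewrite EFinD.
rewrite -leNgt => sm; congr EFin; apply/esym/eqP.
by rewrite subr_eq0 eq_le ms sm.
Qed.

(** Up to time [s] a request has spent in transition either its current progression or, once
    completed, its whole delay, and the latter is subtracted upon execution. *)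
Lemma relax_prog_at v s : served v -> t <= s ->
  rprog_at t a (total_prog r) (relax v) s = total_prog (prog_at t a r v s).
Proof.
move=> [_ vT vc] ts; rewrite /rprog_at.
have vt k p : p \in requests_of k v -> t <= p.1.
  by case: p => [u b']; rewrite mem_requests_of => /vT /andP[].
(* A transition in progress at [t] is dated [t - r k 0], hence the truncation [Num.max t p.1] in the
   lengths below. *)
pose exts k := ext t (a k) (r k 0) (requests_of k v).
have extsP k p : p \in exts k -> t < endtime p.
  rewrite /exts; have := progset_lt k; case: (a k) => [lv _|b rb] /=.
    by move=> /vt /le_lt_trans; apply; exact: endtime_gt.
  rewrite inE => /predU1P[->|/vt /le_lt_trans]; first by rewrite /endtime /=; lra.
  by apply; exact: endtime_gt.
have -> : \int[mu]_(u in `[t, s]) (num_trans (rmode_at t a (relax v) u))%:R =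
    \sum_k \sum_(p <- exts k)
      (if s < Num.max t p.1 then 0 else Num.min s (endtime p) - Num.max t p.1).
  have -> : \int[mu]_(u in `[t, s]) (num_trans (rmode_at t a (relax v) u))%:R =
      fine (\int[mu]_(u in `[t, s])
        \sum_k \sum_(p <- exts k) (p.1 <= u < endtime p)%R%:R%:E)%E.
    congr fine; apply: eq_integral.
    move=> u; rewrite inE /= in_itv /= => /andP[tu _].
    rewrite relax_mode_at /num_trans -sum1_card natr_sum big_mkcond /=.
    rewrite -sumEFin; apply: eq_bigr => k _; rewrite sumEFin; congr EFin.
    have [<- _] := lstate_sums u (vc k).
    rewrite -gstateE ?progset_ge0// inE /in_transition /mode_at gen_stateE.
    by rewrite /is_trans; case: (gstate _ _ _ _ _).1.
  rewrite ge0_integral_sum//=; last 2 first.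
  - move=> k; apply: emeasurable_sum => p; exact: measurable_window.
  - by move=> k u _; apply: sume_ge0 => p _; rewrite lee_fin.
  have -> : (\sum_k \int[mu]_(u in `[t, s]) \sum_(p <- exts k) (p.1 <= u < endtime p)%R%:R%:E =
    \sum_k (\sum_(p <- exts k)
      (if s < Num.max t p.1 then 0 else Num.min s (endtime p) - Num.max t p.1))%:E)%E.
    apply: eq_bigr => k _; rewrite ge0_integral_sum//=; last 1 first.
    - by move=> p; exact: measurable_window.
    rewrite -sumEFin big_seq [RHS]big_seq; apply: eq_bigr => p pk.
    by rewrite integral_window ?endtime_gt// extsP.
  by rewrite sumEFin.
have -> : \sum_(k | in_transition a k && (t%:E <= (relax v).2 k <= s%:E)%E) mode_delay a k +
    \sum_(p <- (relax v).1 | (t%:E <= p.1.2 <= s%:E)%E) req_delay p.2 =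
    \sum_k ((if a k is inr b then
       (if t + delay k (val b) - r k 0 <= s then delay k (val b) else 0) else 0) +
       \sum_(q <- requests_of k v) (if endtime q <= s then delay k (val q.2) else 0)).
  rewrite big_split /=; congr (_ + _).
    rewrite big_mkcond; apply: eq_bigr => k _; rewrite /in_transition /mode_delay.
    have := progset_lt k; case: (a k) => //= b rb; rewrite !lee_fin.
    by have -> : t <= t + delay k (val b) - r k 0 by lra.
  rewrite big_map big_mkcond /= (big_requests_of (fun x (b : request F) =>
    if (t%:E <= (x + req_delay b)%:E <= s%:E)%E then req_delay b else 0)).
  apply: eq_bigr => k _; rewrite !big_seq; apply: eq_bigr => q qk.
  rewrite !lee_fin /endtime /req_delay /req_gen /req_switch /=.
  by rewrite (le_trans (vt _ _ qk) (ltW (endtime_gt q))).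
rewrite /total_prog -big_split -sumrB /=; apply: eq_bigr => k _.
rewrite mxE gen_stateE gstateE ?progset_ge0//.
have [_ ->] := lstate_sums s (vc k).
have term q : q \in requests_of k v ->
  (if s < Num.max t q.1 then 0 else Num.min s (endtime q) - Num.max t q.1) =
  (if q.1 <= s < endtime q then s - q.1 else 0) +
  (if endtime q <= s then delay k (val q.2) else 0).
  move=> /vt tq; rewrite (max_r tq); have e1 := endtime_gt q.
  have e2 : endtime q = q.1 + delay k (val q.2) by [].
  case: (ltP s (endtime q)) => [sq|qs]; rewrite ?(min_l (ltW sq)) ?(min_r qs);
    case: (ltP s q.1) => h /=; lra.
have reqs : \sum_(q <- requests_of k v)
    (if s < Num.max t q.1 then 0 else Num.min s (endtime q) - Num.max t q.1) =
  \sum_(q <- requests_of k v) (if q.1 <= s < endtime q then s - q.1 else 0) +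
  \sum_(q <- requests_of k v) (if endtime q <= s then delay k (val q.2) else 0).
  by rewrite -big_split /= big_seq [RHS]big_seq; apply: eq_bigr => q /term.
rewrite /exts; have := progset_lt k; have := progset_ge0 k.
case: hr => _ /(_ k); rewrite /in_transition.
case: (a k) => [lv /(_ isT) rk _|b _ _] /=; rewrite ?big_cons reqs; first by rewrite rk => _ _; ring.
(* The transition in progress at [t] is integrated only from [t] on; the missing [r k 0] is its
   share of the initial value [total_prog r]. *)
move=> r0 rb.
rewrite /endtime /= max_l; last by lra.
case: (ltP s t) => [|_]; first by rewrite ltNge ts.
have -> /= : t - r k 0 <= s by lra.
case: (ltP s (t - r k 0 + delay k (val b))) => [sq|qs].
  rewrite ifN; first by ring.
  by rewrite -ltNge; lra.
rewrite ifT; last by lra.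
ring.
Qed.

End strategies.

(** * Running costs *)

Section topology_of_vectors.
Context (R : realType).

Lemma trmx_continuous m n : continuous (@trmx R m n).
Proof.
move=> M A [P MP PA]; exists (fun i j => P j i).
  by move=> i j; have := MP j i; rewrite mxE.
by move=> N NP; apply: PA => i j; rewrite mxE; exact: NP.
Qed.

Lemma cV_box_compact n (lo hi : 'I_n -> R) :
  compact [set v : 'cV[R]_n | forall i, lo i <= v i 0 <= hi i].
Proof.
pose A i : set R := `[lo i, hi i]%classic.
have cA : compact [set v : 'rV[R]_n | forall i, A i (v ord0 i)].
  by apply: rV_compact => i; exact: segment_compact.
rewrite (_ : mkset _ = @trmx R 1 n @` [set v : 'rV[R]_n | forall i, A i (v ord0 i)]).
  apply: continuous_compact cA; apply: continuous_subspaceT; exact: trmx_continuous.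
apply/seteqP; split=> [v vb|_ [v vA <-] i].
  by exists v^T; rewrite ?trmxK// => i; rewrite /A /= in_itv /= mxE; exact: vb.
by have := vA i; rewrite /A /= in_itv /= mxE.
Qed.

(** Heine's theorem with closeness measured coordinatewise, through the near-covering form of
    compactness. *)
Lemma compact_unif_continuous n (K : set 'cV[R]_n) (f : 'cV[R]_n -> R) :
  compact K -> {within K, continuous f} -> forall e : R, 0 < e ->
  exists2 d : R, 0 < d & forall p q, K p -> K q ->
    (forall i, `|p i 0 - q i 0| < d) -> `|f p - f q| <= e.
Proof.
move=> cK cf e e0.
pose Q (d : R) (p : 'cV[R]_n) := K p -> forall q, K q ->
  (forall i, `|p i 0 - q i 0| < d) -> `|f p - f q| <= e.
have /compact_near_coveringP/(_ _ (0:R)^'+ Q) := cK.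
have : forall p, K p -> \forall p' \near p & d \near (0:R)^'+, Q d p'.
  move=> p Kp.
  have /subspace_continuousP/(_ p Kp)/cvgrPdist_le/(_ (e / 2)) := cf.
  rewrite divr_gt0// => /(_ isT); rewrite near_withinE => /nbhs_ballP[d /= d0 pd].
  have H1 : nbhs p [set p' : 'cV[R]_n | forall i, `|p i 0 - p' i 0| < d / 2].
    apply/nbhs_ballP; exists (d / 2); first exact: divr_gt0.
    by move=> p' [_ pp'] i; exact: (pp' i 0).
  have H2 : \forall d' \near (0:R)^'+, d' <= d / 2.
    by apply: nbhs_right_le; exact: divr_gt0.
  exists ([set p' : 'cV[R]_n | forall i, `|p i 0 - p' i 0| < d / 2], [set d' | d' <= d / 2]) => //.
  move=> [p' d'] [/= pp' dd'] Kp' q Kq pq.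
  have pq' : `|f p - f q| <= e / 2.
    apply: pd => //; split=> // i j; rewrite ord1 /ball /=.
    rewrite (_ : _ - _ = (p i 0 - p' i 0) + (p' i 0 - q i 0)); last by ring.
    apply: (le_lt_trans (ler_normD _ _)); rewrite [ltRHS]splitr.
    by apply: ltrD => //; exact: lt_le_trans dd'.
  have pp2 : `|f p - f p'| <= e / 2.
    apply: pd => //; split=> // i j; rewrite ord1 /ball /=.
    by apply: (lt_le_trans (pp' i)); lra.
  move: pq' pp2; rewrite !ler_norml; lra.
move=> /[swap] /[apply] H.
have [d [d0 Qd]] := @filter_ex _ ((0:R)^'+) _ _ (filterI (nbhs_right_gt 0) H).
exists d => // p q Kp Kq pq; exact: (Qd p Kp Kp q Kq pq).
Qed.

Lemma dotE n (u v : 'cV[R]_n) : dot u v = \sum_i u i 0 * v i 0.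
Proof. by rewrite /dot mxE; apply: eq_bigr => i _; rewrite mxE. Qed.

Lemma dotDr n (u v w : 'cV[R]_n) : dot u (v + w) = dot u v + dot u w.
Proof. by rewrite /dot mulmxDr mxE. Qed.

Lemma dotBr n (u v w : 'cV[R]_n) : dot u (v - w) = dot u v - dot u w.
Proof. by rewrite /dot mulmxBr !mxE. Qed.

Lemma dot_continuous (T : topologicalType) n (u : 'cV[R]_n) (g : T -> 'cV[R]_n) :
  continuous g -> continuous (fun x => dot u (g x)).
Proof.
move=> cg; under eq_fun do rewrite dotE.
apply: continuous_big => [|i _ x]; first exact: add_continuous.
apply: cvgMl_tmp; exact: (cvg_comp _ _ (cg x) (@coord_continuous _ _ _ i 0 (g x))).
Qed.

End topology_of_vectors.

(** Exhibiting a maximum rules out the default value 0 of [xget]. *)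
Lemma set_maxE (R : realType) (A : set R) v : A v -> ubound A v -> set_max A = v.
Proof.
move=> Av ubv; rewrite /set_max.
have [Aw ubw] := xgetI 0 (conj Av ubv : [set v | A v /\ ubound A v] v).
by apply/eqP; rewrite eq_le ubv// ubw.
Qed.

Lemma set_minE (R : realType) (A : set R) v : A v -> lbound A v -> set_min A = v.
Proof.
move=> Av lbv; rewrite /set_min.
have [Aw lbw] := xgetI 0 (conj Av lbv : [set v | A v /\ lbound A v] v).
by apply/eqP; rewrite eq_le lbv// lbw.
Qed.

(** * Comparison, bounds and continuity of the running costs *)

Section running_cost.
Context (R : realType) (nG : nat) (F : fleet R nG) (nL nc : nat).
Context (N : network F nL nc) (C : costs F nc) (E : projection R nG nL).
Implicit Types (a : mode F) (r : 'cV[R]_nG) (y : R).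

Lemma theta_le k (l m : level F k) : (l <= m)%N -> theta k l <= theta k m.
Proof.
rewrite leq_eqVlt => /orP[/eqP/val_inj->//|/theta_incr/ltW]; exact.
Qed.

(** A monotone ramp stays between its two end levels. *)
Lemma production_prodset a r : progset a r -> prodset F (production a r).
Proof.
move=> [r0 r1 r2] k; rewrite /production mxE.
have := r0 k; have := r2 k; rewrite mxE /in_transition /mode_delay.
case: (a k) => [l _ _|b]; first by rewrite !theta_le//= -ltnS.
move=> /(_ isT) rd rk; have bk : val b \in switches F k by exact: valP.
have h0 : 0 \in `[0, delay k (val b)] by rewrite in_itv /= lexx (ltW (delay_gt0 _ _ _ _ _ bk)).
have h1 : delay k (val b) \in `[0, delay k (val b)].
  by rewrite in_itv /= lexx (ltW (delay_gt0 _ _ _ _ _ bk)).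
have hr : r k 0 \in `[0, delay k (val b)] by rewrite in_itv /= rk ltW.
have e0 := ramp_start _ _ _ _ _ bk; have e1 := ramp_end _ _ _ _ _ bk.
have L1 := @theta_le k (ord0 : level F k) (val b).1 (leq0n _).
have L2 := @theta_le k (ord0 : level F k) (val b).2 (leq0n _).
have U1 : theta k (val b).1 <= theta k (ord_max : level F k) by rewrite theta_le//= -ltnS.
have U2 : theta k (val b).2 <= theta k (ord_max : level F k) by rewrite theta_le//= -ltnS.
case: (ramp_mono _ _ _ _ _ bk) => mono.
  have := mono _ _ h0 hr rk; have := mono _ _ hr h1 (ltW rd).
  by rewrite e0 e1 => m1 m2; rewrite (le_trans L1 m2) (le_trans m1 U2).
have := mono _ _ h0 hr rk; have := mono _ _ hr h1 (ltW rd).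
by rewrite e0 e1 => m1 m2; rewrite (le_trans L2 m1) (le_trans m2 U1).
Qed.

Lemma production_lip a r r' k : progset a r -> progset a r' ->
  `|production a r k 0 - production a r' k 0| <= `|rampLip R nG F| * `|r k 0 - r' k 0|.
Proof.
move=> [r0 r1 r2] [r0' r1' r2']; rewrite /production !mxE.
have := r0 k; have := r2 k; have := r0' k; have := r2' k.
rewrite mxE /in_transition /mode_delay.
case: (a k) => [l *|b]; first by rewrite subrr normr0 mulr_ge0.
move=> /(_ isT) rd' rk' /(_ isT) rd rk; have bk : val b \in switches F k by exact: valP.
have hr : r k 0 \in `[0, delay k (val b)] by rewrite in_itv /= rk ltW.
have hr' : r' k 0 \in `[0, delay k (val b)] by rewrite in_itv /= rk' ltW.
apply: le_trans (ramp_lip _ _ _ _ _ bk _ _ hr hr') _.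
by rewrite ler_wpM2r// ler_norm.
Qed.

Lemma etaL_exists : exists i, 0 < etaL E i 0.
Proof.
apply: contrapT => H; have := etaL_norm E; rewrite /enorm.
have -> : dot (etaL E) (etaL E) = 0.
  rewrite dotE big1// => i _; have := etaL_ge0 E i; rewrite mxE le_eqVlt => /orP[/eqP<-|h].
    by rewrite mul0r.
  by exfalso; apply: H; exists i.
by rewrite sqrtr0 => /eqP; rewrite eq_sym oner_eq0.
Qed.

(* The least cost of shedding one unit of projected demand. *)
Lemma unit_shedcost : exists2 M : R, 0 <= M &
  (forall i, M * etaL E i 0 <= shedcost N i 0) /\
  exists2 i, 0 < etaL E i 0 & M * etaL E i 0 = shedcost N i 0.
Proof.
have [i0 i0P] := etaL_exists.
pose i1 := [arg min_(i < i0 | 0 < etaL E i 0) (shedcost N i 0 / etaL E i 0)]%O.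
have [ip imin] : 0 < etaL E i1 0 /\
    forall j, 0 < etaL E j 0 -> shedcost N i1 0 / etaL E i1 0 <= shedcost N j 0 / etaL E j 0.
  by rewrite /i1; case: arg_minP.
exists (shedcost N i1 0 / etaL E i1 0).
  by rewrite divr_ge0// ltW// shedcost_gt0.
split=> [i|]; last by exists i1; rewrite ?divfK ?gt_eqF.
have := etaL_ge0 E i; rewrite mxE le_eqVlt => /orP[/eqP<-|h].
  by rewrite mulr0 ltW// shedcost_gt0.
by rewrite -ler_pdivlMr// imin.
Qed.

(** By compactness the maximum in [eta_bound] is attained, so [eta_bound] is a genuine bound and not
    the default of [set_max]. *)
Lemma eta_boundP i (j : 'I_(nproj E).+1) (pG : 'cV[R]_nG) (pD : 'cV[R]_nL) : prodset F pG -> cvle 0 pD ->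
  feas N i (pG, pD) -> dot (etaG j) pG + dot (etaL E) pD <= eta_bound N i j.
Proof.
move=> hG hD hf.
pose K : set ('cV[R]_nG * 'cV[R]_nL) :=
  [set p | [/\ prodset F p.1, cvle 0 p.2 & feas N i p]].
have c1 k : continuous (fun p : 'cV[R]_nG * 'cV[R]_nL => p.1 k 0).
  move=> p; apply: (cvg_comp fst (fun M : 'cV[R]_nG => M k 0)); first exact: cvg_fst.
  exact: coord_continuous.
have c2 k : continuous (fun p : 'cV[R]_nG * 'cV[R]_nL => p.2 k 0).
  move=> p; apply: (cvg_comp snd (fun M : 'cV[R]_nL => M k 0)); first exact: cvg_snd.
  exact: coord_continuous.
have cK : compact K.
  apply: (subclosed_compact _ (@feas_compact _ _ _ _ _ N i)); last by move=> p [].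
  have -> : K = (\bigcap_(k in [set: 'I_nG]) ((fun p : 'cV[R]_nG * 'cV[R]_nL => p.1 k 0) @^-1`
        `[theta k (ord0 : level F k), theta k (ord_max : level F k)])) `&`
     (\bigcap_(k in [set: 'I_nL]) ((fun p : 'cV[R]_nG * 'cV[R]_nL => p.2 k 0) @^-1` `[0, +oo[)) `&`
     feas N i.
    apply/seteqP; split=> p /=.
      move=> [h1 h2 h3]; split=> //; split=> k _ /=; rewrite in_itv /= ?h1//.
      by have := h2 k; rewrite mxE => ->.
    move=> [[h1 h2] h3]; split=> // k.
      by have /= := h1 k I; rewrite in_itv.
    by have /= := h2 k I; rewrite in_itv /= andbT mxE.
  apply: closedI; last exact: feas_closed.
  apply: closedI; apply: closed_bigI => k _.
    apply: preimage_closed; first by move=> p _; exact: (c1 k).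
    exact: interval_closed.
  apply: preimage_closed; first by move=> p _; exact: (c2 k).
  exact: interval_closed.
have K0 : K !=set0 by exists (pG, pD).
pose phi (p : 'cV[R]_nG * 'cV[R]_nL) := dot (etaG j) p.1 + dot (etaL E) p.2.
have cphi : {within K, continuous phi}.
  apply: continuous_subspaceT => p; apply: cvgD.
    by apply: (@dot_continuous _ _ _ _ fst) => q; exact: cvg_fst.
  by apply: (@dot_continuous _ _ _ _ snd) => q; exact: cvg_snd.
have [p Kp pmax] := compact_EVT_max K0 cK cphi.
rewrite /eta_bound (@set_maxE _ _ (phi p)).
- by apply: (pmax (pG, pD)); rewrite inE.
- by exists p => //; rewrite inE in Kp.
- by move=> _ [q Kq <-]; apply: pmax; rewrite inE.
Qed.

(** A linear program with a single constraint besides positivity: the excess is covered where a unit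
    of projected demand is cheapest to shed, so the value is [M] times the excess, with the same [M]
    for all [i] and [j]. *)
Lemma eta_shedcostE : exists2 M : R, 0 <= M & forall i (j : 'I_(nproj E).+1) u y,
  eta_shedcost N i j u y = M * Num.max (u + y - eta_bound N i j) 0 /\
  forall z, cvle 0 z -> u + y - dot (etaL E) z <= eta_bound N i j ->
    eta_shedcost N i j u y <= dot (shedcost N) z.
Proof.
have [M M0 [Mi [i1 i1p Mi1]]] := unit_shedcost; exists M => // i j u y.
set d := eta_bound N i j.
have lb : lbound [set dot (shedcost N) z |
    z in [set z | cvle 0 z /\ u + y - dot (etaL E) z <= eta_bound N i j]]
    (M * Num.max (u + y - d) 0).
  move=> _ [z [z0 zd] <-].
  have H : M * dot (etaL E) z <= dot (shedcost N) z.
    rewrite !dotE mulr_sumr; apply: ler_sum => k _.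
    by rewrite mulrA ler_wpM2r//; have := z0 k; rewrite mxE.
  apply: le_trans H; apply: ler_wpM2l => //; rewrite ge_max; apply/andP; split.
    by rewrite -/d in zd; lra.
  rewrite dotE; apply: sumr_ge0 => k _; apply: mulr_ge0.
    by have := etaL_ge0 E k; rewrite mxE.
  by have := z0 k; rewrite mxE.
suff e : eta_shedcost N i j u y = M * Num.max (u + y - d) 0.
  by split=> // z z0 zd; rewrite e; apply: lb; exists z.
apply: set_minE => //.
  (* All of the excess is shed at [i1], where the least unit cost is attained. *)
  exists (\col_k (if k == i1 then Num.max (u + y - d) 0 / etaL E i1 0 else 0)).
    split=> [k|].
      by rewrite !mxE; case: ifP => // _; rewrite divr_ge0 ?le_max ?lexx ?orbT// ltW.
    rewrite dotE (bigD1 i1)//= big1 => [|k ki]; last by rewrite mxE (negbTE ki) mulr0.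
    rewrite mxE eqxx addr0 mulrC divfK ?gt_eqF//.
    have : u + y - d <= Num.max (u + y - d) 0 by rewrite le_max lexx.
    rewrite -/d; lra.
  rewrite dotE (bigD1 i1)//= big1 => [|k ki]; last by rewrite mxE (negbTE ki) mulr0.
  by rewrite mxE eqxx addr0 -Mi1 -mulrA; congr (_ * _); rewrite mulrC divfK ?gt_eqF.
Qed.

(** The load shed in the full problem is a candidate in the scalar one: what is still served lies in
    [feas N i], hence below [eta_bound], and [etaL >= 0] allows passing from the positive part of
    [x] to [x]. *)
Lemma eta_shedcost_le i (j : 'I_(nproj E).+1) (x : 'cV[R]_nL) (pG : 'cV[R]_nG) :
  prodset F pG -> eta_shedcost N i j (dot (etaG j) pG) (dot (etaL E) x) <=
  dot (shedcost N) (shed N i pG (pospart x)).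
Proof.
move=> hG; have [M _ H] := eta_shedcostE.
have xp0 : cvle 0 (pospart x) by move=> k; rewrite !mxE le_max lexx orbT.
have [z0 zf _] := shed_min N i hG xp0.
have hb := eta_boundP j hG (feas_ge0 zf) zf.
have xle : dot (etaL E) x <= dot (etaL E) (pospart x).
  rewrite !dotE; apply: ler_sum => k _; rewrite ler_wpM2l//; last by rewrite mxE le_max lexx.
  by have := etaL_ge0 E k; rewrite mxE.
rewrite /= dotBr in hb.
by apply: (H i j _ _).2 => //; lra.
Qed.

Lemma f1eta_le_run_cost (x : 'cV[R]_nL) a r : progset a r ->
  f1eta N C E (dot (etaL E) x) a r <= run_cost N C x a r.
Proof.
move=> /production_prodset hG; rewrite /f1eta /run_cost lerD2l.
have H (j : 'I_(nproj E).+1) : eta_shedsum N C (dot (etaL E) x) a r j <=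
    \sum_i weight C i * dot (shedcost N) (shed N i (production a r) (pospart x)).
  apply: ler_sum => i _; rewrite ler_wpM2l ?weight_ge0//.
  exact: eta_shedcost_le.
by apply/bigmax_leP; split=> [|j _]; exact: H.
Qed.

Lemma f2eta_le y a r : progset a r ->
  (f2eta N C E y a (total_prog r) <= (f1eta N C E y a r)%:E)%E.
Proof. by move=> hr; apply: ereal_inf_lbound; exists r. Qed.

(** The shedding part is a maximum of sums of hinge functions, hence Lipschitz in demand and
    production, across modes as well. The production cost is merely continuous, so its variation is
    left explicit. *)
Lemma f1eta_diff : exists2 L : R, 0 <= L &
  forall y y' a a' r r' (e : R), 0 <= e ->
  (forall k, `|production a r k 0 - production a' r' k 0| <= e) ->
  f1eta N C E y a r <= f1eta N C E y' a' r' +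
    (prodcost C (production a r) - prodcost C (production a' r')) + L * (e + `|y - y'|).
Proof.
have [M M0 H] := eta_shedcostE.
pose B := 1 + \sum_(j < (nproj E).+1) \sum_k `|etaG j k 0|.
pose L := (\sum_i weight C i) * (M * B).
have B1 (j : 'I_(nproj E).+1) : \sum_k `|etaG j k 0| <= B - 1.
  rewrite /B addrC addKr (bigD1 j)//= lerDl.
  by apply: sumr_ge0 => j' _; apply: sumr_ge0.
have B0 : 1 <= B.
  by rewrite lerDl; apply: sumr_ge0 => j' _; apply: sumr_ge0.
have MB0 : 0 <= M * B by rewrite mulr_ge0// (le_trans ler01).
exists L; first by rewrite mulr_ge0//; apply: sumr_ge0 => i _; exact: weight_ge0.
move=> y y' a a' r r' e e0 he.
have step (j : 'I_(nproj E).+1) : eta_shedsum N C y a r j <=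
    eta_shedsum N C y' a' r' j + L * (e + `|y - y'|).
  rewrite /eta_shedsum /L -mulrA mulr_suml -big_split /=; apply: ler_sum => i _.
  rewrite -mulrDr ler_wpM2l ?weight_ge0//.
  rewrite (H _ _ _ _).1 (H _ _ _ _).1 -mulrA -mulrDr ler_wpM2l//.
  have D : dot (etaG j) (production a r) - dot (etaG j) (production a' r') <= (B - 1) * e.
    rewrite !dotE -sumrB; apply: (@le_trans _ _ (\sum_k `|etaG j k 0| * e)); last first.
      by rewrite -mulr_suml ler_wpM2r.
    apply: ler_sum => k _; rewrite -mulrBr; apply: (le_trans (ler_norm _)).
    by rewrite normrM ler_wpM2l.
  have D2 : y - y' <= `|y - y'| by exact: ler_norm.
  have D3 : `|y - y'| <= B * `|y - y'| by rewrite ler_peMl.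
  have D4 : (B - 1) * e <= B * e by rewrite ler_wpM2r//; lra.
  have D5 : 0 <= B * (e + `|y - y'|) by apply: mulr_ge0; [exact: le_trans ler01 B0|exact: addr_ge0].
  have D6 := mulrDr B e `|y - y'|.
  set u := dot _ (production a r) in D *; set u' := dot _ (production a' r') in D *.
  have m1 : u' + y' - eta_bound N i j <= Num.max (u' + y' - eta_bound N i j) 0 by rewrite le_max lexx.
  have m2 : 0 <= Num.max (u' + y' - eta_bound N i j) 0 by rewrite le_max lexx orbT.
  by rewrite ge_max; apply/andP; split; lra.
rewrite /f1eta.
set S := \big[Num.max/_]_j eta_shedsum N C y a r j; set S' := \big[Num.max/_]_j _.
suff : S <= S' + L * (e + `|y - y'|) by lra.
have S'P (j : 'I_(nproj E).+1) : eta_shedsum N C y' a' r' j <= S' by apply: le_bigmax.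
apply/bigmax_leP; split=> [|j _]; apply: (le_trans (step _)); rewrite lerD2r; exact: S'P.
Qed.

Lemma prodset_compact : compact (prodset F).
Proof. exact: cV_box_compact. Qed.

Lemma prodset_nonempty : prodset F !=set0.
Proof.
exists (\col_k theta k (ord0 : level F k)) => k; rewrite mxE lexx /=.
exact: theta_le.
Qed.

Lemma prodcost_bounded : exists2 B : R, 0 <= B & forall p, prodset F p -> `|prodcost C p| <= B.
Proof.
have [p _ pmax] := compact_EVT_max prodset_nonempty prodset_compact (@prodcost_cont _ _ _ _ C).
have [q _ qmin] := compact_EVT_min prodset_nonempty prodset_compact (@prodcost_cont _ _ _ _ C).
exists (`|prodcost C p| + `|prodcost C q|); first by rewrite addr_ge0.
move=> u Ku; have := pmax u; have := qmin u; rewrite !inE => /(_ Ku) h1 /(_ Ku) h2.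
have := ler_norm (prodcost C p); have := ler_norm (- prodcost C q).
have := normr_ge0 (prodcost C p); have := normr_ge0 (prodcost C q).
by rewrite normrN ler_norml => *; apply/andP; split; lra.
Qed.

(** Shifting by [B] makes the running costs nonnegative, as Tonelli's theorem requires. *)
Lemma f1eta_lower_bound : exists2 B : R, 0 <= B &
  forall y a r, progset a r -> 0 <= f1eta N C E y a r + B.
Proof.
have [B B0 HB] := prodcost_bounded; have [M M0 H] := eta_shedcostE.
exists B => // y a r hr.
have := HB _ (production_prodset hr); rewrite ler_norml => /andP[h1 _].
rewrite /f1eta; set S := \big[_/_]_j _.
suff : 0 <= S by lra.
apply: (@le_trans _ _ (eta_shedsum N C y a r (ord0 : 'I_(nproj E).+1))); last exact: le_bigmax.
apply: sumr_ge0 => i _; rewrite mulr_ge0 ?weight_ge0// (H _ _ _ _).1 mulr_ge0//.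
by rewrite le_max lexx orbT.
Qed.

(** All productions lie in one box, so at equal demand the costs differ by a bounded amount, however
    large the demand. This handles the instants at which rounding changes the mode. *)
Lemma f1eta_mode_bound : exists2 B : R, 0 <= B &
  forall y a a' r r', progset a r -> progset a' r' ->
  f1eta N C E y a r <= f1eta N C E y a' r' + B.
Proof.
have [B B0 HB] := prodcost_bounded; have [L L0 HL] := f1eta_diff.
pose w k := theta k (ord_max : level F k) - theta k (ord0 : level F k).
have w0 k : 0 <= w k by rewrite subr_ge0 theta_le.
have W0 : 0 <= \sum_k w k by apply: sumr_ge0 => k _; exact: w0.
exists (2 * B + L * \sum_k w k); first by rewrite addr_ge0 ?mulr_ge0.
move=> y a a' r r' hr hr'.
have P1 := production_prodset hr; have P2 := production_prodset hr'.
have he k : `|production a r k 0 - production a' r' k 0| <= \sum_k w k.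
  apply: (@le_trans _ _ (w k)).
    have := P1 k; have := P2 k; rewrite /w ler_norml => /andP[? ?] /andP[? ?].
    by apply/andP; split; lra.
  rewrite (bigD1 k)//= lerDl; apply: sumr_ge0 => j _; exact: w0.
have := HL y y a a' r r' _ W0 he; rewrite subrr normr0 addr0.
have := HB _ P1; have := HB _ P2; rewrite !ler_norml => /andP[? ?] /andP[? ?].
lra.
Qed.

Lemma f1eta_unif_continuous (e : R) : 0 < e -> exists2 d : R, 0 < d &
  forall y y' a r r', progset a r -> progset a r' -> `|y - y'| <= d ->
  (forall k, `|r k 0 - r' k 0| <= d) ->
  `|f1eta N C E y a r - f1eta N C E y' a r'| <= e.
Proof.
move=> e0; have [L L0 HL] := f1eta_diff.
have e2 : 0 < e / 2 by rewrite divr_gt0.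
have [d1 d10 Hd1] := compact_unif_continuous prodset_compact (@prodcost_cont _ _ _ _ C) e2.
pose l := 1 + `|rampLip R nG F|.
have l1 : 1 <= l by rewrite lerDl.
have l0 : 0 < l by exact: lt_le_trans l1.
(* Progressions within [d] move each production by at most [l * d]. The first bound on [d] is for
   the production cost, the second for the Lipschitz part. *)
pose d := Num.min (d1 / (2 * l)) (e / (4 * (1 + L) * l)).
have dp : 0 < d.
  rewrite lt_min; apply/andP; split; apply: divr_gt0 => //; first exact: mulr_gt0.
  by rewrite !mulr_gt0//; lra.
have ld1 : l * d < d1.
  apply: (@le_lt_trans _ _ (d1 / 2)); last by lra.
  have : d <= d1 / (2 * l) by rewrite ge_min lexx.
  by rewrite ler_pdivlMr ?mulr_gt0//; lra.
have ld2 : L * (l * d + d) <= e / 2.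
  have : d <= e / (4 * (1 + L) * l) by rewrite ge_min lexx orbT.
  rewrite ler_pdivlMr; last by rewrite !mulr_gt0//; lra.
  have : 0 <= d * l by rewrite mulr_ge0// ltW.
  have : 0 <= L * (d * (l - 1)) by rewrite !mulr_ge0//; lra.
  by nra.
exists d => // y y' a r r' hr hr' hy hk.
have he k : `|production a r k 0 - production a r' k 0| <= l * d.
  apply: (le_trans (production_lip k hr hr')); apply: ler_pM => //.
  by rewrite /l lerDr.
have he' k : `|production a r' k 0 - production a r k 0| <= l * d by rewrite distrC.
have P1 := production_prodset hr; have P2 := production_prodset hr'.
have hC : `|prodcost C (production a r) - prodcost C (production a r')| <= e / 2.
  by apply: Hd1 => // k; exact: le_lt_trans ld1.
have ld0 : 0 <= l * d by rewrite mulr_ge0// ltW.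
have h1 := HL y y' a a r r' _ ld0 he; have h2 := HL y' y a a r' r _ ld0 he'.
rewrite (distrC y' y) in h2.
have h3 : L * (l * d + `|y - y'|) <= L * (l * d + d) by rewrite ler_wpM2l// lerD2l.
by move: hC; rewrite !ler_norml => /andP[? ?]; apply/andP; split; lra.
Qed.

End running_cost.

(** * Rotations of a Brownian motion *)

Section density_measure.
Local Open Scope ereal_scope.
Context d (T : measurableType d) (R : realType) (mu : {measure set T -> \bar R}).
Context (g : T -> \bar R) (mg : measurable_fun setT g) (g0 : forall x, 0 <= g x).

(** The two proofs are arguments so that the measure structure declared below can be inferred from
    the term alone. *)
Definition density_measure (_ : measurable_fun setT g) (_ : forall x, 0 <= g x) (A : set T) :
  \bar R := \int[mu]_(x in A) g x.

Local Notation nu := (density_measure mg g0).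

Let nu0 : nu set0 = 0.
Proof. by rewrite /density_measure integral_set0. Qed.

Let nu_ge0 A : 0 <= nu A.
Proof. by apply: integral_ge0 => x _; exact: g0. Qed.

Let nu_sigma_additive : semi_sigma_additive nu.
Proof.
move=> A mA tA mUA; rewrite /density_measure ge0_integral_bigcup//=.
- by apply: is_cvg_ereal_nneg_natsum_cond => n _ _; exact: nu_ge0.
- exact: measurable_funTS.
Qed.

HB.instance Definition _ := isMeasure.Build _ _ _ nu nu0 nu_ge0 nu_sigma_additive.

End density_measure.

(** * Rotation invariance of Lebesgue and Gaussian measures in the plane *)

Section plane.
Context (R : realType).
Notation mu := (@lebesgue_measure R).
Local Open Scope ereal_scope.

Lemma lebesgue_measure_translation (c : R) (A : set R) : measurable A ->
  mu [set x | A (x + c)%R] = mu A.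
Proof.
move=> mA.
have mc : measurable_fun setT (fun x : measurableTypeR R => (x + c)%R : measurableTypeR R).
  exact: measurable_funD.
pose f : measurableTypeR R -> measurableTypeR R := fun x => (x + c)%R.
change (pushforward mu f A = mu A).
apply/esym/lebesgue_measure_unique => //= _ [[a b]] _ <-.
rewrite /pushforward (_ : f @^-1` _ = `](a - c)%R, (b - c)%R]%classic).
  rewrite !lebesgue_measure_itv /= !lte_fin ltrD2r.
  by case: ifP => // _; rewrite -!EFinB opprB addrA subrK.
by apply/seteqP; split=> x /=; rewrite /f !in_itv /= ltrBlDr lerBrDr.
Qed.

Lemma ge0_integral_translation (c : R) (f : R -> \bar R) :
  measurable_fun setT f -> (forall x, 0 <= f x) ->
  \int[mu]_x f (x + c)%R = \int[mu]_x f x.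
Proof.
move=> mf f0.
have mc : measurable_fun setT (fun x : measurableTypeR R => (x + c)%R : measurableTypeR R).
  exact: measurable_funD.
have := @ge0_integral_pushforward _ _ _ _ _ _ mc mu setT f measurableT mf (fun x _ => f0 x).
rewrite preimage_setT /comp => <-.
apply: eq_measure_integral => A mA _; rewrite /pushforward.
exact: lebesgue_measure_translation.
Qed.

Notation mu2 := (mu \x mu).

Lemma ge0_integral_shear1 (c : R) (f : R * R -> \bar R) :
  measurable_fun setT f -> (forall z, 0 <= f z) ->
  \int[mu2]_z f (z.1 + c * z.2, z.2)%R = \int[mu2]_z f z.
Proof.
move=> mf f0.
have mf' : measurable_fun setT (fun z : R * R => f (z.1 + c * z.2, z.2)%R).
  apply: measurableT_comp => //; apply: measurable_fun_pair => //=.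
  by apply: measurable_funD => //; exact: measurable_funM.
rewrite !fubini_tonelli1// !fubini_tonelli//; apply: eq_integral => y _.
rewrite /fubini_G /=.
apply: (@ge0_integral_translation (c * y) (fun x => f (x, y))) => //.
by apply: measurableT_comp => //; exact: measurable_fun_pair.
Qed.

Lemma ge0_integral_shear2 (c : R) (f : R * R -> \bar R) :
  measurable_fun setT f -> (forall z, 0 <= f z) ->
  \int[mu2]_z f (z.1, z.2 + c * z.1)%R = \int[mu2]_z f z.
Proof.
move=> mf f0.
have mf' : measurable_fun setT (fun z : R * R => f (z.1, z.2 + c * z.1)%R).
  apply: measurableT_comp => //; apply: measurable_fun_pair => //=.
  by apply: measurable_funD => //; exact: measurable_funM.
rewrite !fubini_tonelli1//; apply: eq_integral => x _.
rewrite /fubini_F /=.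
apply: (@ge0_integral_translation (c * x) (fun y => f (x, y))) => //.
by apply: measurableT_comp => //; exact: measurable_fun_pair.
Qed.

(* A rotation is the composition of three shears. *)
Lemma ge0_integral_rotation (c s : R) (f : R * R -> \bar R) :
  (c ^+ 2 + s ^+ 2 = 1)%R -> c != (-1)%R ->
  measurable_fun setT f -> (forall z, 0 <= f z) ->
  \int[mu2]_z f (c * z.1 + s * z.2, c * z.2 - s * z.1)%R = \int[mu2]_z f z.
Proof.
move=> cs cN1 mf f0.
have c1 : (1 + c != 0)%R by rewrite addrC addr_eq0.
(* The tangent of the half angle: the three shears have slopes [k], [- s] and [k]. *)
pose k := (s / (1 + c))%R.
have f1 : measurable_fun setT (fun z : R * R => f (z.1 + k * z.2, z.2)%R).
  apply: measurableT_comp => //; apply: measurable_fun_pair => //=.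
  by apply: measurable_funD => //; exact: measurable_funM.
have f2 : measurable_fun setT (fun z : R * R => f (z.1 + k * (z.2 + - s * z.1), z.2 + - s * z.1)%R).
  apply: measurableT_comp => //; apply: measurable_fun_pair => //=.
    apply: measurable_funD => //; apply: measurable_funM => //.
    by apply: measurable_funD => //; exact: measurable_funM.
  by apply: measurable_funD => //; exact: measurable_funM.
rewrite -[RHS](@ge0_integral_shear1 k)//.
rewrite -[RHS](@ge0_integral_shear2 (- s)%R (fun z => f (z.1 + k * z.2, z.2)%R))//.
rewrite -[RHS](@ge0_integral_shear1 k (fun z => f (z.1 + k * (z.2 + - s * z.1), z.2 + - s * z.1)%R))//.
have kc : (k * (1 + c) = s)%R by rewrite /k divfK.
have ks : (k * s = 1 - c)%R.
  by apply: (mulIf c1); rewrite mulrAC kc; move: cs; rewrite !expr2; lra.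
apply: eq_integral => -[x y] _ /=; congr (f (_, _)).
  transitivity (x * (1 - k * s) + y * (k * (1 + (1 - k * s))))%R; last by ring.
  by rewrite ks; rewrite opprB addrCA subrr addr0 kc; ring.
transitivity (y * (1 - k * s) - s * x)%R; last by ring.
by rewrite ks; ring.
Qed.

Section gaussian_plane.
Context (sigma : R) (sigma0 : (sigma != 0)%R).
Local Notation N := (normal_prob 0 sigma).

Let g (z : R * R) : \bar R := (normal_pdf 0 sigma z.1 * normal_pdf 0 sigma z.2)%:E.

Let mg : measurable_fun setT g.
Proof.
apply/measurable_EFinP; apply: measurable_funM.
  exact: (measurableT_comp (measurable_normal_pdf 0 sigma) measurable_fst).
exact: (measurableT_comp (measurable_normal_pdf 0 sigma) measurable_snd).
Qed.

Let g0 z : 0 <= g z.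
Proof. by rewrite lee_fin mulr_ge0// normal_pdf_ge0. Qed.

Lemma gaussian_plane_density S : measurable S ->
  (N \x N) S = \int[mu2]_(z in S) g z.
Proof.
move=> mS; have := @product_measure_unique _ _ _ _ _ N N (density_measure mu2 mg g0).
move=> /(_ _ S mS) -> // A B mA mB.
rewrite /= /density_measure integral_mkcond.
rewrite fubini_tonelli1; last 2 first.
- by apply/(measurable_restrictT _ _).1 => //; [exact: measurableX|exact: measurable_funTS].
- by move=> z; rewrite patchE; case: ifP.
rewrite /fubini_F /normal_prob.
transitivity (\int[mu]_x (((fun x => (normal_pdf 0 sigma x)%:E) \_ A) x * N B)).
  apply: eq_integral => x _; rewrite patchE; case: ifPn => xA.
    rewrite /normal_prob -ge0_integralZl//.
    - rewrite [RHS]integral_mkcond; apply: eq_integral => y _.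
      rewrite !patchE /=; case: (boolP (y \in B)) => yB.
        by rewrite ifT ?EFinM// inE /=; split; [move: xA|move: yB]; rewrite inE.
      by rewrite ifN// notin_setE /= => -[_]; move: yB; rewrite notin_setE.
    - by apply: measurable_funTS; apply/measurable_EFinP; exact: measurable_normal_pdf.
    - by move=> y _; rewrite lee_fin normal_pdf_ge0.
    - by rewrite lee_fin normal_pdf_ge0.
  rewrite mul0e integral0_eq// => y _; rewrite patchE ifN// notin_setE /= => -[+ _].
  by move: xA; rewrite notin_setE.
rewrite ge0_integralZr//.
- by rewrite -integral_mkcond.
- apply/(measurable_restrictT _ _).1 => //; apply: measurable_funTS.
  by apply/measurable_EFinP; exact: measurable_normal_pdf.
- by move=> x _; rewrite patchE; case: ifP => // _; rewrite lee_fin normal_pdf_ge0.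
Qed.

(** Both Lebesgue measure and the density, which depends on the Euclidean norm only, are
    invariant. *)
Lemma gaussian_plane_rotation (c s : R) S :
  (c ^+ 2 + s ^+ 2 = 1)%R -> c != (-1)%R -> measurable S ->
  (N \x N) [set z : R * R | S (c * z.1 + s * z.2, c * z.2 - s * z.1)%R] = (N \x N) S.
Proof.
move=> cs cN1 mS.
have mrot : measurable_fun setT
    (fun z : R * R => (c * z.1 + s * z.2, c * z.2 - s * z.1)%R : R * R).
  apply: measurable_fun_pair => //=; [apply: measurable_funD|apply: measurable_funB];
    by apply: measurable_funM.
rewrite !gaussian_plane_density//; last first.
  by rewrite -[X in measurable X]setTI; exact: mrot.
rewrite integral_mkcond [RHS]integral_mkcond -[RHS](ge0_integral_rotation cs cN1).
- apply: eq_integral => -[x y] _; rewrite !patchE.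
  have -> : ((x, y) \in [set z : R * R | S (c * z.1 + s * z.2, c * z.2 - s * z.1)%R]) =
            ((c * x + s * y, c * y - s * x)%R \in S).
    by apply/idP/idP; rewrite !inE.
  case: ifP => // _; rewrite /g /= !normal_pdfE// /normal_fun; congr EFin.
  rewrite !subr0 mulrACA [RHS]mulrACA -!expRD; congr (_ * expR _)%R.
  rewrite -!mulrDl; congr (_ * _)%R; move: cs.
  rewrite !expr2 => cs; transitivity (- ((x * x + y * y) * (c * c + s * s)))%R; last by ring.
  by rewrite cs; ring.
- by apply/(measurable_restrictT _ _).1 => //; exact: measurable_funTS.
- by move=> z; rewrite patchE; case: ifP.
Qed.

End gaussian_plane.

End plane.

(** * Independence of generated sigma-algebras *)

Section independence.
Context d (T : measurableType d) (R : realType) (P : probability T R).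
Local Open Scope ereal_scope.
Implicit Types G H : set (set T).

Definition indep G H := forall A B, G A -> H B -> P (A `&` B) = P A * P B.

Lemma indepC G H : indep G H -> indep H G.
Proof. by move=> GH A B HA GB; rewrite setIC muleC GH. Qed.

(** For fixed [B], the trace of [P] on [B] and the multiple of [P] by [P B] are finite measures that
    agree on the pi-system [G]. *)
Lemma indep_sigma_l G H : G `<=` measurable -> H `<=` measurable ->
  setI_closed G -> G setT -> indep G H -> indep (<<s G >>) H.
Proof.
move=> Gm Hm GI GT GH A B sGA HB.
have mB : measurable B by exact: Hm.
have PB0 : (0 <= fine (P B))%R by rewrite fine_ge0.
have fB : P B \is a fin_num by apply: fin_num_measure; exact: mB.
have scaleE C : mscale (NngNum PB0) P C = P C * P B.
  by rewrite /mscale /= muleC; congr (_ * _); rewrite -[RHS]fineK.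
rewrite -scaleE; apply: (@g_sigma_algebra_measure_unique _ R T G Gm (fun=> setT) (fun=> GT) _
  (mrestr P mB) (mscale (NngNum PB0) P) GI) => //.
- by rewrite bigcup_const.
- by move=> C GC; rewrite [RHS]scaleE -GH.
- by move=> _; rewrite /= /mrestr setTI ltey_eq fB.
Qed.

Lemma sigma_measurable G : G `<=` measurable -> <<s G >> `<=` measurable.
Proof. by move=> Gm; apply: smallest_sub => //; exact: sigma_algebra_measurable. Qed.

Lemma indep_sigma G H : G `<=` measurable -> H `<=` measurable ->
  setI_closed G -> setI_closed H -> G setT -> H setT ->
  indep G H -> indep (<<s G >>) (<<s H >>).
Proof.
move=> Gm Hm GI HI GT HT GH; apply: indep_sigma_l => //.
  exact: sigma_measurable.
by apply: indepC; apply: indep_sigma_l => //; exact: indepC.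
Qed.

End independence.

(** * A plane rotation of a Brownian motion is a Brownian motion *)

Section givens.
Context d (Om : measurableType d) (R : realType) (P : probability Om R) (n : nat).
Implicit Types W : R -> Om -> 'cV[R]_n.

(** The generators of [natural_filtration (coords W) s], named so that the sample space can be given
    this sigma-algebra as a measurable type. *)
Definition coord_gens W s : set (set Om) := [set A | exists i (u : R) (B : set R),
        [/\ 0 <= u <= s, measurable B & A = coords W i u @^-1` B]].

Lemma coord_adapted W s u i : 0 <= u <= s ->
  measurable_fun setT ((fun w => W u w i 0) : g_sigma_algebraType (coord_gens W s) -> R).
Proof.
move=> us _ B mB; rewrite setTI; apply: sub_sigma_algebra.
by exists i, u, B.
Qed.

Lemma natural_coords_sub W W' s :
  (forall u i, 0 <= u <= s -> measurable_fun setT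
     ((fun w => W' u w i 0) : g_sigma_algebraType (coord_gens W s) -> R)) ->
  natural_filtration (coords W') s `<=` natural_filtration (coords W) s.
Proof.
move=> H; apply: smallest_sub; first exact: smallest_sigma_algebra.
move=> _ [i [u [B [us mB ->]]]].
by have := H u i us measurableT B mB; rewrite setTI.
Qed.

Lemma natural_coords_measurable W s :
  (forall (s : R) i, 0 <= s -> measurable_fun setT (fun w => W s w i 0)) ->
  natural_filtration (coords W) s `<=` measurable.
Proof.
move=> mW; apply: sigma_measurable => _ [i [u [B [/andP[u0 _] mB ->]]]].
by rewrite -[X in measurable X]setTI; exact: mW.
Qed.

Definition rotate (i j : 'I_n) (c s : R) (v : 'cV[R]_n) : 'cV[R]_n :=
  \col_k (if k == i then c * v i 0 + s * v j 0
          else if k == j then c * v j 0 - s * v i 0 else v k 0).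

(** Restricted to a past event and to constraints on the other coordinates, the law of the two
    rotated increments is a multiple of a centred planar Gaussian, hence invariant. No information
    is lost because a rotation is invertible. *)
Lemma brownian_rotate W i j c s : brownian P W -> i != j ->
  c ^+ 2 + s ^+ 2 = 1 -> c != -1 ->
  let W' := fun u w => rotate i j c s (W u w) in
  brownian P W' /\
  forall u, natural_filtration (coords W) u `<=` natural_filtration (coords W') u.
Proof.
move=> [W0 Wc Wm Wi] ij cs cN1 W'.
have rotE u w k : W' u w k 0 = (if k == i then c * W u w i 0 + s * W u w j 0
          else if k == j then c * W u w j 0 - s * W u w i 0 else W u w k 0).
  by rewrite mxE.
have sub1 u : natural_filtration (coords W') u `<=` natural_filtration (coords W) u.
  apply: natural_coords_sub => v k uv.
  under eq_fun do rewrite rotE.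
  case: (k == i); last case: (k == j).
  - by apply: measurable_funD; apply: measurable_funM => //; exact: coord_adapted.
  - by apply: measurable_funB; apply: measurable_funM => //; exact: coord_adapted.
  - exact: coord_adapted.
have sub2 u : natural_filtration (coords W) u `<=` natural_filtration (coords W') u.
  apply: natural_coords_sub => v k uv.
  have E w : W v w k 0 = if k == i then c * W' v w i 0 - s * W' v w j 0
      else if k == j then s * W' v w i 0 + c * W' v w j 0 else W' v w k 0.
    rewrite !rotE !eqxx (_ : (j == i) = false); last by rewrite eq_sym (negbTE ij).
    case: eqP => [->|_].
      transitivity ((c ^+ 2 + s ^+ 2) * W v w i 0); last by ring.
      by rewrite cs mul1r.
    case: eqP => [->|_//].
    transitivity ((c ^+ 2 + s ^+ 2) * W v w j 0); last by ring.
    by rewrite cs mul1r.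
  under eq_fun do rewrite E.
  case: (k == i); last case: (k == j).
  - by apply: measurable_funB; apply: measurable_funM => //; exact: coord_adapted.
  - by apply: measurable_funD; apply: measurable_funM => //; exact: coord_adapted.
  - exact: coord_adapted.
split=> //; split.
- move=> w; apply/matrixP => k l; rewrite ord1 rotE W0 !mxE !mulr0 subr0 addr0.
  by case: ifP => // _; case: ifP.
- move=> w k; have -> : (fun u : R => W' u w k 0) = if k == i then
      (fun u => c * W u w i 0 + s * W u w j 0) else
      if k == j then (fun u => c * W u w j 0 - s * W u w i 0) else (fun u => W u w k 0).
    by apply/funext => u; rewrite rotE; case: ifP => // _; case: ifP.
  have cc l (b : R) : {within `[0, +oo[, continuous (fun u : R => b * W u w l 0)}.
    by move=> u; apply: cvgMl_tmp; exact: Wc.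
  case: (k == i); last case: (k == j).
  - by move=> u; apply: cvgD; exact: cc.
  - by move=> u; apply: cvgB; exact: cc.
  - exact: Wc.
- move=> u k u0; under eq_fun do rewrite rotE.
  case: (k == i); last case: (k == j).
  - by apply: measurable_funD; apply: measurable_funM => //; exact: Wm.
  - by apply: measurable_funB; apply: measurable_funM => //; exact: Wm.
  - exact: Wm.
move=> r u A B r0 ru FA mB.
set sd := Num.sqrt (u - r).
have sg : sd != 0 by rewrite gt_eqF// sqrtr_gt0 subr_gt0.
have FWA := sub1 _ _ FA.
have mA := natural_coords_measurable Wm FWA.
have u0 : 0 <= u by rewrite (le_trans r0) ?ltW.
pose D k w := W u w k 0 - W r w k 0.
have mD k : measurable_fun setT (D k) by apply: measurable_funB; exact: Wm.
pose A' := A `&` [set w | forall k, k != i -> k != j -> B k (D k w)].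
have mA' : measurable A'.
  apply: measurableI => //.
  have -> : [set w | forall k, k != i -> k != j -> B k (D k w)] =
      \bigcap_(k in [set k | k != i /\ k != j]) (D k @^-1` B k).
    by apply/seteqP; split=> w H k; [case; exact: H|move=> *; exact: H].
  apply: fin_bigcap_measurable => [|k _]; first exact: finite_finset.
  by rewrite -[X in measurable X]setTI; exact: mD.
have mDD : measurable_fun setT
    (fun w => (D i w, D j w) : measurableTypeR R * measurableTypeR R).
  exact: (@measurable_fun_pair _ _ _ Om (measurableTypeR R) (measurableTypeR R) _ _ (mD i) (mD j)).
pose kap := (P A * \prod_(k < n | (k != i) && (k != j)) normal_prob 0 sd (B k))%E.
have Nfin k : normal_prob 0 sd (B k) \is a fin_num by apply: fin_num_measure; exact: mB.
have kapfin : kap \is a fin_num.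
  rewrite fin_numM ?fin_num_measure//.
  by apply: (big_ind (fun x => x \is a fin_num)) => [//|x y|k _]; [exact: fin_numM|exact: Nfin].
have kap0 : 0 <= fine kap.
  apply: fine_ge0; rewrite mule_ge0//.
  by apply: (big_ind (fun x => 0 <= x)%E) => [//|x y|//]; exact: mule_ge0.
have scaleE S : mscale (NngNum kap0) (normal_prob 0 sd \x normal_prob 0 sd)%E S =
    (kap * (normal_prob 0 sd \x normal_prob 0 sd)%E S)%E.
  by rewrite /mscale /=; congr (_ * _)%E; rewrite -[RHS]fineK.
have prodE (C : 'I_n -> set R) : (\prod_k normal_prob 0 sd (C k) =
    normal_prob 0 sd (C i) * (normal_prob 0 sd (C j) *
      \prod_(k < n | (k != i) && (k != j)) normal_prob 0 sd (C k)))%E.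
  by rewrite (bigD1 i)//= (bigD1 j)//= eq_sym.
(* Both sides are finite measures in [S]; they agree on rectangles, where the Brownian property of
   [W] applies. *)
have key (S : set (measurableTypeR R * measurableTypeR R)) : measurable S ->
   pushforward (mrestr P mA') (fun w => (D i w, D j w)) S =
   (kap * (normal_prob 0 sd \x normal_prob 0 sd)%E S)%E.
  move=> mS; rewrite -scaleE.
  pose mDD' : {mfun Om >-> (measurableTypeR R * measurableTypeR R)%type} :=
    HB.pack (fun w => (D i w, D j w) : measurableTypeR R * measurableTypeR R) (isMeasurableFun.Build _ _ _ _ _ mDD).
  apply: (@measure_unique _ R _
    [set A1 `*` A2 | A1 in measurable & A2 in measurable] (fun=> setT) _ _ _ _
    (pushforward (mrestr P mA') mDD') (mscale (NngNum kap0) (normal_prob 0 sd \x normal_prob 0 sd)%E)) => //.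
  - exact: measurable_prod_measurableType.
  - move=> _ _ [A1 mA1 [A2 mA2 <-]] [A3 mA3 [A4 mA4 <-]].
    exists (A1 `&` A3); first exact: measurableI.
    by exists (A2 `&` A4); [exact: measurableI|rewrite setXI].
  - by move=> _; exists setT => //; exists setT => //; rewrite setXTT.
  - by rewrite bigcup_const.
  - move=> _ [A1 mA1 [A2 mA2 <-]].
    rewrite [RHS]scaleE product_measure1E// /pushforward /mrestr /=.
    pose C k := if k == i then A1 else if k == j then A2 else B k.
    have E1 : (fun w => (D i w, D j w)) @^-1` (A1 `*` A2) `&` A' =
        A `&` [set w | forall k, C k (W u w k 0 - W r w k 0)].
      apply/seteqP; split=> w /=.
        move=> [[h1 h2] [hA h3]]; split=> // k; rewrite /C.
        have [->//|ki] := eqVneq k i; have [->//|kj] := eqVneq k j; exact: h3.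
      move=> [hA h]; split; [split|split] => //.
      + by have := h i; rewrite /C eqxx.
      + by have := h j; rewrite /C eqxx eq_sym (negbTE ij).
      + by move=> k ki kj; have := h k; rewrite /C (negbTE ki) (negbTE kj).
    transitivity (P (A `&` [set w | forall k, C k (W u w k 0 - W r w k 0)])).
      by rewrite -E1.
    rewrite Wi//; last by move=> k; rewrite /C; case: ifP => // _; case: ifP.
    rewrite prodE /kap {1 2}/C eqxx eq_sym (negbTE ij) eqxx.
    rewrite [in LHS](eq_bigr (fun k => normal_prob 0 sd (B k))); last first.
      by move=> k /andP[ki kj]; rewrite /C (negbTE ki) (negbTE kj).
    by rewrite -[RHS]muleA; congr (_ * _)%E; rewrite muleA muleC.
  - move=> _; rewrite ltey_eq /= /pushforward fin_num_measure//.
    by rewrite preimage_setT.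
have mBB := @measurableX _ _ (measurableTypeR R) (measurableTypeR R) _ _ (mB i) (mB j).
have mS : measurable [set z : measurableTypeR R * measurableTypeR R |
   (B i `*` B j) (c * z.1 + s * z.2, c * z.2 - s * z.1)].
  have mrot : measurable_fun setT
    (fun z : measurableTypeR R * measurableTypeR R =>
      (c * z.1 + s * z.2, c * z.2 - s * z.1) : measurableTypeR R * measurableTypeR R).
    apply: measurable_fun_pair => //=; [apply: measurable_funD|apply: measurable_funB];
      by apply: measurable_funM.
  by have := mrot measurableT _ mBB; rewrite setTI.
(* A constraint on the rotated increments is one on the original increments, with the set turned
   back; its Gaussian mass is unchanged. *)
have keyE : pushforward (mrestr P mA') (fun w => (D i w, D j w))
   [set z : measurableTypeR R * measurableTypeR R |
     (B i `*` B j) (c * z.1 + s * z.2, c * z.2 - s * z.1)] =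
   (kap * (normal_prob 0 sd (B i) * normal_prob 0 sd (B j)))%E.
  rewrite (key _ mS); congr (_ * _)%E; rewrite (gaussian_plane_rotation sg cs cN1 mBB).
  exact: (@product_measure1E _ _ (measurableTypeR R) (measurableTypeR R) R (normal_prob 0 sd) (normal_prob 0 sd) _ _ (mB i) (mB j)).
rewrite prodE; transitivity (kap * (normal_prob 0 sd (B i) * normal_prob 0 sd (B j)))%E; last first.
  by rewrite /kap -muleA; congr (_ * _)%E; rewrite [RHS]muleA muleC.
rewrite -keyE /pushforward /mrestr; congr (P _).
apply/seteqP; split=> w /=.
  move=> [hA h]; split; last split=> //.
    split.
      by have := h i; rewrite !rotE eqxx /D; congr (B i _); ring.
    have := h j; rewrite !rotE eqxx eq_sym (negbTE ij) /D; congr (B j _); ring.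
  by move=> k ki kj; have := h k; rewrite !rotE (negbTE ki) (negbTE kj).
move=> [[h1 h2] [hA h3]]; split=> // k; rewrite !rotE.
have [->|ki] := eqVneq k i; first by move: h1; congr (B i _); rewrite /D; ring.
have [->|kj] := eqVneq k j; first by move: h2; congr (B j _); rewrite /D; ring.
exact: h3.
Qed.

End givens.

(** * Alignment with a direction, and independence of the coordinates *)

Section brownian_independence.
Context d (Om : measurableType d) (R : realType) (P : probability Om R) (n : nat).
Implicit Types W : R -> Om -> 'cV[R]_n.

(** Givens rotations in the planes of [i0] and [j] clear the coefficients [u j 0] one after the
    other; in the end the coefficient at [i0] carries the whole norm of [u]. *)
Lemma brownian_align W (u : 'cV[R]_n) (i0 : 'I_n) : brownian P W ->
  exists W' c, [/\ brownian P W',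
    forall s, natural_filtration (coords W) s `<=` natural_filtration (coords W') s,
    forall s w, dot u (W s w) = c * W' s w i0 0 & c ^+ 2 = dot u u].
Proof.
have [m] := ubnP #|[pred j | (j != i0) && (u j 0 != 0)]|.
elim: m => // m ih in W u *; rewrite ltnS => um bW.
have [/existsP[j /andP[ji uj]]|] := boolP [exists j, (j != i0) && (u j 0 != 0)]; last first.
  rewrite negb_exists => /forallP uz; exists W, (u i0 0); split=> [//|s A //|s w|].
    rewrite dotE (bigD1 i0)//= big1 ?addr0// => k ki.
    by have := uz k; rewrite ki /= negbK => /eqP ->; rewrite mul0r.
  rewrite dotE (bigD1 i0)//= big1 ?addr0 ?expr2// => k ki.
  by have := uz k; rewrite ki /= negbK => /eqP ->; rewrite mul0r.
pose rho := Num.sqrt (u i0 0 ^+ 2 + u j 0 ^+ 2).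
have uj2 : 0 < u j 0 ^+ 2 by rewrite exprn_even_gt0.
have ui2 : 0 <= u i0 0 ^+ 2 by exact: sqr_ge0.
have rho0 : 0 < rho by rewrite sqrtr_gt0; lra.
have rhoN : rho != 0 by rewrite gt_eqF.
have rho2 : rho ^+ 2 = u i0 0 ^+ 2 + u j 0 ^+ 2 by rewrite sqr_sqrtr//; lra.
pose c := u i0 0 / rho; pose s := u j 0 / rho.
have rc : rho * c = u i0 0 by rewrite mulrC divfK.
have rs : rho * s = u j 0 by rewrite mulrC divfK.
have cs : c ^+ 2 + s ^+ 2 = 1.
  by rewrite /c /s !expr_div_n -mulrDl -rho2 divff// expf_neq0.
have s0 : s != 0 by rewrite mulf_neq0 ?invr_neq0.
(* Since [u j 0] is nonzero the angle is not a half turn, which the decomposition into shears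
   excludes. *)
have cN1 : c != -1.
  apply: contra_neq s0 => cN; move: cs; rewrite cN sqrrN expr1n => /eqP.
  by rewrite addrC -subr_eq0 addrK sqrf_eq0 => /eqP.
have ij : i0 != j by rewrite eq_sym.
have [bW' sW'] := brownian_rotate bW ij cs cN1.
pose u' : 'cV[R]_n := \col_k (if k == i0 then rho else if k == j then 0 else u k 0).
have um' : (#|[pred k | (k != i0) && (u' k 0 != 0)%R]| < m)%N.
  apply: leq_trans um; apply: proper_card; apply/properP; split.
    apply/fintype.subsetP => k; rewrite !inE mxE => /andP[ki]; rewrite ki (negbTE ki).
    by case: (k == j); rewrite ?eqxx.
  by exists j; rewrite !inE ?ji ?uj// mxE (negbTE ji) eqxx eqxx andbF.
have dot2 (x y : 'cV[R]_n) : dot x y = x i0 0 * y i0 0 + (x j 0 * y j 0 +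
    \sum_(k | (k != i0) && (k != j)) x k 0 * y k 0).
  by rewrite dotE (bigD1 i0)//= (bigD1 j).
have [W'' [c'' [bW'' sW'' dW'' cW'']]] := ih _ u' um' bW'.
exists W'', c''; split=> //.
- by move=> v A /sW' /sW''.
- move=> v w; rewrite -dW'' !dot2 !mxE !eqxx (negbTE ji) -rc -rs !addrA.
  rewrite mul0r addr0; congr (_ + _); first by ring.
  by apply: eq_bigr => k /andP[ki kj]; rewrite !mxE (negbTE ki) (negbTE kj).
rewrite cW'' !dot2 !mxE !eqxx (negbTE ji) !addrA mulr0 addr0.
rewrite -expr2 rho2 !expr2; congr (_ + _).
by apply: eq_bigr => k /andP[ki kj]; rewrite !mxE (negbTE ki) (negbTE kj).
Qed.

Lemma indep_mono (G G' H H' : set (set Om)) : G `<=` G' -> H `<=` H' ->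
  indep P G' H' -> indep P G H.
Proof. by move=> GG HH GH A B /GG GA /HH HB; exact: GH. Qed.

Context (W : R -> Om -> 'cV[R]_n) (bW : brownian P W).

Definition gens_at (K : pred 'I_n) (D : set R) : set (set Om) :=
  [set A | exists i (u : R) (B : set R),
    [/\ K i, D u, measurable B & A = (fun w => W u w i 0) @^-1` B]].

Lemma gens_at_adapted (K : pred 'I_n) (D : set R) i u : K i -> D u ->
  measurable_fun setT ((fun w => W u w i 0) : g_sigma_algebraType (gens_at K D) -> R).
Proof.
move=> Ki Du _ B mB; rewrite setTI; apply: sub_sigma_algebra.
by exists i, u, B.
Qed.

Lemma gens_at_sub (K : pred 'I_n) (D : set R) (G : set (set Om)) :
  (forall i u, K i -> D u -> measurable_fun setT ((fun w => W u w i 0) : g_sigma_algebraType G -> R)) ->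
  <<s gens_at K D >> `<=` <<s G >>.
Proof.
move=> H; apply: smallest_sub; first exact: smallest_sigma_algebra.
move=> _ [i [u [B [Ki Du mB ->]]]].
by have := H i u Ki Du measurableT B mB; rewrite setTI.
Qed.

Lemma gens_at_measurable (K : pred 'I_n) (D : set R) : (forall u, D u -> 0 <= u) ->
  <<s gens_at K D >> `<=` measurable.
Proof.
move=> D0; apply: sigma_measurable => _ [i [u [B [Ki Du mB ->]]]].
rewrite -[X in measurable X]setTI.
by case: bW => _ _ Wm _; apply: Wm => //; exact: D0.
Qed.

Lemma gens_at_filtration (K : pred 'I_n) (D : set R) r : (forall u, D u -> 0 <= u <= r) ->
  <<s gens_at K D >> `<=` natural_filtration (coords W) r.
Proof.
move=> Dr; apply: gens_at_sub => i u _ /Dr ur; exact: coord_adapted.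
Qed.

Lemma path_times (us : seq R) u : path <%R 0 us -> u \in us -> 0 <= u <= last 0 us.
Proof.
elim/last_ind: us => [//|us s ih]; rewrite rcons_path last_rcons => /andP[pus lus].
rewrite mem_rcons inE => /predU1P[->|/(ih pus)/andP[-> ul]].
  rewrite lexx andbT; apply: le_trans (ltW lus).
  case/lastP: us pus {ih lus} => [//|us v].
  by rewrite last_rcons (path_sortedE lt_trans) => /andP[/allP h _]; rewrite ltW// h// mem_rcons mem_head.
by rewrite (le_trans ul)// ltW.
Qed.

(** A pi-system generating the coordinates in [K] up to [s]: a past event together with a rectangle
    of increments over the last step. *)
Definition incr_gens (K : pred 'I_n) (us : seq R) (s : R) : set (set Om) :=
  [set A | exists G (C : 'I_n -> set R), [/\ <<s gens_at K [set` us] >> G,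
     forall i, measurable (C i) &
     A = G `&` [set w | forall i, K i -> C i (W s w i 0 - W (last 0 us) w i 0)]]].

Lemma incr_gens_sub (K : pred 'I_n) us s : path <%R 0 (rcons us s) ->
  <<s gens_at K [set` rcons us s] >> `<=` <<s incr_gens K us s >>.
Proof.
move=> pus; apply: gens_at_sub => i u Ki /=.
have mus v : v \in us -> measurable_fun setT
    ((fun w => W v w i 0) : g_sigma_algebraType (incr_gens K us s) -> R).
  move=> vu _ B mB; rewrite setTI; apply: sub_sigma_algebra.
  exists ((fun w => W v w i 0) @^-1` B), (fun=> setT); split=> //.
    by apply: sub_sigma_algebra; exists i, v, B.
  by apply/seteqP; split=> w /=; [|case].
rewrite mem_rcons inE => /predU1P[->|]; last exact: mus.
have -> : (fun w => W s w i 0) = (fun w => W (last 0 us) w i 0 + (W s w i 0 - W (last 0 us) w i 0)).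
  by apply/funext => w; ring.
apply: measurable_funD.
  case/lastP: us mus {pus} => [_|us v mus]; last by rewrite last_rcons; apply: mus; rewrite mem_rcons mem_head.
  rewrite /=; case: bW => W0 _ _ _; under eq_fun do rewrite W0 mxE.
  exact: measurable_cst.
move=> _ B mB; rewrite setTI; apply: sub_sigma_algebra.
exists setT, (fun k => if k == i then B else setT); split.
- exact: (@measurableT _ (g_sigma_algebraType (gens_at K [set` us]))).
- by move=> k; case: ifP.
- rewrite setTI; apply/seteqP; split=> w /=.
    by move=> Bw k Kk; case: eqP => // ->.
  by move=> /(_ i Ki); rewrite eqxx.
Qed.

(** Induction on the times: the last increments are independent of the past and of each other, and
    the past events are independent by induction. *)
Lemma indep_times (K : pred 'I_n) us : path <%R 0 us ->
  indep P (<<s gens_at K [set` us] >>) (<<s gens_at (predC K) [set` us] >>).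
Proof.
elim/last_ind: us => [_|us s ih pus].
  have sub K' : <<s gens_at K' [set` [::]] >> `<=` <<s [set [set: Om]] >>.
    by apply: gens_at_sub.
  apply: (indep_mono (sub _) (sub _)); apply: indep_sigma => //.
  - by move=> _ ->.
  - by move=> _ ->.
  - by move=> _ _ -> ->; rewrite setIT.
  - by move=> _ _ -> ->; rewrite setIT.
  - by move=> _ _ -> ->; rewrite setIT probability_setT mule1.
apply: (indep_mono (incr_gens_sub pus) (incr_gens_sub pus)).
have := pus; rewrite rcons_path => /andP[pus' ls].
have r0 : 0 <= last 0 us.
  case/lastP: (us) pus' => [//|us' v] pv; rewrite last_rcons.
  have vv : v \in rcons us' v by rewrite mem_rcons mem_head.
  by case/andP: (path_times pv vv).
have uspos u : [set` us] u -> 0 <= u by move=> /= /(path_times pus')/andP[].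
have usr u : [set` us] u -> 0 <= u <= last 0 us by move=> /= /(path_times pus').
have s0 : 0 <= s by rewrite (le_trans r0) ?ltW.
have [_ _ Wm Wi] := bW.
(* The Brownian property with [setT] at the coordinates outside [K']. *)
have incr_prob (K' : pred 'I_n) G C : natural_filtration (coords W) (last 0 us) G -> (forall i, measurable (C i)) ->
  P (G `&` [set w | forall i, K' i -> C i (W s w i 0 - W (last 0 us) w i 0)]) =
  (P G * \prod_(i < n | K' i) normal_prob 0 (Num.sqrt (s - last 0 us))%R (C i))%E.
  move=> FG mC.
  transitivity (P (G `&` [set w | forall i, (if K' i then C i else setT)
      (W s w i 0 - W (last 0 us) w i 0)])).
    congr (P (_ `&` _)); apply/seteqP; split=> w /= H i.
      by have := H i; case: (K' i) => //; exact.
    by move=> K'i; have := H i; rewrite K'i.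
  rewrite (Wi _ _ G (fun i => if K' i then C i else setT))//; last by move=> i; case: ifP.
  congr (_ * _)%E; rewrite [RHS]big_mkcond /=; apply: eq_bigr => i _.
  by case: ifP => // _; exact: probability_setT.
have incrm (K' : pred 'I_n) : incr_gens K' us s `<=` measurable.
  move=> _ [G [C [sG mC ->]]]; apply: measurableI.
    exact: (gens_at_measurable uspos sG).
  have -> : [set w | forall i, K' i -> C i (W s w i 0 - W (last 0 us) w i 0)] =
     \bigcap_(i in [set i | K' i]) ((fun w => W s w i 0 - W (last 0 us) w i 0) @^-1` C i).
    by apply/seteqP; split=> w H i; exact: H.
  apply: fin_bigcap_measurable => [|i _]; first exact: finite_finset.
  rewrite -[X in measurable X]setTI; apply: measurable_funB => //; exact: Wm.
have incrI (K' : pred 'I_n) : setI_closed (incr_gens K' us s).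
  move=> _ _ [G [C [sG mC ->]]] [G' [C' [sG' mC' ->]]].
  exists (G `&` G'), (fun i => C i `&` C' i); split.
  - exact: (@measurableI _ (g_sigma_algebraType (gens_at K' [set` us]))).
  - by move=> i; exact: measurableI.
  - apply/seteqP; split=> w /=.
      by move=> [[gw h] [gw' h']]; split=> // i K'i; split; [exact: h|exact: h'].
    by move=> [[gw gw'] h]; do 2 split=> //; move=> i /h[].
have incrT (K' : pred 'I_n) : incr_gens K' us s setT.
  exists setT, (fun=> setT); split=> //.
    exact: (@measurableT _ (g_sigma_algebraType (gens_at K' [set` us]))).
  by apply/seteqP; split=> w.
apply: indep_sigma => //.
move=> _ _ [G [C [sG mC ->]]] [G' [C' [sG' mC' ->]]].
have FG := gens_at_filtration usr sG; have FG' := gens_at_filtration usr sG'.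
have FGG' : natural_filtration (coords W) (last 0 us) (G `&` G').
  exact: (@measurableI _ (g_sigma_algebraType (coord_gens W (last 0 us)))).
rewrite (incr_prob K G C)// (incr_prob (predC K) G' C')//.
transitivity (P ((G `&` G') `&` [set w | forall i, predT i -> (if K i then C i else C' i)
     (W s w i 0 - W (last 0 us) w i 0)])).
  congr (P _); apply/seteqP; split=> w /=.
    move=> [[gw h] [gw' h']]; split=> // i _; case: ifPn => Ki; [exact: h|exact: h'].
  move=> [[gw gw'] h]; split; split=> // i.
    by move=> Ki; have := h i isT; rewrite Ki.
  by move=> Ki; have := h i isT; rewrite (negbTE Ki).
rewrite (incr_prob predT (G `&` G') (fun i => if K i then C i else C' i))//; last by move=> i; case: ifP.
rewrite (ih pus' G G' sG sG') (bigID K) /= [RHS]muleACA; congr (_ * (_ * _))%E.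
  by apply: eq_bigr => i ->.
by apply: eq_bigr => i /negbTE ->.
Qed.

(** Events involving finitely many times form a generating pi-system, which reduces the claim to
    [indep_times]. *)
Lemma indep_processes (K : pred 'I_n) :
  indep P (<<s gens_at K [set u | 0 <= u] >>) (<<s gens_at (predC K) [set u | 0 <= u] >>).
Proof.
pose cyl (K' : pred 'I_n) : set (set Om) := [set A | exists us : seq R,
  (forall u, u \in us -> 0 <= u) /\ <<s gens_at K' [set` us] >> A].
have cylsub (K' : pred 'I_n) : <<s gens_at K' [set u | 0 <= u] >> `<=` <<s cyl K' >>.
  apply: gens_at_sub => i u K'i /= u0 _ B mB; rewrite setTI; apply: sub_sigma_algebra.
  exists [:: u]; split; first by move=> v; rewrite inE => /eqP ->.
  by apply: sub_sigma_algebra; exists i, u, B; split=> //=; rewrite inE.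
have cylmono K' (us vs : seq R) : {subset us <= vs} ->
    <<s gens_at K' [set` us] >> `<=` <<s gens_at K' [set` vs] >>.
  by move=> uv; apply: gens_at_sub => i u K'i /= uus; apply: gens_at_adapted => //=; exact: uv.
have cylm (K' : pred 'I_n) : cyl K' `<=` measurable.
  by move=> A [us [us0]]; apply: gens_at_measurable => u /= /us0.
have cylI (K' : pred 'I_n) : setI_closed (cyl K').
  move=> A B [us [us0 sA]] [vs [vs0 sB]]; exists (us ++ vs); split.
    by move=> u; rewrite mem_cat => /orP[/us0|/vs0].
  apply: (@measurableI _ (g_sigma_algebraType (gens_at K' [set` us ++ vs]))).
    by apply: cylmono sA => u uus; rewrite mem_cat uus.
  by apply: cylmono sB => u uus; rewrite mem_cat uus orbT.
have cylT (K' : pred 'I_n) : cyl K' setT.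
  by exists [::]; split=> //; exact: (@measurableT _ (g_sigma_algebraType (gens_at K' [set` [::]]))).
apply: (indep_mono (cylsub _) (cylsub _)); apply: indep_sigma => //.
move=> A B [us [us0 sA]] [vs [vs0 sB]].
(* A common increasing list of positive times; time 0 carries no information because [W] starts at
   0. *)
pose ts := sort <=%R (undup [seq u <- us ++ vs | 0 < u]).
have pts : path <%R 0 ts.
  rewrite (path_sortedE lt_trans); apply/andP; split.
    by apply/allP => u; rewrite mem_sort mem_undup mem_filter => /andP[].
  by rewrite lt_sorted_uniq_le sort_uniq undup_uniq sort_le_sorted.
have norm K' (xs : seq R) C : {subset xs <= us ++ vs} -> (forall u, u \in xs -> 0 <= u) ->
    <<s gens_at K' [set` xs] >> C -> <<s gens_at K' [set` ts] >> C.
  move=> xuv x0; apply: gens_at_sub => i u K'i /= ux.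
  have := x0 u ux; rewrite le_eqVlt => /predU1P[e|u0].
    case: bW => W0 _ _ _; rewrite (_ : (fun w => W u w i 0) = cst 0); first exact: measurable_cst.
    by apply/funext => w; rewrite -e W0 mxE.
  by apply: gens_at_adapted => //=; rewrite mem_sort mem_undup mem_filter u0 xuv.
apply: (indep_times pts).
  by apply: norm sA => // u uus; rewrite mem_cat uus.
by apply: norm sB => // u uus; rewrite mem_cat uus orbT.
Qed.

End brownian_independence.

(** * Measurability of Ornstein-Uhlenbeck processes and path integrals *)

Section right_continuous_process.
Context d (T : measurableType d) (R : realType).
Context (a b : R) (ab : a <= b) (Phi : R -> T -> R).
Context (mPhi : forall s, a <= s <= b -> measurable_fun setT (Phi s)).
Context (rcPhi : forall w s, a <= s < b -> forall e : R, 0 < e ->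
  exists2 dl : R, 0 < dl & forall u, s < u < s + dl -> u <= b -> `|Phi u w - Phi s w| <= e).

(** Extends the process constantly outside [[a, b]], so that joint measurability can be stated on
    the whole product. *)
Definition clamp (s : R) := Num.min (Num.max s a) b.

Lemma clamp_itv s : a <= clamp s <= b.
Proof. by rewrite /clamp le_min ab le_max lexx orbT /= ge_min lexx orbT. Qed.

Lemma clamp_id s : a <= s <= b -> clamp s = s.
Proof. by move=> /andP[h1 h2]; rewrite /clamp (max_l h1) (min_l h2). Qed.

(** [kap n s] is the first point of the grid of step [1 / n.+1] strictly to the right of
    [Num.max s a]. Right continuity makes the process sampled there converge, and each sampled
    process is measurable piece by piece. *)
Let pos n (s : R) : R := Num.max 0 ((s - a) * n.+1%:R).
Let kap n (s : R) : R := a + (Num.truncn (pos n s)).+1%:R / n.+1%:R.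

Let kap_itv n s : Num.max s a < kap n s <= Num.max s a + n.+1%:R^-1.
Proof.
have p0 : 0 <= pos n s by rewrite le_max lexx.
have n0 : 0 < n.+1%:R :> R by rewrite ltr0n.
have posE : pos n s = (Num.max s a - a) * n.+1%:R.
  rewrite /pos; have [sa|as_] := leP s a; first by rewrite subrr mul0r max_l// mulr_le0_ge0// subr_le0.
  by rewrite max_r// mulr_ge0// subr_ge0 ltW.
have /andP[h1 h2] := truncn_itv p0.
rewrite /kap; apply/andP; split.
  by rewrite -ltrBlDl ltr_pdivlMr// -posE.
rewrite -lerBrDl addrAC ler_pdivrMr// mulrDl -posE mulVf ?gt_eqF//.
by rewrite -natr1 lerD2r.
Qed.

Let Phin n (z : T * R) : R := Phi (clamp (kap n z.2)) z.1.

Let mPhin n : measurable_fun setT (Phin n).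
Proof.
move=> _ B mB; rewrite setTI.
have -> : Phin n @^-1` B = \bigcup_k
    ((Phi (clamp (a + k.+1%:R / n.+1%:R)) @^-1` B) `*` (pos n @^-1` `[k%:R, k.+1%:R[)).
  apply/seteqP; split=> [[w s] /= H|[w s] [k _ [/= H1]]].
    exists (Num.truncn (pos n s)) => //; split=> //=.
    by rewrite in_itv /= truncn_itv// le_max lexx.
  rewrite in_itv /= => H2; rewrite /Phin /kap /=.
  suff -> : Num.truncn (pos n s) = k by [].
  by apply: truncn_def.
apply: bigcupT_measurable => k; apply: measurableX.
  by rewrite -[X in measurable X]setTI; apply: mPhi => //; exact: clamp_itv.
rewrite -[X in measurable X]setTI; apply: (_ : measurable_fun setT (pos n)) => //.
apply: measurable_maxr => //; apply: measurable_funM => //; exact: measurable_funB.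
Qed.

Lemma measurable_process :
  measurable_fun setT (fun z : T * R => Phi (clamp z.2) z.1).
Proof.
apply/measurable_EFinP.
apply: (emeasurable_fun_cvg (fun n z => (Phin n z)%:E)) => [n|[w s] _].
  exact/measurable_EFinP.
apply/cvg_EFin => //; first exact: nearW.
apply/cvgrPdist_le => e e0 /=.
have [bs|sb] := leP b (Num.max s a).
  near=> n; rewrite /Phin /=; have /andP[k1 _] := kap_itv n s.
  rewrite /clamp (min_r bs) min_r ?subrr ?normr0 ?ltW//.
  by rewrite lt_max (le_lt_trans bs k1).
have cs : clamp s = Num.max s a by rewrite /clamp min_l// ltW.
have /rcPhi : a <= Num.max s a < b by rewrite sb le_max lexx orbT.
move=> /(_ w e e0)[dl dl0 H].
near=> n; rewrite /Phin /= cs distrC; have /andP[k1 k2] := kap_itv n s.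
have ak : a <= kap n s by rewrite ltW// (le_lt_trans _ k1)// le_max lexx orbT.
apply: H; last by have /andP[] := clamp_itv (kap n s).
rewrite /clamp (max_l ak) lt_min k1 sb /= gt_min; apply/orP; left.
apply: (le_lt_trans k2); rewrite ltrD2l.
near: n; exact: near_infty_natSinv_lt (PosNum dl0).
Unshelve. all: by end_near. Qed.

Lemma measurable_path w : measurable_fun `[a, b] (fun s => Phi s w).
Proof.
have m1 : measurable_fun setT (fun s : R => (w, s)).
  by apply: measurable_fun_pair.
have := measurableT_comp measurable_process m1.
move=> /(measurable_funTS (D := `[a, b]%classic)); apply: eq_measurable_fun => s.
by rewrite inE /= in_itv /= => sab; rewrite clamp_id.
Qed.

Lemma measurable_integral_process (mu : {sigma_finite_measure set (measurableTypeR R) -> \bar R}) :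
  (forall s w, a <= s <= b -> 0 <= Phi s w) ->
  measurable_fun setT (fun w => (\int[mu]_(s in `[a, b]) (Phi s w)%:E)%E).
Proof.
move=> Phi0.
pose f (z : T * measurableTypeR R) : \bar R :=
  ((\1_(`[a, b]%classic : set R) z.2)%:E * (Phi (clamp z.2) z.1)%:E)%E.
have mf : measurable_fun setT f.
  apply: emeasurable_funM; last by apply/measurable_EFinP; exact: measurable_process.
  apply/measurable_EFinP; have mi : measurable_fun setT (\1_(`[a, b]%classic) : measurableTypeR R -> R) by exact: measurable_indic.
  exact: (measurableT_comp mi measurable_snd).
have f0 z : (0 <= f z)%E.
  by rewrite mule_ge0 ?lee_fin// Phi0 ?clamp_itv.
have := @measurable_fun_fubini_tonelli_F _ _ _ _ R mu f mf f0.
apply: eq_measurable_fun => w _; rewrite /fubini_F [RHS]integral_mkcond.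
apply: eq_integral => s _; rewrite patchE /f /= indicE; case: ifPn => [|_]; last by rewrite mul0e.
by rewrite inE /= in_itv /= => sab; rewrite mul1e clamp_id.
Qed.

End right_continuous_process.

(** * The Ornstein-Uhlenbeck equation, path by path *)

Section ornstein_uhlenbeck.
Context (R : realType).
Notation mu := (@lebesgue_measure R).
Implicit Types (gamma t T z : R) (n p : R -> R).

Lemma within_cc_sub (a b a' b' : R) (f : R -> R) : a <= a' -> b' <= b ->
  {within `[a, b], continuous f} -> {within `[a', b'], continuous f}.
Proof.
move=> aa bb; apply: continuous_subspaceW => x /=; rewrite !in_itv /= => /andP[h1 h2].
by rewrite (le_trans aa h1) (le_trans h2 bb).
Qed.

Lemma within_integrable (a b : R) (f : R -> R) :
  {within `[a, b], continuous f} -> mu.-integrable `[a, b] (EFin \o f).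
Proof. by move=> cf; apply: continuous_compact_integrable => //; exact: segment_compact. Qed.

(* The integrating factor [exp (gamma s)] turns the equation into an explicit integral. *)
Lemma ou_path_explicit gamma t T z n p : {within `[t, T], continuous n} ->
  ou_path gamma t T z n p -> forall s, t <= s <= T ->
  p s = z - gamma * (expR (- (gamma * s)) *
    \int[mu]_(u in `[t, s]) (expR (gamma * u) * (z + (n u - n t)))) + (n s - n t).
Proof.
move=> cn [cp hp] s /andP[ts sT]; rewrite hp ?ts//.
congr (_ - _ * _ + _).
move: ts; rewrite le_eqVlt => /predU1P[<-|ts].
  by rewrite set_itv1 !Rintegral_set1 mulr0.
(* By the equation, [p] is [z] minus [gamma] times [I] plus noise, so [G] has derivative [f]; since
   [G] vanishes at [t], the integral of [f] is [G s]. *)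
pose I (x : R) := \int[mu]_(u in `[t, x]) p u.
pose f (u : R) := expR (gamma * u) * (z + (n u - n t)).
pose G (u : R) := expR (gamma * u) * I u.
have cps : {within `[t, s], continuous p} by exact: within_cc_sub cp.
have cns : {within `[t, s], continuous n} by exact: within_cc_sub cn.
have ip := within_integrable cps.
have cI : {within `[t, s], continuous I}.
  by apply: parameterized_integral_continuous => //; exact: ltW.
have ce : continuous (fun u : R => expR (gamma * u)).
  move=> u; apply: (cvg_comp (fun u : R => gamma * u) expR); last exact: continuous_expR.
  by apply: cvgMl_tmp; exact: cvg_id.
have cf : {within `[t, s], continuous f}.
  move=> u; apply: cvgM; first by apply: continuous_subspaceT; exact: ce.
  by apply: cvgD; [exact: cvg_cst|apply: cvgB; [exact: cns|exact: cvg_cst]].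
have cG : {within `[t, s], continuous G}.
  move=> u; apply: cvgM; first by apply: continuous_subspaceT; exact: ce.
  exact: cI.
have [cpo _ _] := (continuous_within_itvP p ts).1 cps.
have [cGo cGl cGr] := (continuous_within_itvP G ts).1 cG.
have dI x : x \in `]t, s[ -> is_derive x 1 I (p x).
  move=> xts; have := xts; rewrite in_itv /= => /andP[tx xs].
  have [d1 d2] := @continuous_FTC1_closed _ p t x s xs ip tx (cpo x xts).
  by apply: DeriveDef => //; rewrite -d2 derive1E.
have dE (x : R) : is_derive x 1 (fun u : R => expR (gamma * u)) (gamma * expR (gamma * x)).
  have dm : is_derive x 1 (fun u : R => gamma * u) gamma.
    have -> : (fun u : R => gamma * u) = gamma \*: (@id R) by [].
    by apply: is_derive_eq; rewrite scaler1.
  have dm1 : derivable (fun u : R => gamma * u) x 1 by case: dm.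
  have de1 : derivable (@expR R) (gamma * x) 1 by exact: derivable_expR.
  apply: DeriveDef.
    apply/derivable1_diffP; apply: (@differentiable_comp _ _ _ _ (fun u : R => gamma * u) expR);
      exact/derivable1_diffP.
  rewrite -derive1E (_ : (fun u : R => expR (gamma * u)) = expR \o (fun u : R => gamma * u))//.
  rewrite (derive1_comp dm1 de1) !derive1E mulrC.
  by case: dm => _ ->; rewrite derive_val.
have dG x : x \in `]t, s[ -> is_derive x 1 G (f x).
  move=> xts; have dIx := dI x xts; have dEx := dE x.
  apply: (is_derive_eq (is_deriveM dEx dIx)).
  have xtT : t <= x <= T.
    by move: xts; rewrite in_itv /= => /andP[/ltW-> /ltW xs]; rewrite (le_trans xs).
  by rewrite /f hp// /GRing.scale /= -/(I x); ring.
have e : (\int[mu]_(x in `[t, s]) (f x)%:E = (G s)%:E - (G t)%:E)%E.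
  apply: continuous_FTC2 => //.
    by split=> // x xts; have [] := dG x xts.
  by move=> x xts; have [_ <-] := dG x xts; rewrite derive1E.
have -> : \int[mu]_(u in `[t, s]) f u = G s - G t by rewrite /Rintegral e.
by rewrite /G /I set_itv1 Rintegral_set1 mulr0 subr0 mulrA -expRD addNr expR0 mul1r.
Qed.

Lemma ou_path_unique gamma t T z n p p' : {within `[t, T], continuous n} ->
  ou_path gamma t T z n p -> ou_path gamma t T z n p' ->
  forall s, t <= s <= T -> p s = p' s.
Proof.
move=> cn hp hp' s sT.
by rewrite (ou_path_explicit cn hp sT) (ou_path_explicit cn hp' sT).
Qed.

Lemma ou_path_sum (I : Type) (r : seq I) (k z : I -> R) (n p : I -> R -> R) gamma t T :
  (forall i, ou_path gamma t T (z i) (n i) (p i)) ->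
  ou_path gamma t T (\sum_(i <- r) k i * z i) (fun s => \sum_(i <- r) k i * n i s)
    (fun s => \sum_(i <- r) k i * p i s).
Proof.
move=> H; elim: r => [|i r [ih1 ih2]].
  split=> [|s st].
    have -> : (fun s : R => \sum_(i <- [::]) k i * p i s) = cst 0.
      by apply/funext => u; rewrite big_nil.
    by move=> u; exact: cvg_cst.
  under eq_Rintegral => u _ do rewrite big_nil.
  by rewrite !big_nil Rintegral_cst// mul0r mulr0; ring.
have [c1 c2] := H i.
have ck : {within `[t, T], continuous (fun s => k i * p i s)}.
  by move=> u; apply: cvgMl_tmp; exact: c1.
split=> [|s st].
  have -> : (fun s => \sum_(j <- i :: r) k j * p j s) =
      (fun s => k i * p i s + \sum_(j <- r) k j * p j s).
    by apply/funext => u; rewrite big_cons.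
  by move=> u; apply: cvgD; [exact: ck|exact: ih1].
have /andP[ts sT] := st.
under eq_Rintegral => u _ do rewrite big_cons.
rewrite !big_cons RintegralD//; last 2 first.
- by apply: within_integrable; exact: within_cc_sub ck.
- by apply: within_integrable; exact: within_cc_sub ih1.
rewrite RintegralZl//; last by apply: within_integrable; exact: within_cc_sub c1.
by rewrite ih2// c2//; ring.
Qed.

Lemma within_right_continuous (a b : R) (f : R -> R) : {within `[a, b], continuous f} ->
  forall s, a <= s < b -> forall e : R, 0 < e ->
  exists2 dl : R, 0 < dl & forall u, s < u < s + dl -> u <= b -> `|f u - f s| <= e.
Proof.
move=> cf s /andP[as_ sb] e e0.
have /subspace_continuousP/(_ s)/= := cf.
rewrite in_itv /= as_ ltW// => /(_ isT)/cvgrPdist_le/(_ e e0).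
rewrite near_withinE => /nbhs_ballP[dl /= dl0 H].
exists dl => // u /andP[su us] ub; rewrite distrC; apply: H.
  by rewrite /ball /= ltr_distlC; apply/andP; split; lra.
by rewrite /= in_itv /= ub andbT (le_trans as_)// ltW.
Qed.

Section measurability.
Context d (T' : measurableType d).

Lemma measurable_Rintegral_process (a b : R) (Phi : R -> T' -> R) : a <= b ->
  (forall s, a <= s <= b -> measurable_fun setT (Phi s)) ->
  (forall w, {within `[a, b], continuous (Phi^~ w)}) ->
  measurable_fun setT (fun w => \int[mu]_(s in `[a, b]) Phi s w).
Proof.
move=> ab mPhi cPhi.
have H (Psi : R -> T' -> R) : (forall s, a <= s <= b -> measurable_fun setT (Psi s)) ->
  (forall w, {within `[a, b], continuous (Psi^~ w)}) ->
  measurable_fun setT (fun w => (\int[mu]_(s in `[a, b]) (Num.max (Psi s w) 0)%:E)%E).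
  move=> mPsi cPsi.
  apply: (@measurable_integral_process _ _ _ a b ab (fun s w => Num.max (Psi s w) 0)).
  - by move=> s sab; apply: measurable_maxr => //; exact: mPsi.
  - move=> w; apply: within_right_continuous => u.
    apply: (@cvg_comp _ _ _ (Psi^~ w) (fun x => Num.max x 0) _ (nbhs (Psi u w))); first exact: cPsi.
    exact: (@continuous_max _ _ id (cst 0) (Psi u w) (fun=> id) (cvg_cst _)).
  - by move=> s w _; rewrite le_max lexx orbT.
have -> : (fun w => \int[mu]_(s in `[a, b]) Phi s w) = (fun w => fine
   (\int[mu]_(s in `[a, b]) (Num.max (Phi s w) 0)%:E -
    \int[mu]_(s in `[a, b]) (Num.max (- Phi s w) 0)%:E)%E).
  apply/funext => w; rewrite /Rintegral integralE; congr (fine (_ - _)%E).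
    by apply: eq_integral => s _; rewrite funeposE EFin_max.
  by apply: eq_integral => s _; rewrite funenegE EFin_max.
apply: measurableT_comp => //; apply: emeasurable_funB; apply: H => //.
- by move=> s sab; apply: measurableT_comp => //; exact: mPhi.
- by move=> w u; apply: cvgN; exact: cPhi.
Qed.

(** The explicit formula makes the solution a measurable function of the noise. When [T'] carries a
    sigma-algebra of the noise filtration, this gives adaptedness. *)
Lemma ou_measurable gamma t T z (n p : R -> T' -> R) :
  (forall w, ou_path gamma t T z (n^~ w) (p^~ w)) ->
  (forall w, {within `[t, T], continuous (n^~ w)}) ->
  (forall s, t <= s <= T -> measurable_fun setT (n s)) ->
  forall s, t <= s <= T -> measurable_fun setT (p s).
Proof.
move=> hp cn mn s sT; have /andP[ts sT'] := sT.
have tT : t <= t <= T by rewrite lexx (le_trans ts).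
have -> : p s = (fun w => z - gamma * (expR (- (gamma * s)) *
    \int[mu]_(u in `[t, s]) (expR (gamma * u) * (z + (n u w - n t w)))) + (n s w - n t w)).
  apply/funext => w; exact: (ou_path_explicit (cn w) (hp w) sT).
apply: measurable_funD; last by apply: measurable_funB; exact: mn.
apply: measurable_funB => //; apply: measurable_funM => //; apply: measurable_funM => //.
apply: (@measurable_Rintegral_process t s (fun u w => expR (gamma * u) * (z + (n u w - n t w)))) => //.
- move=> u /andP[tu us]; apply: measurable_funM => //; apply: measurable_funD => //.
  by apply: measurable_funB; apply: mn => //; rewrite tu (le_trans us).
- move=> w u; apply: cvgM.
    apply: continuous_subspaceT => v.
    apply: (cvg_comp (fun u : R => gamma * u) expR); last exact: continuous_expR.
    by apply: cvgMl_tmp; exact: cvg_id.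
  apply: cvgD; first exact: cvg_cst.
  apply: cvgB; last exact: cvg_cst.
  have : {within `[t, s], continuous (n^~ w)} by apply: within_cc_sub (cn w).
  exact.
Qed.

End measurability.

End ornstein_uhlenbeck.

(** * The projected demand and its driving noise *)

Section projected_demand.
Context (R : realType) (disp : measure_display) (Om : measurableType disp)
  (P : probability Om R) (nG nL : nat) (X : demand P nL) (E : projection R nG nL).

Lemma dot_mulmx m n (u : 'cV[R]_m) (A : 'M[R]_(m, n)) (v : 'cV[R]_n) :
  dot u (A *m v) = dot (A^T *m u) v.
Proof. by rewrite /dot trmx_mul trmxK mulmxA. Qed.

Lemma dot_ge0 n (u : 'cV[R]_n) : 0 <= dot u u.
Proof. by rewrite dotE; apply: sumr_ge0 => i _; rewrite -expr2 sqr_ge0. Qed.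

Lemma dot_eq0 n (u : 'cV[R]_n) : dot u u = 0 -> u = 0.
Proof.
rewrite dotE => /eqP; rewrite psumr_eq0 => [/allP h|i _]; last by rewrite -expr2 sqr_ge0.
apply/matrixP => i j; rewrite ord1 mxE.
by have := h i (mem_index_enum _); rewrite -expr2 sqrf_eq0 => /eqP.
Qed.

Lemma eta_vol_neq0 : eta_vol X E != 0.
Proof.
rewrite /eta_vol /enorm sqrtr_eq0 -ltNge lt_neqAle dot_ge0 andbT eq_sym.
apply/eqP => /dot_eq0 h.
have : etaL E = 0.
  have vt : (vol X)^T \in unitmx by rewrite unitmx_tr vol_unit.
  by rewrite -(mul1mx (etaL E)) -(mulVmx vt) -mulmxA h mulmx0.
move=> e; have := etaL_norm E; rewrite e /enorm /dot mulmx0 mxE sqrtr0 => /eqP.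
by rewrite eq_sym oner_eq0.
Qed.

Lemma eta_noise s w : eta_vol X E * Weta X E s w = dot (etaL E) (vol X *m W X s w).
Proof. by rewrite /Weta mulrA divff ?eta_vol_neq0// mul1r. Qed.

Lemma noise_continuous w i (t T : R) : 0 <= t ->
  {within `[t, T], continuous (fun s => (vol X *m W X s w) i 0)}.
Proof.
move=> t0; have [_ Wc _ _] := W_brownian X.
have c : {within `[0, +oo[, continuous (fun s => (vol X *m W X s w) i 0)}.
  have -> : (fun s => (vol X *m W X s w) i 0) = (fun s => \sum_j vol X i j * W X s w j 0).
    by apply/funext => s; rewrite mxE.
  apply: continuous_big => [|j _ s]; first exact: add_continuous.
  by apply: cvgMl_tmp; exact: Wc.
apply: continuous_subspaceW c => s /=; rewrite !in_itv /= andbT => /andP[ts _].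
exact: le_trans ts.
Qed.

Lemma eta_noise_continuous w (t T : R) : 0 <= t ->
  {within `[t, T], continuous (fun s => eta_vol X E * Weta X E s w)}.
Proof.
move=> t0.
have -> : (fun s => eta_vol X E * Weta X E s w) =
    (fun s => \sum_i etaL E i 0 * (vol X *m W X s w) i 0).
  by apply/funext => s; rewrite eta_noise dotE.
apply: continuous_big => [|j _ s]; first exact: add_continuous.
by apply: cvgMl_tmp; exact: noise_continuous.
Qed.

Section with_Zeta.
Context (Zeta : R -> R -> R -> Om -> R) (hZeta : eta_ou X E Zeta).

(** Projecting the vector equation on [etaL] gives the scalar equation with the same noise, and its
    solution is unique. *)
Lemma eta_demandE t x s w : 0 <= t -> t <= s <= horizon X ->
  dot (etaL E) (demand_from X t x s w) =
  eta_demand_from X E Zeta t (dot (etaL E) x) s w.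
Proof.
move=> t0 sT; have /andP[ts sT'] := sT.
have tT : 0 <= t <= horizon X by rewrite t0 (le_trans ts).
rewrite /demand_from /eta_demand_from dotDr; congr (_ + _).
have H1 := hZeta (dot (etaL E) x - dot (etaL E) (mean X t)) w tT.
have H2 := ou_path_sum (index_enum 'I_nL) (fun i => etaL E i 0)
   (fun i => @Zflow_ou _ _ _ _ _ X t (x - mean X t) w i tT).
have {}H2 : ou_path (reversion X) t (horizon X)
    (dot (etaL E) x - dot (etaL E) (mean X t))
    (fun s : R => eta_vol X E * Weta X E s w)
    (fun s => \sum_i etaL E i 0 * Zflow X t (x - mean X t) s w i 0).
  move: H2; congr ou_path; first by rewrite -dotBr dotE.
  by apply/funext => u; rewrite eta_noise dotE.
by rewrite dotE; exact: (ou_path_unique (eta_noise_continuous t0) H2 H1 sT).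
Qed.

Lemma demand_filtration_sub s : 0 <= s <= horizon X ->
  demand_filtration X s `<=` natural_filtration (coords (W X)) s.
Proof.
move=> /andP[s0 sT]; apply: natural_coords_sub => u i /andP[u0 us].
have -> : (fun w => demand_from X 0 (x0 X) u w i 0) =
    (fun w => mean X u i 0 + Zflow X 0 (x0 X - mean X 0) u w i 0).
  by apply/funext => w; rewrite mxE.
apply: measurable_funD => //.
have T0 : 0 <= (0 : R) <= horizon X by apply/andP; split => //; exact: le_trans sT.
(* The equation is restricted to [[0, s]], so that only the noise up to time [s] enters. *)
apply: (@ou_measurable R _ (g_sigma_algebraType (coord_gens (W X) s)) (reversion X) 0 s
   ((x0 X - mean X 0) i 0) (fun v w => (vol X *m W X v w) i 0)
   (fun v w => Zflow X 0 (x0 X - mean X 0) v w i 0)) => //.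
- move=> w; have [c1 c2] := @Zflow_ou _ _ _ _ _ X 0 (x0 X - mean X 0) w i T0.
  split; first exact: within_cc_sub c1.
  by move=> v /andP[v0 vs]; apply: c2; rewrite v0 (le_trans vs).
- by move=> w; exact: noise_continuous.
- move=> v vs; under eq_fun do rewrite mxE.
  by apply: measurable_sum => j; apply: measurable_funM => //; exact: coord_adapted.
- by rewrite u0 us.
Qed.

(** The projected noise pairs [W X] with the vector [(vol X)^T *m etaL E], which is nonzero because
    [vol X] is invertible; the Brownian motion is aligned with that vector. *)
Lemma align_eta : (0 < nL)%N -> exists (i0 : 'I_nL) W' (c : R),
  [/\ brownian P W', forall s, 0 <= s <= horizon X ->
    demand_filtration X s `<=` natural_filtration (coords W') s, c != 0 &
    forall s w, W' s w i0 0 = c * Weta X E s w].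
Proof.
move=> nL0; pose i0 := Ordinal nL0.
have [W' [c [bW' sub dW' c2]]] := brownian_align ((vol X)^T *m etaL E) i0 (W_brownian X).
have c0 : c != 0.
  apply: contra_neq eta_vol_neq0 => c0; rewrite /eta_vol /enorm -c2 c0 expr0n.
  by rewrite sqrtr0.
exists i0, W', (eta_vol X E / c); split=> //.
- by move=> s sT A /(demand_filtration_sub sT)/sub.
- by rewrite mulf_neq0 ?invr_neq0 ?eta_vol_neq0.
- move=> s w; rewrite mulrAC eta_noise dot_mulmx dW' mulrC mulrA mulVf// mul1r.
  by [].
Qed.

End with_Zeta.

Lemma eta_demand_measurable (Zeta : R -> R -> R -> Om -> R) d' (T' : measurableType d')
    (phi : T' -> Om) t y s : eta_ou X E Zeta ->
  (forall u, 0 <= u -> measurable_fun setT (fun w => Weta X E u (phi w))) ->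
  0 <= t -> t <= s <= horizon X ->
  measurable_fun setT (fun w => eta_demand_from X E Zeta t y s (phi w)).
Proof.
move=> hZ mW t0 sT; have /andP[ts sT'] := sT.
have tT : 0 <= t <= horizon X by rewrite t0 (le_trans ts).
apply: measurable_funD => //.
apply: (@ou_measurable R _ T' (reversion X) t (horizon X) (y - dot (etaL E) (mean X t))
  (fun v w => eta_vol X E * Weta X E v (phi w))
  (fun v w => Zeta t (y - dot (etaL E) (mean X t)) v (phi w))) => //.
- by move=> w; exact: hZ.
- by move=> w; exact: eta_noise_continuous.
- by move=> v /andP[tv _]; apply: measurable_funM => //; apply: mW; exact: le_trans tv.
Qed.

Lemma mean_continuous (t : R) : 0 <= t ->
  {within `[t, horizon X], continuous (fun s => dot (etaL E) (mean X s))}.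
Proof.
move=> t0.
have -> : (fun s => dot (etaL E) (mean X s)) = (fun s => \sum_i etaL E i 0 * mean X s i 0).
  by apply/funext => s; rewrite dotE.
apply: continuous_big => [|i _]; first exact: add_continuous.
have [g [gd gm]] := mean_smooth X i.
have cg : continuous g.
  by move=> s; apply/differentiable_continuous/derivable1_diffP; have := gd 0%N s.
move=> s; apply: cvgMl_tmp.
suff : {within `[t, horizon X], continuous (fun s => mean X s i 0)} by exact.
apply/subspace_continuousP => u /=; rewrite in_itv /= => /andP[tu uT].
have gu : mean X u i 0 = g u by apply: gm; rewrite (le_trans t0).
have : g @ within [set` `[t, horizon X]] (nbhs u) --> mean X u i 0.
  by rewrite gu; apply: cvg_within_filter; exact: cg.
apply: cvg_trans; apply: near_eq_cvg; rewrite near_withinE; apply: nearW => v /=.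
rewrite in_itv /= => /andP[tv vT]; apply/esym/gm; rewrite vT andbT.
exact: le_trans tv.
Qed.

Lemma eta_demand_continuous (Zeta : R -> R -> R -> Om -> R) t y w : eta_ou X E Zeta ->
  0 <= t <= horizon X ->
  {within `[t, horizon X], continuous (fun s => eta_demand_from X E Zeta t y s w)}.
Proof.
move=> hZ tT; have [cz _] := hZ t (y - dot (etaL E) (mean X t)) w tT.
have /andP[t0 _] := tT.
by move=> s; apply: cvgD; [exact: (mean_continuous t0)|exact: cz].
Qed.

End projected_demand.

(** * Freezing the independent noises *)

Section independent_diagonal.
Local Open Scope ereal_scope.
Context d (Om : measurableType d) (R : realType) (P : probability Om R).
Context (G1 G2 : set (set Om)).
Context (G1m : G1 `<=` measurable) (G2m : G2 `<=` measurable).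
Context (G12 : indep P (<<s G1 >>) (<<s G2 >>)).
Notation T1 := (g_sigma_algebraType G1).
Notation T2 := (g_sigma_algebraType G2).

Let id1 : Om -> T1 := id.
Let id2 : Om -> T2 := id.

Let mid1 : measurable_fun setT id1.
Proof. by move=> _ A mA; rewrite setTI; exact: sigma_measurable mA. Qed.
Let mid2 : measurable_fun setT id2.
Proof. by move=> _ A mA; rewrite setTI; exact: sigma_measurable mA. Qed.

Let X1 : {mfun Om >-> T1} := HB.pack id1 (isMeasurableFun.Build _ _ _ _ _ mid1).
Let X2 : {mfun Om >-> T2} := HB.pack id2 (isMeasurableFun.Build _ _ _ _ _ mid2).
Let P1 : probability T1 R := distribution P X1.
Let P2 : probability T2 R := distribution P X2.

Let diag : Om -> T1 * T2 := fun w => (w, w).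
Let mdiag : measurable_fun setT diag.
Proof. exact: measurable_fun_pair. Qed.
Let X12 : {mfun Om >-> (T1 * T2)%type} := HB.pack diag (isMeasurableFun.Build _ _ _ _ _ mdiag).

(** Independence says that the pair [(w, w)], each component being seen through its own
    sigma-algebra, is distributed as the product. *)
Lemma integral_diagonal (f : T1 * T2 -> \bar R) : measurable_fun setT f ->
  (forall z, 0 <= f z) ->
  \int[P]_w f (w, w) = \int[P2]_w' \int[P]_w f (w, w').
Proof.
move=> mf f0.
have -> : \int[P]_w f (w, w) = \int[P1 \x P2]_z f z.
  have := @ge0_integral_pushforward _ _ _ _ _ _ mdiag P setT f measurableT mf (fun z _ => f0 z).
  rewrite preimage_setT => <-.
  apply: eq_measure_integral => A mA _.
  apply/esym; apply: (@product_measure_unique _ _ _ _ _ P1 P2 (distribution P X12)) => //.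
rewrite fubini_tonelli1// fubini_tonelli//; apply: eq_integral => w' _.
rewrite /fubini_G.
have mfw : measurable_fun setT (fun w : T1 => f (w, w')).
  by apply: measurableT_comp => //; exact: measurable_fun_pair.
have := @ge0_integral_pushforward _ _ _ _ _ _ mid1 P setT _ measurableT mfw (fun w _ => f0 (w, w')).
by rewrite preimage_setT.
Qed.

(** Otherwise every section would exceed by [e] the average of all sections, which is the finite
    integral over the diagonal. *)
Lemma exists_good_section (f : T1 * T2 -> \bar R) (e : R) : measurable_fun setT f ->
  (forall z, 0 <= f z) -> (0 < e)%R -> \int[P]_w f (w, w) < +oo ->
  exists w', \int[P]_w f (w, w') <= \int[P]_w f (w, w) + e%:E.
Proof.
move=> mf f0 e0 fy; apply: contrapT => H.
set I := \int[P]_w f (w, w) in fy H *.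
have I0 : 0 <= I by apply: integral_ge0.
have If : I \is a fin_num by rewrite ge0_fin_numE.
have : \int[P2]_w' (I + e%:E) <= I.
  rewrite [leRHS](integral_diagonal mf f0); apply: le_integral_pointwise => w' _.
  rewrite leNgt; apply/negP => h; apply: H; exists w'; exact: ltW.
have -> : \int[P2]_w' (I + e%:E) = I + e%:E.
  rewrite integral_cst//; transitivity ((I + e%:E) * 1); last by rewrite mule1.
  by congr (_ * _); exact: (@probability_setT _ _ _ P2).
rewrite leNgt => /negP; apply.
by rewrite -(fineK If) -EFinD lte_fin ltrDl.
Qed.

End independent_diagonal.

(** * Sigma-algebras and causal choices among countably many values *)

Section sigma_algebra_predicates.
Context (Z : Type) (S : set (set Z)) (hS : sigma_algebra setT S).

Lemma sigma_setC A : S A -> S (~` A).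
Proof. by case: hS => _ SC _ SA; have := SC _ SA; rewrite setTD. Qed.

Lemma sigma_setT : S setT.
Proof. by rewrite -setC0; apply: sigma_setC; case: hS. Qed.

Lemma sigma_bigcup_count (D : countType) (A : D -> set Z) :
  (forall l, S (A l)) -> S (\bigcup_l A l).
Proof.
move=> SA; case: hS => S0 _ SU.
have -> : \bigcup_l A l = \bigcup_n (if unpickle n is Some l then A l else set0).
  apply/seteqP; split=> z [].
    by move=> l _ Alz; exists (pickle l) => //; rewrite pickleK.
  by move=> n _; case: unpickle => // l Alz; exists l.
by apply: SU => n; case: unpickle.
Qed.

Lemma sigma_bigcap_count (D : countType) (A : D -> set Z) :
  (forall l, S (A l)) -> S (\bigcap_l A l).
Proof.
move=> SA; rewrite -[X in S X]setCK setC_bigcap; apply: sigma_setC.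
by apply: sigma_bigcup_count => l; exact: sigma_setC.
Qed.

Lemma sigma_setU A B : S A -> S B -> S (A `|` B).
Proof.
move=> SA SB; have -> : A `|` B = \bigcup_(b : bool) (if b then A else B).
  apply/seteqP; split=> z.
    by case=> h; [exists true|exists false].
  by move=> [[] _ h]; [left|right].
by apply: sigma_bigcup_count => -[].
Qed.

Lemma sigma_setI A B : S A -> S B -> S (A `&` B).
Proof.
by move=> SA SB; rewrite -[X in S X]setCK setCI; apply/sigma_setC/sigma_setU; exact: sigma_setC.
Qed.

Lemma sigma_const (Q : Prop) : S [set _ | Q].
Proof.
have [q|nq] := pselect Q.
  by rewrite (_ : [set _ | Q] = setT); [exact: sigma_setT|apply/seteqP; split].
by rewrite (_ : [set _ | Q] = set0); [by case: hS|apply/seteqP; split].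
Qed.

Lemma sigma_of_levels (D : countType) (H : Z -> D) :
  (forall l, S [set z | H z = l]) -> forall Q : D -> Prop, S [set z | Q (H z)].
Proof.
move=> HS Q.
have -> : [set z | Q (H z)] = \bigcup_l ([set z | H z = l] `&` [set _ | Q l]).
  by apply/seteqP; split=> z /=; [move=> h; exists (H z)|move=> [l _ [/= ->]]].
by apply: sigma_bigcup_count => l; apply: sigma_setI => //; exact: sigma_const.
Qed.

End sigma_algebra_predicates.

Section causal_selection.
Context (Z : Type) (D : countType) (S : nat -> set (set Z)).
Context (hS : forall i, sigma_algebra setT (S i)).
Context (Smono : forall i, S i `<=` S i.+1).
Context (B : nat -> D -> set Z) (Ok : nat -> D -> D -> Prop) (d0 : D).

(* Follow the announced value [l] when it is the only one announced and it is *)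
(* acceptable after the previous value; otherwise keep the previous value.    *)
Definition announced i (prev : D) (z : Z) : set D :=
  [set l | [/\ B i l z, forall l', l' != l -> ~ B i l' z & Ok i prev l]].

Fixpoint select (i : nat) (z : Z) : D :=
  if i is i'.+1 then xget (select i' z) (announced i' (select i' z) z) else d0.

Lemma announced_unique i prev z l l' :
  announced i prev z l -> announced i prev z l' -> l = l'.
Proof.
move=> [Bl ul _] [Bl' ul' _]; apply/eqP/negPn/negP => ll.
by apply: (ul l') => //; rewrite eq_sym.
Qed.

Lemma select_step i z :
  select i.+1 z = select i z \/ Ok i (select i z) (select i.+1 z).
Proof.
rewrite /=; case: xgetP => [l _ [_ _ ok]|]; [by right|by left].
Qed.

(** The value after date [i] is decided by the announcements of dates up to [i], all in [S i] by
    monotonicity; [D] being countable, the unions and intersections are countable. *)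
Lemma select_levels (M : nat) : (forall i l, (i < M)%N -> S i (B i l)) ->
  forall i l, (i < M)%N -> S i [set z | select i.+1 z = l].
Proof.
move=> SB.
have step i : (i < M)%N -> (forall l, S i [set z | select i z = l]) ->
    forall l, S i [set z | select i.+1 z = l].
  move=> iM Si l.
  pose U p q := [set z | announced i p z q].
  have SU p q : S i (U p q).
    have -> : U p q = (B i q `&` \bigcap_l' (~` (B i l' `&` [set _ | l' != q]))) `&`
        [set _ | Ok i p q].
      apply/seteqP; split=> z /=.
        move=> [h1 h2 h3]; split=> //; split=> // l' _ [/= h4 h5]; exact: (h2 l').
      move=> [[h1 h2] h3]; split=> // l' h4 h5; exact: (h2 l').
    apply: sigma_setI => //; last exact: sigma_const.
    apply: sigma_setI => //; first exact: SB.
    apply: sigma_bigcap_count => // l'; apply: sigma_setC => //.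
    by apply: sigma_setI => //; [exact: SB|exact: sigma_const].
  have -> : [set z | select i.+1 z = l] = \bigcup_p ([set z | select i z = p] `&`
     (U p l `|` ([set _ | p = l] `&` \bigcap_q ~` U p q))).
    apply/seteqP; split=> z /=.
      move=> h; exists (select i z) => //; split=> //.
      move: h; case: xgetP => [l' -> a <-|na <-]; first by left.
      by right; split=> // q _ /na.
    move=> [p _ [/= <-{p}] [a|[/= <- na]]].
      by case: xgetP => [l' -> a'|na]; [exact: announced_unique a' a|have := na _ a].
    by case: xgetP => // l' _ a'; have := na l' I.
  apply: sigma_bigcup_count => // p; apply: sigma_setI => //.
  apply: sigma_setU => //; apply: sigma_setI => //; first exact: sigma_const.
  by apply: sigma_bigcap_count => // q; exact: sigma_setC.
elim=> [|i ih] l iM; apply: step => //.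
  by move=> l'; exact: (sigma_const (hS 0%N) (d0 = l')).
by move=> l'; apply: (@Smono i); apply: ih; exact: ltnW.
Qed.

Lemma select_follow i z l : (forall l', B i l' z <-> l' = l) ->
  Ok i (select i z) l -> select i.+1 z = l.
Proof.
move=> Bl ok.
have a : announced i (select i z) z l.
  split=> //; first exact/Bl.
  by move=> l' /eqP ll /Bl.
rewrite /=; case: xgetP => [l' _ a'|na]; first exact: announced_unique a' a.
by have := na _ a.
Qed.

End causal_selection.

(** On a sorted list a downward closed [Q] keeps an initial segment, so positions do not shift. *)
Lemma onth_filter_prefix (D : Type) (r : rel D) (Q : pred D) (s : seq D) j :
  transitive r -> (forall p q, r p q -> Q q -> Q p) -> sorted r s ->
  onth [seq p <- s | Q p] j =
  if onth s j is Some p then (if Q p then Some p else None) else None.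
Proof.
move=> rtr rQ; elim: s j => [|p s ih] j /=; first by case: j.
move=> ps.
have ss := path_sorted ps.
case: ifPn => Qp; first by case: j => [|j] /=; [rewrite Qp|exact: ih].
have nQ : all (predC Q) s.
  have := order_path_min rtr ps; apply: sub_all => q rpq /=.
  by apply/negP => /(rQ _ _ rpq); rewrite (negbTE Qp).
have -> : [seq q <- s | Q q] = [::].
  by elim: (s) nQ => [//|q s' ih'] /= /andP[/negbTE -> /ih'].
have H : forall j', if onth s j' is Some q then (if Q q then Some q else None) = None else True.
  elim: (s) nQ => [_ [|]//|q s' ih'] /= /andP[/negbTE nq /ih' {}ih'] [|j'] /=; last exact: ih'.
  by rewrite nq.
case: j => [|j] /=; first by rewrite (negbTE Qp).
by have := H j; case: onth.
Qed.

Lemma onth_map (D D' : Type) (f : D -> D') (s : seq D) j :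
  onth [seq f p | p <- s] j = omap f (onth s j).
Proof. by elim: s j => [|p s ih] [|j] /=. Qed.

Lemma onth_mem (D : eqType) (s : seq D) j p : onth s j = Some p -> p \in s.
Proof.
elim: s j => [|q s ih] [|j] //= => [[->]|/ih ps]; first by rewrite mem_head.
by rewrite inE ps orbT.
Qed.

(** * Controls on a time grid *)

Section discretization.
Context (R : realType) (nG : nat) (F : fleet R nG).
Context (t T : R) (a : mode F) (r : 'cV[R]_nG) (hr : progset a r).
Context (h kap : R) (h0 : 0 < h) (kap0 : 0 < kap).
Context (h_delay : forall k (b : switch F k), h <= kap * delay k (val b)).
Implicit Types (v : strategy F) (l : seq (nat * request F)).

Definition grid (n : nat) : R := t + h * n%:R.

(** From [t] on, this is the dilated elapsed time in units of [h], rounded up; [Num.max 0] matters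
    only before [t]. *)
Definition index (tau : R) : nat :=
  `|Num.ceil (Num.max 0 ((1 + kap) * (tau - t) / h))%R|%N.

Definition decode l : strategy F := [seq (grid p.1, p.2) | p <- l].

(* Rounding up makes a request known at its grid point; the dilation makes up  *)
(* for the rounding, so that successive requests of a generator stay a full    *)
(* delay apart.                                                                *)
Definition encode (i : nat) v : seq (nat * request F) :=
  [seq p <- [seq (index p.1, p.2) | p <- v] | (p.1 <= i)%N].

Lemma grid_le m n : (grid m <= grid n) = (m <= n)%N.
Proof. by rewrite /grid lerD2l ler_pM2l// ler_nat. Qed.

Lemma grid_ge n : t <= grid n.
Proof. by rewrite lerDl mulr_ge0// ltW. Qed.

(** The time on the right does not exceed [grid n], so whether a request has index at most [n] is
    known at that grid point. *)
Lemma index_le tau n : t <= tau -> (index tau <= n)%N = (tau <= t + h * n%:R / (1 + kap)).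
Proof.
move=> tt; have k1 : 0 < 1 + kap by rewrite addr_gt0.
have x0 : 0 <= (1 + kap) * (tau - t) / h.
  by rewrite divr_ge0 ?mulr_ge0 ?subr_ge0// ltW.
rewrite /index (max_r x0).
have c0 : 0 <= Num.ceil ((1 + kap) * (tau - t) / h).
  by rewrite -(ler_int R) (le_trans x0)// ceil_ge.
rewrite -lez_nat gez0_abs// ceil_le_int -pmulrn.
by rewrite ler_pdivrMr// mulrC -ler_pdivlMr// lerBlDl [in RHS](mulrC h).
Qed.

Lemma index_mono tau tau' : t <= tau -> tau <= tau' -> (index tau <= index tau')%N.
Proof.
move=> tt tt'; rewrite index_le//; apply: (le_trans tt').
by rewrite -index_le// (le_trans tt).
Qed.

Lemma grid_index tau : t <= tau ->
  t + (1 + kap) * (tau - t) <= grid (index tau) < t + (1 + kap) * (tau - t) + h.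
Proof.
move=> tt; have k1 : 0 < 1 + kap by rewrite addr_gt0.
have H1 : tau <= t + h * (index tau)%:R / (1 + kap) by rewrite -index_le.
rewrite -lerBlDl ler_pdivlMr// mulrC in H1.
rewrite /grid; apply/andP; split; first by rewrite lerD2l.
rewrite -addrA ltrD2l.
case E : (index tau) => [|n].
  rewrite mulr0; apply: ltr_wpDl => //.
  by rewrite mulr_ge0 ?subr_ge0// ltW.
have : ~~ (index tau <= n)%N by rewrite E ltnn.
rewrite index_le// -ltNge => H2.
rewrite -ltrBrDl ltr_pdivrMr// in H2.
by rewrite -natr1; lra.
Qed.

Lemma decode_encode i v : decode (encode i v) =
  [seq p <- [seq (grid (index p.1), p.2) | p <- v] | p.1 <= grid i].
Proof.
rewrite /decode /encode; elim: v => [//|p v ih] /=.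
by rewrite grid_le; case: ifP => _ /=; rewrite ih.
Qed.

Lemma served_encode i v : served t T a r v -> grid i <= T -> served t T a r (decode (encode i v)).
Proof.
move=> [sv vT vc] iT; rewrite decode_encode; split.
- apply: (@subseq_sorted _ <=%R le_trans _ (map fst [seq (grid (index p.1), p.2) | p <- v])).
    by apply: map_subseq; exact: filter_subseq.
  have vt : all (fun x => t <= x) (map fst v).
    by apply/allP => x /mapP[p pv ->]; have /andP[] := vT p pv.
  have -> : map fst [seq (grid (index p.1), p.2) | p <- v] = map (grid \o index) (map fst v).
    by rewrite -!map_comp.
  apply: (@homo_sorted_in _ _ (fun x => t <= x) (grid \o index) <=%R <=%R) => //.
  by move=> x y xt yt xy /=; rewrite grid_le index_mono.
- move=> p; rewrite mem_filter => /andP[pi /mapP[q qv e]]; rewrite e /= in pi *.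
  by rewrite grid_ge (le_trans pi).
- move=> k; rewrite (requests_of_filter (fun x => x <= grid i)).
  rewrite (requests_of_map (fun k x b => grid (index x))).
  apply: (@chain_filter _ _ _ _ _ _ _ _ (fun x => x <= grid i)); last first.
    by move=> x y xy; exact: le_trans.
  have vt : {in requests_of k v, forall p, t <= p.1}.
    by move=> [x b]; rewrite mem_requests_of => /vT /andP[].
  apply: (@chain_map _ _ _ _ _ _ _ _ (fun x => grid (index x))) => //.
    move=> x tx; have /andP[g1 _] := grid_index tx; apply: le_trans g1.
    by have : 0 <= kap * (x - t); [rewrite mulr_ge0 ?subr_ge0// ltW|lra].
  move=> p y tp py; have ty : t <= y.
    by rewrite (le_trans tp)// ltW// (lt_trans (endtime_gt p)).
  have /andP[_ g1] := grid_index tp; have /andP[g2 _] := grid_index ty.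
  rewrite /endtime /= in py *.
  have hd := h_delay p.2.
  (* The dilation lengthens the delay by [kap] times itself, hence by at least [h], while rounding
     postpones the first request by less than [h]. *)
  have : (1 + kap) * (p.1 + delay k (val p.2) - t) < (1 + kap) * (y - t).
    by have kp := kap0; rewrite ltr_pM2l; lra.
  have kp := kap0; have hp := h0; have dp := delay_gt0 _ _ _ _ _ (valP p.2).
  by move: g1 g2; rewrite !mulrDl !mul1r !mulrDr; lra.
Qed.

(** At date [i] only requests of index [i] may be added, and what was done before is left
    untouched. *)
Definition acceptable (i : nat) (l l' : seq (nat * request F)) : Prop :=
  [/\ {in l', forall p, (p.1 <= i)%N}, [seq p <- l' | (p.1 < i)%N] = l &
      served t T a r (decode l')].

Definition encode_before (i : nat) v := if i is i'.+1 then encode i' v else [::].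

Lemma encode_acceptable i v : served t T a r v -> grid i <= T ->
  acceptable i (encode_before i v) (encode i v).
Proof.
move=> sv iT; split.
- by move=> p; rewrite mem_filter => /andP[].
- case: i iT => [|i] iT; rewrite /encode_before /encode.
    by rewrite (eq_filter (a2 := pred0)) ?filter_pred0.
  rewrite -filter_predI; apply: eq_filter => p /=; rewrite ltnS.
  by case: (leqP p.1 i) => // pi; rewrite (leq_trans pi).
- exact: served_encode.
Qed.

(** A list is determined by its entries, and an entry of index at most [i] comes from a request made
    at a date not exceeding [grid i]. *)
Lemma encode_level d (Om : measurableType d) (Fil : R -> set (set Om)) (v : Om -> strategy F) i l :
  (forall s, sigma_algebra setT (Fil s)) -> (forall s s', s <= s' -> Fil s `<=` Fil s') ->
  (forall w, sorted <=%R (map fst (v w)) /\ {in v w, forall p, t <= p.1 <= T}) ->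
  (forall j, request_adapted Fil `[0, T] id v j) -> 0 <= t -> grid i <= T ->
  Fil (grid i) [set w | encode i (v w) = l].
Proof.
move=> hF mF vs va t0 iT; have k1 : 0 < 1 + kap by rewrite addr_gt0.
pose sn n := t + h * n%:R / (1 + kap).
have snt n : t <= sn n by rewrite lerDl divr_ge0 ?mulr_ge0// ltW.
have sng n : sn n <= grid n.
  rewrite /sn /grid lerD2l ler_pdivrMr// ler_peMr ?mulr_ge0// ?ltW//.
  by have kp := kap0; lra.
pose A j n b := [set w | exists2 x, onth (v w) j = Some (x, b) & x <= sn n].
have FA j n b : (n <= i)%N -> Fil (grid i) (A j n b).
  move=> ni; have gni : grid n <= grid i by rewrite grid_le.
  apply: (mF _ _ (le_trans (sng n) gni)); apply: va.
  by rewrite /= in_itv /= (le_trans t0)//= (le_trans (sng n))// (le_trans gni).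
have mem w j x b : onth (v w) j = Some (x, b) -> t <= x.
  by move=> /onth_mem e; have [_ vT] := vs w; have /andP[] := vT (x, b) e.
have onthE w j : onth (encode i (v w)) j =
    if onth (v w) j is Some p then (if (index p.1 <= i)%N then Some (index p.1, p.2) else None)
    else None.
  have [vsw vT] := vs w.
  have srt : sorted (fun p q : nat * request F => (p.1 <= q.1)%N) [seq (index p.1, p.2) | p <- v w].
    have : sorted <=%R (map fst (v w)) by [].
    have vt : all (fun p : R * request F => t <= p.1) (v w) by apply/allP => p /vT /andP[].
    rewrite !sorted_map.
    apply: (sub_in_sorted (P := fun p : R * request F => t <= p.1)) => //.
    by move=> p q tp tq /= pq; exact: index_mono.
  rewrite /encode (onth_filter_prefix (r := fun p q : nat * request F => (p.1 <= q.1)%N) _ _ _ srt).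
  - by rewrite onth_map; case: onth => //=.
  - by move=> p q x; exact: leq_trans.
  - by move=> p q pq; exact: leq_trans.
have FSome j n b : Fil (grid i) [set w | onth (encode i (v w)) j = Some (n, b)].
  have [ni|ni] := leqP n i; last first.
    rewrite (_ : [set w | _] = set0); first by case: (hF (grid i)).
    apply/seteqP; split=> // w /=; rewrite onthE; case: onth => // p.
    by case: ifP => // pi [pn _]; move: ni; rewrite -pn ltnNge pi.
  (* Index exactly [n] means that the request has been made by the date [sn n] but not by the
     preceding one; index 0 has no preceding date. *)
  have -> : [set w | onth (encode i (v w)) j = Some (n, b)] =
      A j n b `&` (if n is n'.+1 then ~` A j n' b else setT).
    apply/seteqP; split=> w /=; rewrite onthE.
      case E : onth => [[x b']|//]; case: ifP => //= xi [xn bb]; rewrite -bb in E *.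
      have tx := mem _ _ _ _ E.
      split; first by exists x => //; rewrite -index_le// xn.
      case: (n) xn => [//|n'] xn [x']; rewrite E => -[<-].
      by rewrite -index_le// xn ltnn.
    move=> [[x E xn] H]; rewrite E /=; have tx := mem _ _ _ _ E.
    rewrite -index_le// in xn; rewrite (leq_trans xn ni); congr (Some (_, _)).
    apply/eqP; rewrite eqn_leq xn /=; case: (n) H => [//|n'] H.
    by rewrite ltnNge; apply/negP; rewrite index_le// => ?; apply: H; exists x.
  apply: sigma_setI => //; first exact: FA.
  case: (n) ni => [|n'] ni; first exact: sigma_setT.
  by apply: sigma_setC => //; apply: FA; exact: ltnW.
have Flev j (o : option (nat * request F)) : Fil (grid i) [set w | onth (encode i (v w)) j = o].
  case: o => [[n b]|]; first exact: FSome.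
  have -> : [set w | onth (encode i (v w)) j = None] =
      ~` (\bigcup_(q : nat * request F) [set w | onth (encode i (v w)) j = Some (q.1, q.2)]).
    apply/seteqP; split=> w /=; first by move=> e [q _ /=]; rewrite e.
    by case E : onth => [[n b]|//] H; exfalso; apply: H; exists (n, b).
  by apply: sigma_setC => //; apply: sigma_bigcup_count => // -[n b]; exact: FSome.
have -> : [set w | encode i (v w) = l] =
    \bigcap_(j : nat) [set w | onth (encode i (v w)) j = onth l j].
  apply/seteqP; split=> w /=; first by move=> e j _ /=; rewrite e.
  move=> H; have {}H j : onth (encode i (v w)) j = onth l j by exact: H.
  elim: (encode i (v w)) l H => [|p s ih] [|q l'] H //.
  - by have := H 0%N.
  - by have := H 0%N.
  - by have [->] := H 0%N; congr cons; apply: ih => j; exact: (H j.+1).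
by apply: sigma_bigcap_count => // j; exact: Flev.
Qed.

End discretization.

(** * Admissibility of the relaxed control built on the grid *)

Section relaxed_control.
Context (R : realType) (nG : nat) (F : fleet R nG).
Context (t T : R) (a : mode F) (r : 'cV[R]_nG) (hr : progset a r).
Context (h : R) (h0 : 0 < h).
Local Notation grid := (grid t h).
Local Notation decode := (decode t h).
Context d (Om : measurableType d) (Fil : R -> set (set Om)).
Context (hF : forall s, sigma_algebra setT (Fil s)).
Context (mF : forall s s', s <= s' -> Fil s `<=` Fil s').
Context (L : Om -> seq (nat * request F)).
Context (Lserved : forall w, served t T a r (decode (L w))).
Context (Lprefix : forall i (Q : seq (nat * request F) -> Prop),
  Fil (grid i) [set w | Q [seq p <- L w | (p.1 <= i)%N]]).

(** A grid request made by [s] already belongs to the prefix at the last grid point not after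
    [s]. *)
Lemma prefix_event j s (Rel : nat * request F -> Prop) :
  (forall p, Rel p -> grid p.1 <= s) ->
  Fil s [set w | exists2 p, onth (L w) j = Some p & Rel p].
Proof.
move=> Rs; have [st|ts] := ltP s t.
  rewrite (_ : [set w | _] = set0); first by case: (hF s).
  apply/seteqP; split=> // w [p _ /Rs ps].
  by have := le_lt_trans ps st; rewrite ltNge grid_ge.
pose i := Num.truncn ((s - t) / h).
have x0 : 0 <= (s - t) / h by rewrite divr_ge0 ?subr_ge0// ltW.
have gridi n : (grid n <= s) = (n <= i)%N.
  by rewrite /i truncn_ge_nat// ler_pdivlMr// lerBrDl mulrC.
have is_ : grid i <= s by rewrite gridi.
apply: (mF is_).
have -> : [set w | exists2 p, onth (L w) j = Some p & Rel p] =
  [set w | (fun l => exists2 p, onth l j = Some p & Rel p) [seq p <- L w | (p.1 <= i)%N]].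
  apply/seteqP; split=> w /=; rewrite (onth_filter_prefix (r := fun p q : nat * request F => (p.1 <= q.1)%N)).
  - by move=> [p -> Rp]; exists p => //; rewrite -gridi Rs.
  - by move=> p q x; exact: leq_trans.
  - by move=> p q pq; exact: leq_trans.
  - have [] := Lserved w; rewrite /decode -map_comp sorted_map => srt _ _.
    by apply: sub_sorted srt => p q /=; rewrite grid_le.
  - by case: onth => [p|] [q] //; case: ifP => // _ [->] Rq; exists q.
  - by move=> p q x; exact: leq_trans.
  - by move=> p q pq; exact: leq_trans.
  - have [] := Lserved w; rewrite /decode -map_comp sorted_map => srt _ _.
    by apply: sub_sorted srt => p q /=; rewrite grid_le.
exact: (Lprefix i (fun l => exists2 p, onth l j = Some p & Rel p)).
Qed.

(** An execution time is a request time plus a delay that is known when the request is made, hence a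
    stopping time; the execution times of the initial transitions are deterministic. *)
Lemma relax_radmissible :
  radmissible Fil t T a (total_prog r) (fun w => relax t a r (decode (L w))).
Proof.
have relE w : (relax t a r (decode (L w))).1 =
    [seq ((grid p.1, (grid p.1 + req_delay p.2)%:E), p.2) | p <- L w].
  by rewrite /relax /decode /= -map_comp.
have dpos (b : request F) : 0 < req_delay b by apply: delay_gt0; exact: valP.
have stop (time : R * \bar R -> \bar R) j :
    (forall (p : nat * request F) s,
      (time (grid p.1, (grid p.1 + req_delay p.2)%:E) <= s%:E)%E -> grid p.1 <= s) ->
    stopping_time Fil `[0, +oo[ (nth_time time (fun w => (relax t a r (decode (L w))).1) j).
  move=> tg s _.
  have := @prefix_event j s (fun p => (time (grid p.1, (grid p.1 + req_delay p.2)%:E) <= s%:E)%E).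
  move=> /(_ (fun p => tg p s)); congr (Fil s _); apply/seteqP.
  rewrite /nth_time; split=> w; rewrite /mkset relE onth_map.
    by move=> [p -> ps].
  by case: onth => [p|] //= ps; exists p.
split.
- move=> w; have [srt wT _] := Lserved w; rewrite relE; split.
    by move: srt; rewrite /decode -!map_comp.
  move=> p /mapP[q qL ->] /=; apply: (wT (grid q.1, q.2)).
  by apply/mapP; exists q.
- move=> j; split; first by apply: stop => p s; rewrite lee_fin.
  move=> s b _; have := @prefix_event j s (fun p => p.2 = b /\ grid p.1 <= s).
  move=> /(_ (fun p => @proj2 _ _)); congr (Fil s _); apply/seteqP.
  split=> w; rewrite /mkset relE onth_map.
    move=> [p -> [<- ps]] /=.
    by exists (grid p.1, (grid p.1 + req_delay p.2)%:E).
  case: onth => [p|] [x] //= [<- <-] ps.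
  by exists p.
- move=> w p; rewrite relE => /mapP[q qL ->] /=.
  have := allowed_of_served hr (Lserved w) (_ : (grid q.1, q.2) \in decode (L w)).
  have H : (grid q.1, q.2) \in decode (L w) by apply/mapP; exists q.
  move=> /(_ H) [a' na' al]; exists a' => //.
  by apply: filterS na' => u; rewrite relax_mode_at.
- move=> w k; rewrite requests_of_relax -map_comp.
  by have := served_sorted k (Lserved w).
split.
- move=> j; apply: stop => p s; rewrite /= lee_fin => ps; apply: le_trans ps.
  by rewrite lerDl ltW.
- by move=> w p; rewrite relE => /mapP[q qL ->] /=; rewrite lee_fin lerDl ltW.
- move=> k ak; split.
    move=> s _; have := sigma_const (hF s) (((relax t a r (decode [::])).2 k <= s%:E)%E).
    by congr (Fil s _).
  move=> w; rewrite /relax /=; have := progset_lt hr k; case: (a k) => // b rb.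
  by rewrite lee_fin; lra.
- move=> w s /andP[ts sT]; rewrite (relax_prog_at hr (Lserved w) ts) relax_mode_at.
  exact/total_prog_bounds/state_progset.
Qed.

End relaxed_control.

(** * Right continuity of modes and progressions *)

Section right_continuity.
Context (R : realType) (nG : nat) (F : fleet R nG).
Context (t : R) (a : mode F) (r : 'cV[R]_nG).

Lemma near_right_le (x s : R) : \forall u \near s^'+, (x <= u) = (x <= s).
Proof.
case: (leP x s) => [xs|sx].
  by near=> u; apply/idP; rewrite (le_trans xs)//; apply: ltW; near: u; exact: nbhs_right_gt.
near=> u; apply/negbTE; rewrite -ltNge; near: u; exact: nbhs_right_lt.
Unshelve. all: by end_near. Qed.

Lemma gstate_right k (g : gmode F k) rho l s : t <= s ->
  \forall u \near s^'+, (gstate t g rho l u).1 = (gstate t g rho l s).1 /\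
    `|(gstate t g rho l u).2 - (gstate t g rho l s).2| <= u - s.
Proof.
move=> ts.
have H1 : \forall u \near s^'+, {in l, forall p, (p.1 <= u) = (p.1 <= s)}.
  by apply: near_seq => p _; exact: near_right_le.
have H2 : \forall u \near s^'+, {in l, forall p, (u < endtime p) = (s < endtime p)}.
  apply: near_seq => p _; apply: filterS (near_right_le (endtime p) s) => u e.
  by rewrite !ltNge e.
have H3 : \forall u \near s^'+, s < u by exact: nbhs_right_gt.
have H4 : \forall u \near s^'+, if g is inr b then
    (u - t + rho < delay k (val b)) = (s - t + rho < delay k (val b)) else True.
  case: g => [?|b]; first exact: nearW.
  apply: filterS (near_right_le (delay k (val b) + t - rho) s) => u e.
  have E x : (x - t + rho < delay k (val b)) = ~~ (delay k (val b) + t - rho <= x).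
    by rewrite -ltNge; apply/idP/idP; lra.
  by rewrite !E e.
apply: filterS (filterI (filterI H1 H2) (filterI H3 H4)) => u [[h1 h2] [h3 h4]].
rewrite /gstate (le_gtF ts) (le_gtF (le_trans ts (ltW h3))).
rewrite (@last_such_pred _ _ (fun p => p.1 <= s)); last exact: h1.
have us0 : 0 <= u - s by rewrite subr_ge0 ltW.
case E : last_such => [p|].
  have [pl _] := last_such_mem E; rewrite /stage h2//; case: ifP => _ /=.
    by split=> //; rewrite ler_norml; lra.
  by rewrite subrr normr0.
case: g h4 {H4} => [lv _|b ->] /=; first by rewrite subrr normr0.
case: ifP => _ /=; last by rewrite subrr normr0.
by split=> //; rewrite ler_norml; lra.
Qed.

Lemma state_right v s : t <= s ->
  \forall u \near s^'+, mode_at t a r v u = mode_at t a r v s /\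
    forall k, `|prog_at t a r v u k 0 - prog_at t a r v s k 0| <= u - s.
Proof.
move=> ts.
have H : \forall u \near s^'+, {in enum 'I_nG, forall k,
   (gstate t (a k) (r k 0) (requests_of k v) u).1 = (gstate t (a k) (r k 0) (requests_of k v) s).1 /\
    `|(gstate t (a k) (r k 0) (requests_of k v) u).2 - (gstate t (a k) (r k 0) (requests_of k v) s).2| <= u - s}.
  by apply: near_seq => k _; exact: gstate_right.
apply: filterS H => u H; split.
  apply: functional_extensionality_dep => k; rewrite /mode_at !gen_stateE.
  by have [] := H k (mem_enum _ _).
move=> k; rewrite /prog_at !mxE !gen_stateE.
by have [] := H k (mem_enum _ _).
Qed.

End right_continuity.

Lemma delay_lower_bound (R : realType) (nG : nat) (F : fleet R nG) :
  exists2 d : R, 0 < d & forall k (b : switch F k), d <= delay k (val b).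
Proof.
suff [d d0 H] : exists2 d : R, 0 < d & {in enum {: request F}, forall b, d <= req_delay b}.
  by exists d => // k b; apply: (H (Tagged (switch F) b)); rewrite mem_enum.
elim: (enum _) => [|b s [d d0 ih]]; first by exists 1.
exists (Num.min d (req_delay b)).
  by rewrite lt_min d0 delay_gt0//; exact: valP.
move=> b'; rewrite inE ge_min => /predU1P[->|/ih ->//].
by rewrite lexx orbT.
Qed.

(** * The price of moving requests to the grid *)

Section rounding_cost.
Context (R : realType) (nG : nat) (F : fleet R nG) (nL nc : nat).
Context (N : network F nL nc) (C : costs F nc) (E : projection R nG nL).
Context (t T : R) (tT : t <= T) (a : mode F) (r : 'cV[R]_nG) (hr : progset a r).
Notation mu := (@lebesgue_measure R).
Implicit Types (v : strategy F).

(** At each generator every request but the last uses up at least [d0] of the horizon; the summand 1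
    is for the last. *)
Lemma served_size (d0 : R) v : 0 < d0 -> (forall k (b : switch F k), d0 <= delay k (val b)) ->
  served t T a r v -> (size v)%:R <= nG%:R * (1 + (T - t) / d0).
Proof.
move=> d00 hd [_ vT vc].
have Hk k : (size (requests_of k v))%:R <= 1 + (T - t) / d0.
  have vt : {in requests_of k v, forall p, t <= p.1 <= T}.
    by move=> [x b]; rewrite mem_requests_of => /vT.
  have := vc k; move: vt; elim/last_ind: (requests_of k v) => [|l q _] vt.
    by rewrite addr_ge0// divr_ge0 ?subr_ge0// ltW.
  have tl : {in rcons l q, forall p, t <= p.1} by move=> p /vt /andP[].
  have /vt/andP[_ qT] : q \in rcons l q by rewrite mem_rcons mem_head.
  move=> /(chain_size (hd k) tl) H.
  rewrite size_rcons -natr1 addrC lerD2l ler_pdivlMr//.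
  by apply: (le_trans H); rewrite lerD2r.
rewrite size_requests_of natr_sum.
apply: (le_trans (ler_sum _ (fun k _ => Hk k))).
by rewrite sumr_const card_ord -[leLHS]mulr_natl.
Qed.

Section rounded.
Context (h kap : R) (h0 : 0 < h) (kap0 : 0 < kap).
Context (M : nat) (hM : grid t h M <= T < grid t h M.+1).
(** A bound on the postponement due to dilation and rounding together. *)
Let e := kap * (T - t) + h.

Lemma rounded_gstate v s k : served t T a r v -> t <= s <= T ->
  {in v, forall p, ~~ (p.1 <= s < p.1 + e) &&
                   ~~ (p.1 + req_delay p.2 <= s < p.1 + req_delay p.2 + e)} ->
  let v' := decode t h (encode t h kap M v) in
  mode_at t a r v' s k = mode_at t a r v s k /\
  `|prog_at t a r v' s k 0 - prog_at t a r v s k 0| <= e.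
Proof.
move=> [_ vT _] /andP[ts sT] vs /=.
have e0 : 0 <= e by rewrite addr_ge0 ?mulr_ge0 ?subr_ge0// ltW.
rewrite /mode_at /prog_at !mxE !gen_stateE decode_encode//.
(* No grid point lies between [grid t h M] and [T] (the former excluded), so cutting at one is
   cutting at the other; the requests cut off would come after [T] and do not affect the state at
   [s]. *)
have -> : [seq p <- [seq (grid t h (index t h kap p.1), p.2) | p <- v] | p.1 <= grid t h M] =
          [seq p <- [seq (grid t h (index t h kap p.1), p.2) | p <- v] | p.1 <= T].
  apply: eq_in_filter => p /mapP[q _ ->] /=; have /andP[h1 h2] := hM.
  rewrite grid_le//; case: (leqP _ M) => qM.
    by rewrite (le_trans _ h1)// grid_le.
  by apply/esym/negbTE; rewrite -ltNge (lt_le_trans h2)// grid_le.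
rewrite (requests_of_filter (fun x => x <= T)).
rewrite (requests_of_map (fun k x b => grid t h (index t h kap x))).
rewrite (@gstate_filter _ _ _ _ _ _ _ _ _ (fun x => x <= T)); last first.
  by move=> x xs; exact: le_trans sT.
have vT' q : q \in requests_of k v -> t <= q.1 <= T.
  by case: q => [x b]; rewrite mem_requests_of => /vT.
apply: (@gstate_perturb _ _ _ _ _ _ _ _ _ (fun x => grid t h (index t h kap x))) => //.
  move=> q /vT' /andP[tq qT]; have /andP[h1 h2] := grid_index h0 kap0 tq.
  have H1 : 0 <= kap * (q.1 - t) by rewrite mulr_ge0 ?subr_ge0// ltW.
  have H2 : kap * (q.1 - t) <= kap * (T - t) by rewrite ler_pM2l// lerD2r.
  by rewrite /e; apply/andP; split; lra.
by move=> [x b]; rewrite mem_requests_of => /vs.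
Qed.

Definition window (u : R) (s : R) : R := (u <= s < u + e)%R%:R.

Definition windows v s : R :=
  \sum_(p <- v) (window p.1 s + window (p.1 + req_delay p.2) s).

(** Outside the windows the mode is unchanged and the progressions are close, which costs [e1];
    inside them the crude bound [B] is paid. *)
Lemma rounded_cost (d e1 B : R) v s y : e <= d ->
  (forall y a r r', progset a r -> progset a r' ->
    (forall k, `|r k 0 - r' k 0| <= d) -> `|f1eta N C E y a r - f1eta N C E y a r'| <= e1) ->
  (forall y a a' r r', progset a r -> progset a' r' ->
    f1eta N C E y a r <= f1eta N C E y a' r' + B) ->
  0 <= e1 -> 0 <= B ->
  served t T a r v -> t <= s <= T ->
  let v' := decode t h (encode t h kap M v) in
  f1eta N C E y (mode_at t a r v' s) (prog_at t a r v' s) <=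
  f1eta N C E y (mode_at t a r v s) (prog_at t a r v s) + e1 + B * windows v s.
Proof.
move=> ed hd hB e10 B0 sv tsT /=; set v' := decode _ _ _.
have /andP[ts sT] := tsT.
have p' := state_progset hr v' ts; have p := state_progset hr v ts.
have w0 u : 0 <= window u s by [].
have [al|] := boolP (all (fun p => ~~ (p.1 <= s < p.1 + e) &&
                   ~~ (p.1 + req_delay p.2 <= s < p.1 + req_delay p.2 + e)) v).
  have H := fun k => rounded_gstate k sv tsT (fun p => allP al p).
  have eqm : mode_at t a r v' s = mode_at t a r v s.
    by apply: functional_extensionality_dep => k; have [] := H k.
  rewrite eqm in p' *.
  have := hd y _ _ _ p' p (fun k => le_trans (proj2 (H k)) ed).
  rewrite ler_norml => /andP[_].
  have : 0 <= B * windows v s.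
    by rewrite mulr_ge0// sumr_ge0// => q _; rewrite addr_ge0.
  lra.
rewrite -has_predC => /hasP[q qv /= qw].
suff : B <= B * windows v s by have := hB y _ _ _ _ p' p; lra.
rewrite ler_peMr// /windows (big_rem q qv)/=.
have : 1 <= window q.1 s + window (q.1 + req_delay q.2) s.
  move: qw; rewrite negb_and !negbK /window => /orP[] -> /=.
    by rewrite lerDl.
  by rewrite lerDr.
have : 0 <= \sum_(p <- rem q v) (window p.1 s + window (p.1 + req_delay p.2) s).
  by rewrite sumr_ge0// => p'' _; rewrite addr_ge0.
lra.
Qed.

Lemma measurable_windows v D : measurable_fun D (fun s => (windows v s)%:E).
Proof.
apply/measurable_EFinP; apply: measurable_sum => p; apply: measurable_funD.
  by apply/measurable_EFinP; exact: measurable_window.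
by apply/measurable_EFinP; exact: measurable_window.
Qed.

Lemma integral_windows v : served t T a r v ->
  (\int[mu]_(s in `[t, T]) (windows v s)%:E <= (2 * e * (size v)%:R)%:E)%E.
Proof.
move=> [_ vT _].
have e0 : 0 < e by apply: ltr_wpDl => //; rewrite mulr_ge0 ?subr_ge0// ltW.
have w0 u s : 0 <= window u s by [].
have W u : t <= u -> (\int[mu]_(s in `[t, T]) (window u s)%:E <= e%:E)%E.
  move=> tu; rewrite integral_window//; last 2 first.
  - by rewrite ltrDl.
  - by rewrite (le_lt_trans tu)// ltrDl.
  rewrite lee_fin; case: ifP => _; first exact: ltW.
  by rewrite (max_r tu) lerBlDl ge_min lexx orbT.
under eq_integral do rewrite /windows -sumEFin.
rewrite ge0_integral_sum//; last 2 first.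
- move=> p; apply/measurable_EFinP; apply: measurable_funD;
  by apply/measurable_EFinP; exact: measurable_window.
- by move=> p s _; rewrite lee_fin addr_ge0.
have -> : 2 * e * (size v)%:R = \sum_(p <- v) (e + e).
  by rewrite big_const_seq count_predT iter_addr_0 -[RHS]mulr_natr; congr (_ * _); ring.
rewrite -sumEFin big_seq [leRHS]big_seq; apply: lee_sum => p /vT /andP[tp _].
under eq_integral do rewrite EFinD.
rewrite ge0_integralD//; try exact: measurable_window; try by move=> s _; rewrite lee_fin.
rewrite EFinD leeD// W//.
by rewrite (le_trans tp)// lerDl ltW// delay_gt0//; exact: valP.
Qed.

Lemma rounded_request_cost v :
  \sum_(p <- decode t h (encode t h kap M v)) req_cost p.2 <= \sum_(p <- v) req_cost p.2 :> R.
Proof.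
rewrite decode_encode// big_filter big_map big_mkcond /=; apply: ler_sum => p _.
by case: ifP => // _; apply: swcost_ge0; exact: valP.
Qed.

End rounded.

(* The mode jumps, but there are boundedly many requests. *)
Lemma rounding_cost (C0 eps : R) : 0 < eps -> 0 <= C0 ->
  (forall y a r, progset a r -> 0 <= f1eta N C E y a r + C0) ->
  exists h kap : R, [/\ 0 < h, 0 < kap,
    forall k (b : switch F k), h <= kap * delay k (val b) &
    forall M v (y g : R -> R), grid t h M <= T < grid t h M.+1 -> served t T a r v ->
      let v' := decode t h (encode t h kap M v) in
      let f1 u s := f1eta N C E (y s) (mode_at t a r u s) (prog_at t a r u s) in
      measurable_fun `[t, T] (f1 v') ->
      (forall s, t <= s <= T -> f1 v s <= g s) ->
      (\int[mu]_(s in `[t, T]) (f1 v' s + C0)%:E <=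
       \int[mu]_(s in `[t, T]) (g s)%:E + (eps + C0 * (T - t))%:E)%E].
Proof.
move=> eps0 C00 hC0.
have [d0 d00 hd0] := delay_lower_bound F.
have [B B0 HB] := f1eta_mode_bound N C E.
have l0 : 0 <= T - t by rewrite subr_ge0.
(* Half of [eps] pays for uniform continuity over the whole horizon, the other half for at most
   [2 * n] windows of length at most [e2]. As [n] bounds the number of requests of every served
   strategy, [h] and [kap] can be chosen before the sample point. *)
pose e1 := eps / 2 / (1 + (T - t)).
have e10 : 0 < e1 by rewrite !divr_gt0// ltr_wpDr.
have [d dp Hd] := f1eta_unif_continuous N C E e10.
pose n : R := nG%:R * (1 + (T - t) / d0).
have n0 : 0 <= n by rewrite mulr_ge0// addr_ge0// divr_ge0// ltW.
pose e2 := Num.min d (eps / 2 / (1 + 2 * B * n)).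
have Bn : 0 <= 2 * B * n by apply: mulr_ge0 => //; exact: mulr_ge0.
have e20 : 0 < e2 by rewrite lt_min dp /= !divr_gt0// ltr_wpDr.
(* The second bound is [kap * d0], so that the dilation makes up for the rounding at every
   switch. *)
pose h := Num.min (e2 / 2) (e2 / 2 / (1 + (T - t)) * d0).
pose kap := e2 / 2 / (1 + (T - t)).
have kap0 : 0 < kap by rewrite !divr_gt0// ltr_wpDr.
have h0 : 0 < h by rewrite lt_min divr_gt0//= mulr_gt0.
have he : kap * (T - t) + h <= e2.
  have : h <= e2 / 2 by rewrite ge_min lexx.
  have : kap * (T - t) <= e2 / 2.
    rewrite /kap mulrAC ler_pdivrMr ?ltr_wpDr// ler_pM2l ?divr_gt0//.
    by rewrite lerDr.
  lra.
exists h, kap; split=> // [k b|M v y g hM sv v' f1 mf1 f1g].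
  by rewrite (@le_trans _ _ (kap * d0))// ?ge_min ?lexx ?orbT// ler_pM2l.
have ed : kap * (T - t) + h <= d by rewrite (le_trans he)// ge_min lexx.
pose k s : \bar R := (e1 + C0 + B * windows h kap v s)%:E.
have mk : measurable_fun `[t, T] k.
  apply/measurable_EFinP; apply: measurable_funD => //; apply: measurable_funM => //.
  by apply/measurable_EFinP; exact: measurable_windows.
have w0 s : 0 <= windows h kap v s.
  by apply: sumr_ge0 => p _; rewrite addr_ge0// /window.
apply: (@integral_le_perturbation _ _ R mu `[t, T]%classic _ _ k (eps + C0 * (T - t))) => //.
- by apply/measurable_EFinP; apply: measurable_funD.
- move=> s /=; rewrite in_itv /= => /andP[ts _]; rewrite lee_fin; apply: hC0.
  exact: state_progset.
- by move=> s _; rewrite /k lee_fin ltry andbT; apply: addr_ge0; [apply: addr_ge0 => //; exact: ltW|exact: mulr_ge0].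
- move=> s /=; rewrite in_itv /= => tsT; rewrite -EFinB lee_fin.
  have Hd' y' a' r' r'' (p' : progset a' r') (p'' : progset a' r'')
      (H : forall k, `|r' k 0 - r'' k 0| <= d) :
      `|f1eta N C E y' a' r' - f1eta N C E y' a' r''| <= e1.
    by apply: Hd => //; rewrite subrr normr0 ltW.
  have := rounded_cost h0 kap0 hM (y s) ed Hd' HB (ltW e10) B0 sv tsT.
  have := f1g s tsT; rewrite /f1 /v'; set u := f1eta _ _ _ _ _ _; set u' := f1eta _ _ _ _ _ _.
  move: (windows h kap v s) (g s) u u' => ????; lra.
- rewrite /k; under eq_integral do rewrite EFinD (EFinM B).
  rewrite ge0_integralD//; last 3 first.
  + by move=> s _; rewrite lee_fin; apply: addr_ge0 => //; exact: ltW e10.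
  + by move=> s _; rewrite -EFinM lee_fin; exact: mulr_ge0.
  + by apply: measurable_funeM; exact: measurable_windows.
  rewrite ge0_integralZl//; last 2 first.
  + exact: measurable_windows.
  + by move=> s _; rewrite lee_fin.
  rewrite integral_cst//= lebesgue_measure_itv /=.
  have I1 : ((e1 + C0)%:E * (if t%:E < T%:E then T%:E - t%:E else 0) <=
             (eps / 2 + C0 * (T - t))%:E)%E.
    have p0 : 0 <= C0 * (T - t) by exact: mulr_ge0.
    case: ifP => _; last by rewrite mule0 lee_fin; lra.
    rewrite -EFinB -EFinM lee_fin mulrDl lerD2r /e1 mulrAC ler_pdivrMr ?ltr_wpDr//.
    by rewrite ler_pM2l ?divr_gt0// lerDr.
  apply: (le_trans (leeD I1 (lee_pmul _ _ (lexx B%:E) (integral_windows h0 kap0 sv)))).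
  + by rewrite lee_fin.
  + by apply: integral_ge0 => s _; rewrite lee_fin.
  have H1 : (size v)%:R <= n by exact: served_size hd0 sv.
  have H2 : B * (2 * (kap * (T - t) + h) * (size v)%:R) <= e2 * (2 * B * n).
    have -> : B * (2 * (kap * (T - t) + h) * (size v)%:R) =
      (kap * (T - t) + h) * (2 * B * (size v)%:R) by ring.
    apply: ler_pM => //; first by apply: addr_ge0; [apply: mulr_ge0 => //; exact: ltW|exact: ltW].
      by apply: mulr_ge0 => //; exact: mulr_ge0.
    by rewrite ler_wpM2l//; exact: mulr_ge0.
  have H3 : e2 * (2 * B * n) <= eps / 2.
    apply: (@le_trans _ _ (eps / 2 / (1 + 2 * B * n) * (2 * B * n))).
      by rewrite ler_wpM2r// ge_min lexx orbT.
    rewrite mulrAC ler_pdivrMr ?ltr_wpDr// ler_pM2l ?divr_gt0//.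
    by rewrite lerDr.
  by rewrite -EFinM -EFinD lee_fin; lra.
Qed.

End rounding_cost.

(** * Lifting events to two copies of the sample space *)

Section natural_filtrations.
Context (R : realType) d (Om : measurableType d).

Lemma natural_filtration_sigma (I : Type) (Y : I -> R -> Om -> R) s :
  sigma_algebra setT (natural_filtration Y s).
Proof. exact: smallest_sigma_algebra. Qed.

Lemma natural_filtration_mono (I : Type) (Y : I -> R -> Om -> R) s s' : s <= s' ->
  natural_filtration Y s `<=` natural_filtration Y s'.
Proof.
move=> ss'; apply: smallest_sub; first exact: smallest_sigma_algebra.
move=> _ [i [u [B [/andP[u0 us] mB ->]]]]; apply: sub_sigma_algebra.
by exists i, u, B; rewrite u0 (le_trans us).
Qed.

End natural_filtrations.

Section two_copies.
Context (R : realType) d (Om : measurableType d) (n : nat).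
Context (W : R -> Om -> 'cV[R]_n) (i0 : 'I_n) (U : R -> Om -> R) (c : R).
Context (WU : forall s w, W s w i0 0 = c * U s w).
Notation T1 := (g_sigma_algebraType (gens_at W (pred1 i0) [set u | 0 <= u])).
Notation T2 := (g_sigma_algebraType (gens_at W (predC (pred1 i0)) [set u | 0 <= u])).

(* Events of the product of two copies of the sample space that depend on the  *)
(* noise [U] up to time [s] in the first copy and, measurably, on the other    *)
(* noises in the second one.                                                   *)
Definition causal (s : R) : set (set (Om * Om)) :=
  [set B | (forall w' : Om, natural_filtration (fun _ : unit => U) s [set w | B (w, w')]) /\
           measurable (B : set (T1 * T2))].

Lemma causal_sigma s : sigma_algebra setT (causal s).
Proof.
have N := natural_filtration_sigma (fun _ : unit => U) s.
split.
- by split=> [w'|]; [case: N => N0 _ _|exact: measurable0].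
- move=> A [hA mA]; split=> [w'|].
    by have := sigma_setC N (hA w'); rewrite setTD.
  by rewrite setTD; exact: measurableC.
- move=> A hA; split=> [w'|].
    have [_ _ NU] := N.
    rewrite (_ : [set w | _] = \bigcup_k [set w | A k (w, w')]).
      by apply: NU => k; case: (hA k).
    by apply/seteqP; split=> w [k _ Ak]; exists k.
  by apply: bigcupT_measurable => k; case: (hA k).
Qed.

Lemma causal_mono s s' : s <= s' -> causal s `<=` causal s'.
Proof.
by move=> ss' A [hA mA]; split=> // w'; apply: natural_filtration_mono (hA w').
Qed.

(** The events that can be lifted form a sigma-algebra. A generator is lifted by reading coordinate
    [i0] on the first copy and any other coordinate on the second, where it becomes constant once
    [w'] is fixed. *)
Lemma causal_lift s A : natural_filtration (coords W) s A ->
  exists2 B, causal s B & forall w, B (w, w) <-> A w.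
Proof.
pose S : set (set Om) := [set A | exists2 B, causal s B & forall w, B (w, w) <-> A w].
suff : natural_filtration (coords W) s `<=` S by move=> /[apply].
have CS := causal_sigma s.
apply: smallest_sub.
  split.
  - by exists set0; first by case: CS.
  - move=> B [B' cB' BB']; exists (~` B'); first exact: (sigma_setC CS).
    by move=> w; rewrite setTD /=; split=> nB /BB'.
  - move=> B hB; have hB' k := cid2 (hB k).
    exists (\bigcup_k sval (cid2 (hB k))).
      by case: CS => _ _; apply=> k; case: cid2.
    move=> w; split=> -[k _ Bk]; exists k => //.
      by move: Bk; case: cid2 => B' /= _ /(_ w) [].
    by case: cid2 => B' /= _ /(_ w) [_]; apply.
move=> _ [i [u [B [/andP[u0 us] mB ->]]]].
have [e|ne] := eqVneq i i0.
  exists [set z | B (W u z.1 i0 0)]; last by rewrite e.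
  split=> [w'|].
    apply: sub_sigma_algebra; exists tt, u, ((fun x => c * x) @^-1` B); split.
    - by rewrite u0.
    - by rewrite -[X in measurable X]setTI; apply: (_ : measurable_fun setT _) => //; exact: measurable_funM.
    - by apply/seteqP; split=> w /=; rewrite WU.
  have m : measurable_fun setT (fun w : T1 => W u w i0 0).
    by apply: gens_at_adapted => //=.
  have := measurableT_comp m (@measurable_fst _ _ T1 T2).
  by move=> /(_ measurableT B mB); rewrite setTI.
exists [set z | B (W u z.2 i 0)] => //.
split=> [w'|].
  by have := sigma_const (natural_filtration_sigma (fun _ : unit => U) s) (B (W u w' i 0)).
have m : measurable_fun setT (fun w : T2 => W u w i 0).
  by apply: gens_at_adapted => //=.
have := measurableT_comp m (@measurable_snd _ _ T1 T2).
by move=> /(_ measurableT B mB); rewrite setTI.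
Qed.

End two_copies.

(** * The control read off from lifted announcements *)

Section selected_control.
Context (R : realType) (nG : nat) (F : fleet R nG).
Context (t T : R) (a : mode F) (r : 'cV[R]_nG) (hr : progset a r).
Context (h kap : R) (h0 : 0 < h) (kap0 : 0 < kap).
Context (h_delay : forall k (b : switch F k), h <= kap * delay k (val b)).
Context (Z : Type) (B : nat -> seq (nat * request F) -> set Z).
Notation sel := (select B (acceptable t T a r h) [::]).

(** Every accepted list is served, whatever the sets [B]; this is what makes the control admissible
    off the diagonal too. *)
Lemma select_served i z : served t T a r (decode t h (sel i z)).
Proof.
elim: i => [|i ih]; last by case: (select_step B (acceptable t T a r h) [::] i z) => [->|[]].
exact: served_of_allowed.
Qed.

Lemma select_lt i z : {in sel i z, forall p, (p.1 < i)%N}.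
Proof.
elim: i => [//|i ih] p.
by case: (select_step B (acceptable t T a r h) [::] i z) => [->/ih/leqW//|[+ _ _]]; apply.
Qed.

(** Decisions are never revised: a later list only adds requests of later dates. *)
Lemma select_prefix i j z : (i <= j)%N -> [seq p <- sel j z | (p.1 < i)%N] = sel i z.
Proof.
elim: j => [|j ih].
  by rewrite leqn0 => /eqP ->.
rewrite leq_eqVlt => /predU1P[->|].
  by apply/all_filterP/allP => p; exact: select_lt.
rewrite ltnS => ij; rewrite -(ih ij).
case: (select_step B (acceptable t T a r h) [::] j z) => [->//|[_ <- _]].
rewrite -filter_predI; apply: eq_filter => p /=.
by case: (ltnP p.1 i) => // pi; rewrite (leq_trans pi).
Qed.

(** When exactly one list is announced at each date and it is the encoding of a served strategy, it
    extends the previous one acceptably and is followed at every date. *)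
Lemma select_encode M z v : served t T a r v -> grid t h M <= T ->
  (forall i l, (i <= M)%N -> B i l z <-> encode t h kap i v = l) ->
  sel M.+1 z = encode t h kap M v.
Proof.
move=> sv MT HB; suff H i : (i <= M.+1)%N -> sel i z = encode_before t h kap i v by exact: (H M.+1).
elim: i => [//|i ih] iM; apply: select_follow => [l|].
  by rewrite HB//; split=> ->.
rewrite ih; last exact: ltnW.
by apply: encode_acceptable => //; apply: le_trans MT; rewrite grid_le.
Qed.

Lemma select_levels_top (S : nat -> set (set Z)) M i (Q : seq (nat * request F) -> Prop) :
  (forall i, sigma_algebra setT (S i)) -> (forall i, S i `<=` S i.+1) ->
  (forall i l, (i <= M)%N -> S i (B i l)) ->
  S i [set z | Q [seq p <- sel M.+1 z | (p.1 <= i)%N]].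
Proof.
move=> hS mS SB.
have SL j : (j <= M)%N -> S j [set z | Q (sel j.+1 z)].
  move=> jM; apply: (sigma_of_levels (hS j)) => l.
  by apply: (@select_levels _ _ S hS mS B _ _ M.+1) => //.
have [iM|Mi] := leqP i M.
  rewrite (_ : [set z | _] = [set z | Q (sel i.+1 z)]); first exact: SL.
  by apply/seteqP; split=> z /=; rewrite (@select_prefix i.+1 M.+1).
rewrite (_ : [set z | _] = [set z | Q (sel M.+1 z)]).
  (* After the last date nothing is added, so the event of date [M] is carried forward by
     monotonicity. *)
  have -> : i = (M + (i - M))%N by rewrite subnKC// ltnW.
  elim: (i - M)%N => [|j ih]; first by rewrite addn0; exact: SL.
  by rewrite addnS; exact: mS.
apply/seteqP; split=> z; rewrite /mkset (_ : [seq p <- _ | _] = sel M.+1 z)//;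
  apply/all_filterP/allP => p /(@select_lt M.+1 z p); rewrite ltnS => pM; exact: leq_trans pM (ltnW Mi).
Qed.

End selected_control.

Lemma at_right_ex (R : realType) (s : R) (Q : R -> Prop) : (\forall u \near s^'+, Q u) ->
  exists2 dl : R, 0 < dl & forall u, s < u < s + dl -> Q u.
Proof.
rewrite /at_right /within /= => /nbhs_ballP[dl /= dl0 H]; exists dl => // u /andP[su us].
by apply: H => //; rewrite /ball /= ltr_norml; apply/andP; split; lra.
Qed.

(** * Cost of the frozen control *)

Section projected_cost.
Context (R : realType) (disp : measure_display) (Om : measurableType disp)
  (P : probability Om R) (nG nL nc : nat) (F : fleet R nG) (N : network F nL nc)
  (C : costs F nc) (X : demand P nL) (E : projection R nG nL).
Context (Zeta : R -> R -> R -> Om -> R) (hZeta : eta_ou X E Zeta).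
Context (t : R) (ht : 0 <= t <= horizon X) (a : mode F) (r : 'cV[R]_nG) (hr : progset a r).
Context (C0 : R) (hC0 : forall y a r, progset a r -> 0 <= f1eta N C E y a r + C0).
Notation mu := (@lebesgue_measure R).
Notation T := (horizon X).
Implicit Types (v : strategy F).

Definition path_f1eta (y : R -> R) v s : R :=
  f1eta N C E (y s) (mode_at t a r v s) (prog_at t a r v s).

(** The demand path and the requests are separate arguments because, after freezing, the demand is
    read on the first copy alone while the requests depend on both. *)
Definition projected_cost (y : R -> R) v : \bar R :=
  (\int[mu]_(s in `[t, T]) (path_f1eta y v s + C0)%:E + (\sum_(p <- v) req_cost p.2)%:E)%E.

Lemma path_f1eta_right y v : {within `[t, T], continuous y} ->
  forall s, t <= s < T -> forall e : R, 0 < e ->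
  exists2 dl : R, 0 < dl & forall u, s < u < s + dl -> u <= T ->
    `|path_f1eta y v u - path_f1eta y v s| <= e.
Proof.
move=> cy s sT e e0; have /andP[ts _] := sT.
have [d d0 Hd] := f1eta_unif_continuous N C E e0.
have [d1 d10 H1] := within_right_continuous cy sT d0.
have [d2 d20 H2] := at_right_ex (state_right a r v ts).
exists (Num.min d (Num.min d1 d2)); first by rewrite !lt_min d0 d10.
move=> u /andP[su]; rewrite -ltrBlDl !lt_min => /and3P[ud ud1 ud2] uT.
have [eqm Hp] : mode_at t a r v u = mode_at t a r v s /\
    forall k, `|prog_at t a r v u k 0 - prog_at t a r v s k 0| <= u - s.
  by apply: H2; rewrite su -ltrBlDl.
have pu := state_progset hr v (le_trans ts (ltW su)).
rewrite /path_f1eta; rewrite eqm in pu *; apply: Hd => //.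
- exact: state_progset.
- by apply: H1 => //; rewrite su -ltrBlDl.
- by move=> k; rewrite (le_trans (Hp k))// ltW.
Qed.

Lemma path_f1eta_ge0 y v s : t <= s -> 0 <= path_f1eta y v s + C0.
Proof. by move=> ts; apply: hC0; exact: state_progset. Qed.

Lemma projected_cost_ge0 y v : (0 <= projected_cost y v)%E.
Proof.
apply: adde_ge0.
  apply: integral_ge0 => s /=; rewrite in_itv /= => /andP[ts _].
  by rewrite lee_fin path_f1eta_ge0.
by rewrite lee_fin; apply: sumr_ge0 => p _; apply: swcost_ge0; exact: valP.
Qed.

Lemma f1eta_continuous a' r' : progset a' r' -> continuous (fun y => f1eta N C E y a' r').
Proof.
move=> hr' y; apply/cvgrPdist_le => e e0.
have [d d0 Hd] := f1eta_unif_continuous N C E e0.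
near=> z; apply: Hd => //; last by move=> k; rewrite subrr normr0 ltW.
Unshelve. all: by end_near. Qed.

Lemma measurable_path_f1eta y v : {within `[t, T], continuous y} ->
  measurable_fun `[t, T] (path_f1eta y v).
Proof.
move=> cy; have /andP[t0 tT] := ht.
apply: (@measurable_path _ Om R t T tT (fun s _ => path_f1eta y v s) _ _ point).
- by move=> s _; exact: measurable_cst.
- by move=> _; exact: path_f1eta_right.
Qed.

Lemma measurable_projected_cost d' (T' : measurableType d') (phi : T' -> Om) x v :
  (forall u, 0 <= u -> measurable_fun setT (fun w => Weta X E u (phi w))) ->
  measurable_fun setT (fun w => projected_cost (fun s => eta_demand_from X E Zeta t x s (phi w)) v).
Proof.
move=> mW; have /andP[t0 tT] := ht.
apply: emeasurable_funD => //.
apply: (@measurable_integral_process _ T' R t T tT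
  (fun s w => path_f1eta (fun s => eta_demand_from X E Zeta t x s (phi w)) v s + C0)).
- move=> s sT; apply: measurable_funD => //.
  apply: (@measurableT_comp _ _ _ _ _ _ (fun y => f1eta N C E y (mode_at t a r v s) (prog_at t a r v s))).
    apply: continuous_measurable_fun; apply: f1eta_continuous; apply: state_progset => //.
    by have /andP[] := sT.
  exact: eta_demand_measurable.
- move=> w s sT e e0.
  have cy : {within `[t, T], continuous (fun s => eta_demand_from X E Zeta t x s (phi w))}.
    exact: eta_demand_continuous.
  have [dl dl0 H] := path_f1eta_right v cy sT e0; exists dl => // u us uT.
  by rewrite opprD addrACA subrr addr0; exact: H.
- by move=> s w /andP[ts _]; exact: path_f1eta_ge0.
Qed.

End projected_cost.

Section shift.
Local Open Scope ereal_scope.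
Context d (T : measurableType d) (R : realType) (mu : {measure set T -> \bar R}).

(** Undoes the shift by [C0] under an integrand [g] that may fail to be measurable; an infinite
    integral of [h] is set apart because subtraction requires integrability. *)
Lemma integral_shift_le (D : set T) (g h : T -> \bar R) (c m : R) : measurable D ->
  mu D = m%:E -> measurable_fun D h -> (forall x, D x -> 0 <= h x) ->
  (forall x, D x -> g x <= h x - c%:E) ->
  \int[mu]_(x in D) g x <= \int[mu]_(x in D) h x - (c * m)%:E.
Proof.
move=> mD Dm mh h0 gh; apply: (le_trans (le_integral_pointwise mu gh)).
have h00 : 0 <= \int[mu]_(x in D) h x by exact: integral_ge0.
have [hy|hy] := ltP (\int[mu]_(x in D) h x) +oo; last first.
  by move: hy; rewrite leye_eq => /eqP ->; rewrite addye// leey.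
rewrite integralB//; first by rewrite integral_cst// Dm -EFinM.
- apply/integrableP; split=> //.
  rewrite (_ : \int[mu]_(x in D) `|h x| = \int[mu]_(x in D) h x)//.
  by apply: eq_integral => x; rewrite inE => /h0/gee0_abs.
- apply/integrableP; split=> //.
  by rewrite integral_cst// Dm /= -EFinM ltry.
Qed.

End shift.

Theorem theorem4p8 (R : realType) (disp : measure_display)
    (Omega : measurableType disp) (P : probability Omega R)
    (nG nL nc : nat) (hnG : (0 < nG)%N) (hnL : (0 < nL)%N)
    (F : fleet R nG) (N : network F nL nc) (C : costs F nc)
    (X : demand P nL) (E : projection R nG nL)
    (Zeta : R -> R -> R -> Omega -> R) (hZeta : eta_ou X E Zeta)
    (t : R) (ht : 0 <= t <= horizon X) (x : 'cV[R]_nL) (a : mode F)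
    (r : 'cV[R]_nG) (hr : progset a r) :
  (Veta X N C E Zeta t (dot (etaL E) x) a (total_prog r) <= V X N C t x a r)%E.
Proof.
have /andP[t0 tT] := ht; set T := horizon X in tT *.
have [i0 [W' [c [bW' sub c0 WU]]]] := align_eta X E hnL.
apply: le_ereal_inf_tmp => _ [v [vs _ vb va vk] <-].
apply/lee_addgt0Pr => e e0.
(* A finite cost is needed below, for the average over the sections to be finite. *)
have [->|Jy] := eqVneq (J X N C t x a r v) +oo%E; first by rewrite addye// leey.
have [C0 C00 hC0] := f1eta_lower_bound N C E.
have e2 : 0 < e / 2 by rewrite divr_gt0.
have [h [kap [h0 kap0 hd round]]] := rounding_cost tT hr e2 C00 hC0.
have sv w : served t T a r (v w).
  by have [srt vT] := vs w; apply: served_of_allowed => //; exact: va.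
pose M := Num.truncn ((T - t) / h).
have hM : grid t h M <= T < grid t h M.+1.
  have d0 : 0 <= (T - t) / h by rewrite divr_ge0 ?subr_ge0// ltW.
  have /andP[m1 m2] := truncn_itv d0.
  rewrite /grid; move: m1 m2; rewrite ler_pdivlMr// ltr_pdivrMr// -/M => m1 m2.
  by apply/andP; split; lra.
have /andP[MT _] := hM.
have gT i : (i <= M)%N -> grid t h i <= T.
  by move=> iM; apply: le_trans MT; rewrite grid_le.
pose G1 := gens_at W' (pred1 i0) [set u : R | 0 <= u].
pose G2 := gens_at W' (predC (pred1 i0)) [set u : R | 0 <= u].
pose T1 := g_sigma_algebraType G1; pose T2 := g_sigma_algebraType G2.
(* [B (i, l)] lifts the event that the list announced at date [i] is [l]; nothing is asked after the
   last date [M]. *)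
have /boolp.choice[B HB] (il : nat * seq (nat * request F)) : exists B : set (Omega * Omega),
    (il.1 <= M)%N -> causal W' i0 (Weta X E) (grid t h il.1) B /\
      forall w, B (w, w) <-> encode t h kap il.1 (v w) = il.2.
  move: il => [i l] /=; have [iM|_] := leqP i M; last by exists set0.
  have := @encode_level _ _ _ t T h kap h0 kap0 _ _ (demand_filtration X) v i l.
  move=> /(_ (natural_filtration_sigma _) (@natural_filtration_mono _ _ _ _ _) vs vb t0 (gT i iM)).
  have gi : 0 <= grid t h i <= T by rewrite gT// andbT (le_trans t0)// grid_ge.
  by move=> /(sub _ gi)/(causal_lift WU)[B cB HB]; exists B => _; split=> // w; exact: HB.
pose Bc i l := B (i, l).
pose L i z := select Bc (acceptable t T a r h) [::] i z.
have Lserved z : served t T a r (decode t h (L M.+1 z)) by exact: select_served.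
have Ldiag w : L M.+1 (w, w) = encode t h kap M (v w).
  apply: (select_encode h0 kap0 hd (sv w) MT) => i l iM; have [_ H] := HB (i, l) iM.
  exact: H.
have cS i := causal_sigma W' i0 (Weta X E) (grid t h i).
have cmono i : causal W' i0 (Weta X E) (grid t h i) `<=` causal W' i0 (Weta X E) (grid t h i.+1).
  by apply: causal_mono; rewrite grid_le.
have Llev i Q : causal W' i0 (Weta X E) (grid t h i)
    [set z | Q [seq p <- L M.+1 z | (p.1 <= i)%N]].
  apply: (@select_levels_top _ _ _ t T a r h _ Bc (fun i => causal W' i0 (Weta X E) (grid t h i))) => // j l jM.
  by have [] := HB (j, l) jM.
(* The control in which the noises other than [Weta] are frozen at [w']. *)
pose u w' w := relax t a r (decode t h (L M.+1 (w, w'))).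
have adm w' : radmissible (eta_filtration X E) t T a (total_prog r) (u w').
  apply: relax_radmissible => //.
  - exact: natural_filtration_sigma.
  - exact: natural_filtration_mono.
  - by move=> i Q; have [H _] := Llev i Q; exact: H.
pose y w s := eta_demand_from X E Zeta t (dot (etaL E) x) s w.
pose f (z : T1 * T2) := projected_cost N C X E t a r C0 (y z.1) (decode t h (L M.+1 z)).
have f0 z : (0 <= f z)%E by exact: projected_cost_ge0.
have cy w : {within `[t, T], continuous (y w)} by exact: eta_demand_continuous.
have mU s : 0 <= s -> measurable_fun setT (fun w : T1 => Weta X E s w).
  move=> s0; rewrite (_ : (fun w : T1 => Weta X E s w) = (fun w => c^-1 * W' s w i0 0)).
    by apply: measurable_funM => //; apply: gens_at_adapted => //=.
  by apply/funext => w; rewrite WU mulKf.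
(* The selected list takes countably many values, and where it is fixed the cost varies only with
   the demand, that is with the first copy. *)
have mf : measurable_fun setT f.
  move=> _ A mA; rewrite setTI.
  have -> : f @^-1` A = \bigcup_l ([set z | L M.+1 z = l] `&`
      (fun z : T1 * T2 => projected_cost N C X E t a r C0 (y z.1) (decode t h l)) @^-1` A).
    apply/seteqP; split=> z /=; first by move=> fA; exists (L M.+1 z).
    by move=> [l _ [/= <-]].
  have mS := @sigma_algebra_measurable _ (T1 * T2)%type.
  apply: (sigma_bigcup_count mS) => l; apply: measurableI.
    have pre z : [seq p <- L M.+1 z | (p.1 <= M)%N] = L M.+1 z.
      exact: (select_prefix t T a r h Bc z (leqnn M.+1)).
    rewrite (_ : [set z | _] = [set z | [seq p <- L M.+1 z | (p.1 <= M)%N] = l]).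
      by have [_] := Llev M (fun l' => l' = l).
    by apply/seteqP; split=> z; rewrite /mkset pre.
  have m : measurable_fun setT (fun w : T1 => projected_cost N C X E t a r C0 (y w) (decode t h l)).
    exact: (measurable_projected_cost hZeta ht hr hC0 (phi := (id : T1 -> Omega))).
  have m2 : measurable_fun setT (fun z : T1 * T2 =>
      projected_cost N C X E t a r C0 (y z.1) (decode t h l)).
    exact: (measurableT_comp m (@measurable_fst _ _ T1 T2)).
  by rewrite -[X in measurable X]setTI; exact: m2.
have G1m : <<s G1 >> `<=` measurable by exact: (gens_at_measurable bW' (fun u h' => h')).
have G2m : <<s G2 >> `<=` measurable by exact: (gens_at_measurable bW' (fun u h' => h')).
have id1 : measurable_fun setT (id : Omega -> T1).
  by move=> _ A mA; rewrite setTI; exact: G1m.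
have id2 : measurable_fun setT (id : Omega -> T2).
  by move=> _ A mA; rewrite setTI; exact: G2m.
have mdiag : measurable_fun setT (fun w : Omega => f (w, w)).
  apply: (measurableT_comp mf (_ : measurable_fun setT (fun w : Omega => (w, w) : T1 * T2))).
  exact: measurable_fun_pair.
have msec w' : measurable_fun setT (fun w : Omega => f (w, w')).
  apply: (measurableT_comp mf (_ : measurable_fun setT (fun w : Omega => (w, w') : T1 * T2))).
  by apply: measurable_fun_pair => //; exact: measurable_cst.
pose K := C0 * (T - t).
have K0 : 0 <= K by rewrite mulr_ge0// subr_ge0.
(* On the diagonal the selected control is the rounded one: rounding costs [e / 2], and [K] is the
   shift [C0] accumulated over the horizon. *)
have diag : (\int[P]_w f (w, w) <= J X N C t x a r v + (e / 2 + K)%:E)%E.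
  apply: (@integral_le_perturbation _ _ _ _ _ _ _ (cst (e / 2 + K)%:E)) => //.
  - by move=> w _; rewrite lee_fin ltry andbT addr_ge0// ltW.
  - move=> w _; rewrite /cst leeBlDr// /f /projected_cost Ldiag [leRHS]addeAC.
    apply: leeD; last by rewrite lee_fin; exact: rounded_request_cost.
    apply: (round M (v w) (y w) _ hM (sv w)).
      exact: measurable_path_f1eta.
    move=> s /andP[ts sT]; rewrite /y -eta_demandE ?ts//.
    by apply: f1eta_le_run_cost; exact: state_progset.
  - rewrite integral_cst//.
    rewrite -[leRHS]mule1 le_eqVlt; apply/orP; left; apply/eqP; congr (_ * _)%E.
    exact: probability_setT.
(* Valid for every [w']: the shift is removed, and [f2eta] is below [f1eta] along the actual
   progressions. *)
have sect w' : (Jeta X N C E Zeta t (dot (etaL E) x) a (total_prog r) (u w') <=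
    \int[P]_w f (w, w') - K%:E)%E.
  rewrite -[K in leRHS]mulr1.
  apply: integral_shift_le => //; first exact: probability_setT.
  move=> w _; set l := decode t h (L M.+1 (w, w')).
  have -> : \sum_(p <- (u w' w).1) req_cost p.2 = \sum_(p <- l) req_cost p.2 by rewrite big_map.
  rewrite /f /projected_cost -/l [leRHS]addeAC; apply: leeD => //.
  apply: integral_shift_le => //.
  - rewrite /= lebesgue_measure_itv /= lte_fin; case: ltP => [_|Tt]; first by rewrite EFinB.
    by have -> : T - t = 0 by apply/eqP; rewrite subr_eq0 eq_le Tt tT.
  - apply/measurable_EFinP; apply: measurable_funD => //; exact: measurable_path_f1eta.
  - move=> s /=; rewrite in_itv /= => /andP[ts _]; rewrite lee_fin; exact: path_f1eta_ge0.
  - move=> s /=; rewrite in_itv /= => /andP[ts _].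
    rewrite -EFinB addrK /u relax_mode_at (relax_prog_at hr (Lserved (w, w')) ts); apply: f2eta_le.
    exact: state_progset.
have Jlt : (J X N C t x a r v < +oo)%E by rewrite ltey.
have G12 : indep P (<<s G1 >>) (<<s G2 >>) by exact: indep_processes.
have G1m' : G1 `<=` measurable by move=> A GA; apply: G1m; exact: sub_sigma_algebra.
have G2m' : G2 `<=` measurable by move=> A GA; apply: G2m; exact: sub_sigma_algebra.
(* The other half of [e] is spent on the choice of [w']. *)
have [|w' Hw'] := exists_good_section G1m' G2m' G12 mf f0 e2.
  by apply: (le_lt_trans diag); rewrite lte_add_pinfty// ltry.
apply: (@le_trans _ _ (Jeta X N C E Zeta t (dot (etaL E) x) a (total_prog r) (u w'))).
  by apply: ereal_inf_lbound; exists (u w').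
apply: (le_trans (sect w')); rewrite leeBlDr//.
apply: (le_trans Hw'); apply: (le_trans (leeD2r _ diag)).
rewrite -addeA -EFinD -[leRHS]addeA -EFinD; apply: leeD2l; rewrite lee_fin; lra.
Qed.
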